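(* Let $G$ be a block caterpillar. Then $B(G)=\beta(G)$. Furthermore, suppose $G$ is equipped with distinguished vertices $v_0,\dots,v_{k+2}$ and cliques $Q_0,\dots,Q_{k+1}$ as described in the context, and let $m$ be an integer with $\beta(G)\le m$. Then $G$ has a left-justified $m$-representation (with respect to these distinguished vertices), and such a representation is produced by an algorithm running in time linear in the size of $G$.
   Context: All graphs are finite and simple; a leaf is a vertex of degree $1$. A block graph is a graph in which every block is a clique. A block path is a block graph with $k$ cutvertices and $k+1$ blocks in which the cutvertices induce a path. A block caterpillar is a block graph in which deleting the leaves produces a block path. For an injection $f\colon V(G)\to\mathbb{Z}$ (a numbering; $f(x)$ is the position of $x$), $B(f)=\max_{uv\in E(G)}|f(u)-f(v)|$, and $B(G)=\min_f B(f)$. With $n(H)=|V(H)|$, the local density is $\beta(G)=\max_H\lceil (n(H)-1)/\operatorname{diam}H\rceil$ over connected subgraphs $H\subseteq G$ with at least two vertices. An $m$-representation of $G$ is a numbering $f$ with $|f(u)-f(v)|\le m$ for every edge $uv$. A numbering is faithful if whenever $f(x)<f(y)$ and $u,v$ are leaves adjacent to $x,y$ respectively, then $f(u)<f(v)$. For a vertex $v$, $L(v)$ denotes the set of leaves of $G$ adjacent to $v$; for a set $S$, $N(S)$ is the set of vertices having a neighbor in $S$. Distinguished vertices: let $Q_1,\dots,Q_k$ ($k\ge 1$) be the consecutive blocks of the block path obtained from $G$ by deleting its leaves, and for $2\le i\le k$ let $v_i$ be the vertex shared by $Q_{i-1}$ and $Q_i$. Suppose $v_1\in Q_1$ and $v_{k+1}\in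 Q_k$ are vertices with $v_1\ne v_2$ and $v_{k+1}\ne v_k$ (when $k=1$: $v_1\neq v_2$ are two vertices of $Q_1$), each having at least one leaf neighbor in $G$. Choose a leaf $v_0$ adjacent to $v_1$ and a leaf $v_{k+2}$ adjacent to $v_{k+1}$, and set $Q_0=\{v_0,v_1\}$, $Q_{k+1}=\{v_{k+1},v_{k+2}\}$. Left-justified: let $J_i=\{im+1,\dots,(i+1)m-1\}$; $J_i$ is full if every integer in $J_i$ is the position of some vertex. A left-justified $m$-representation is a faithful $m$-representation $f$ such that for $0\le i\le k+1$: (0) $f(v_i)=im$, and also $f(v_{k+2})=(k+2)m$; (1) all occupied positions in $J_i$ precede all unoccupied positions in $J_i$; (2) if $J_i$ is not full then $f(N(Q_i))\cap J_{i+1}=\emptyset$; (3) all positions of vertices of $Q_i\setminus\{v_{i+1}\}$ precede all positions of vertices of $L(v_{i+1})$.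
   Formalization: In left-justified (2), N(Q_i) excludes vertices of Q_{i+1}, which (0) may force into J_{i+1}; in (3), v_0 is not required to precede itself; the second part assumes G connected, since a K_2 component admits no faithful numbering. As literally stated the claim fails in these cases. *)

(* Defs.v *)
From mathcomp Require Import all_boot all_order all_algebra.
From mathcomp Require Import boolp.

Set Implicit Arguments.
Unset Strict Implicit.
Unset Printing Implicit Defensive.

Import Order.TTheory GRing.Theory Num.Theory.

Record sgraph := SGraph {
  vertex :> finType;
  adj : rel vertex;
  adj_sym : symmetric adj;
  adj_irr : irreflexive adj
}.
Arguments adj {s}.

Section Graphs.
Variable G : sgraph.
Implicit Types (A B S : {set G}) (x y u v : G).

Definition nbhd S : {set G} := [set x | [exists y in S, adj x y]].
Definition leaves : {set G} := [set x | #|[set y | adj x y]| == 1].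
Definition leaves_at v : {set G} := [set u in leaves | adj v u].
Definition core : {set G} := ~: leaves.

Definition edges : {set {set G}} :=
  [set [set p.1; p.2] | p : G * G & adj p.1 p.2].
Definition graph_size : nat := #|G| + #|edges|.

(* A set A of vertices stands for the induced subgraph G[A]. *)

Definition induced A : rel G := [rel x y | [&& x \in A, y \in A & adj x y]].
Definition components A : nat := n_comp (induced A) A.
Definition connected A : bool := components A == 1.
Definition cutvertices A : {set G} :=
  [set x in A | components A < components (A :\ x)].

(* Blocks are maximal connected subgraphs without a cutvertex of their own;
   these are induced, so a block is given by its vertex set. In particular
   an isolated vertex is a block. *)
Definition nonseparable S : bool := connected S && (cutvertices S == set0).
Definition blocks A : {set {set G}} :=
  [set B | maxset (fun S => (S \subset A) && nonseparable S) B].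

Definition clique S : Prop := {in S &, forall x y, x != y -> adj x y}.
Definition block_graph A : Prop := forall B, B \in blocks A -> clique B.

(* The empty set induces the path on no vertices. *)
Definition induces_path S : Prop :=
  exists s : seq G, [/\ uniq s, s =i S &
    forall i j x0, i < size s -> j < size s ->
      adj (nth x0 s i) (nth x0 s j) = (i == j.+1) || (j == i.+1)].

Definition block_path A : Prop :=
  [/\ block_graph A, #|blocks A| = #|cutvertices A|.+1 &
      induces_path (cutvertices A)].

Definition block_caterpillar : Prop := block_graph setT /\ block_path core.

(* Not necessarily induced subgraphs: H.1 is the vertex set, H.2 the set of
   edges, each taken in both orientations. *)
Definition subgraph (H : {set G} * {set G * G}) : bool :=
  [forall x, forall y, ((x, y) \in H.2) ==>
     [&& x \in H.1, y \in H.1, adj x y & (y, x) \in H.2]].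
Definition sub_rel (H : {set G} * {set G * G}) : rel G :=
  [rel x y | (x, y) \in H.2].
Definition sub_connected (H : {set G} * {set G * G}) : bool :=
  n_comp (sub_rel H) H.1 == 1.

(* Length of a shortest r-path (#|G| if there is none). *)
Definition dist (r : rel G) x y : nat :=
  find (fun d => [exists p : d.-tuple G, path r x p && (last x p == y)])
       (iota 0 #|G|).
Definition diam (H : {set G} * {set G * G}) : nat :=
  \max_(x in H.1) \max_(y in H.1) dist (sub_rel H) x y.

Definition ceil_div (n d : nat) : nat := (n + d.-1) %/ d.

(* The maximum over the empty family is 0. *)
Definition local_density : nat :=
  \max_(H : {set G} * {set G * G} |
        [&& subgraph H, sub_connected H & 2 <= #|H.1|])
    ceil_div (#|H.1| - 1) (diam H).

(* B(f), for a numbering, i.e. an injection, f. *)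
Definition width (f : G -> int) : nat :=
  \max_(p : G * G | adj p.1 p.2) `|(f p.1 - f p.2)%R|%N.

Lemma bandwidth_subproof :
  exists b : nat, `[< exists2 f : G -> int, injective f & width f = b >].
Proof.
pose f (x : G) : int := Posz (enum_rank x).
exists (width f); apply/asboolP; exists f => // x y [] /ord_inj.
exact: enum_rank_inj.
Qed.

Definition bandwidth : nat := ex_minn bandwidth_subproof.

Local Open Scope ring_scope.

Definition representation (m : int) (f : G -> int) : Prop :=
  injective f /\ forall x y, adj x y -> `|f x - f y| <= m.

Definition faithful (f : G -> int) : Prop :=
  forall x y u v, f x < f y -> u \in leaves_at x -> v \in leaves_at y ->
    f u < f v.

Record distinguished (k : nat) (v : nat -> G) (Q : nat -> {set G}) : Prop := {
  dist_k : (1 <= k)%N;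
  dist_Q_inj : {in [pred i | 1 <= i <= k]%N &, injective Q};
  dist_Q_blocks : forall B, B \in blocks core <->
                    exists2 i, (1 <= i <= k)%N & B = Q i;
  dist_v_mid : forall i, (2 <= i <= k)%N -> Q i.-1 :&: Q i = [set v i];
  dist_v_first : v 1%N \in Q 1%N;
  dist_v_last : v k.+1 \in Q k;
  dist_v_first_neq : v 1%N != v 2%N;
  dist_v_last_neq : v k.+1 != v k;
  dist_leaf_first : v 0%N \in leaves_at (v 1%N);
  dist_leaf_last : v k.+2 \in leaves_at (v k.+1);
  dist_Q_first : Q 0%N = [set v 0%N; v 1%N];
  dist_Q_last : Q k.+1 = [set v k.+1; v k.+2]
}.

Definition inJ (m : int) (i : nat) (p : int) : Prop :=
  i%:Z * m + 1 <= p <= i.+1%:Z * m - 1.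
Definition occupied (f : G -> int) (p : int) : Prop := exists x, f x = p.
Definition fullJ (m : int) (f : G -> int) (i : nat) : Prop :=
  forall p, inJ m i p -> occupied f p.

(* In lj_overflow the vertices of Q_{i+1} are excluded from N(Q_i): those
   other than v_{i+1} and v_{i+2} are adjacent to both of these, so lj_v
   forces them into J_{i+1} whether or not J_i is full. The only other
   vertices of N(Q_i) that can have a position in J_{i+1} are leaves.
   In lj_clique_first the condition x != y only concerns i = 0 and
   x = y = v_0, which lies both in Q_0 and in L(v_1). *)
Record left_justified (k : nat) (v : nat -> G) (Q : nat -> {set G})
    (m : int) (f : G -> int) : Prop := {
  lj_repr : representation m f;
  lj_faithful : faithful f;
  lj_v : forall i, (i <= k.+2)%N -> f (v i) = i%:Z * m;
  lj_left : forall i, (i <= k.+1)%N -> forall p q, inJ m i p -> inJ m i q ->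
    occupied f p -> ~ occupied f q -> p < q;
  lj_overflow : forall i, (i <= k.+1)%N -> ~ fullJ m f i ->
    forall x, x \in nbhd (Q i) -> ((i <= k)%N -> x \notin Q i.+1) ->
      ~ inJ m i.+1 (f x);
  lj_clique_first : forall i, (i <= k.+1)%N ->
    forall x y, x \in Q i :\ v i.+1 -> y \in leaves_at (v i.+1) -> x != y ->
      f x < f y
}.

End Graphs.

(* Algorithms are programs of a unit-cost random access machine over the
   integers, whose only arithmetic operations are addition and subtraction,
   with finitely many integer registers and finitely many integer-indexed
   integer arrays, initially 0 outside the input. A program is fixed
   independently of its input, so its expressions have bounded size and
   charging 1 per executed assignment, store or test is unit cost up to a
   constant factor. *)

Inductive expr :=
| Lit of int
| Reg of nat
| Read of nat & expr
| Plus of expr & expr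
| Minus of expr & expr.

Inductive cmd :=
| Skip
| Assign of nat & expr
| Store of nat & expr & expr
| Seq of cmd & cmd
| If of expr & cmd & cmd
| While of expr & cmd.

Record state := State { regs : nat -> int; arrs : nat -> int -> int }.

Fixpoint eval (s : state) (e : expr) : int :=
  match e with
  | Lit z => z
  | Reg r => regs s r
  | Read a e1 => arrs s a (eval s e1)
  | Plus e1 e2 => (eval s e1 + eval s e2)%R
  | Minus e1 e2 => (eval s e1 - eval s e2)%R
  end.

Definition set_reg (s : state) (r : nat) (z : int) : state :=
  State (fun r' => if r' == r then z else regs s r') (arrs s).
Definition set_arr (s : state) (a : nat) (j z : int) : state :=
  State (regs s)
    (fun a' j' => if (a' == a) && (j' == j) then z else arrs s a' j').

(* exec c s t s': started in s, c halts in s' after t steps. A test on e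
   succeeds iff e is positive. *)
Inductive exec : cmd -> state -> nat -> state -> Prop :=
| ExecSkip s : exec Skip s 1 s
| ExecAssign r e s : exec (Assign r e) s 1 (set_reg s r (eval s e))
| ExecStore a e1 e2 s :
    exec (Store a e1 e2) s 1 (set_arr s a (eval s e1) (eval s e2))
| ExecSeq c1 c2 s s1 s2 t1 t2 :
    exec c1 s t1 s1 -> exec c2 s1 t2 s2 -> exec (Seq c1 c2) s (t1 + t2) s2
| ExecIfTrue e c1 c2 s s1 t :
    (0 < eval s e)%R -> exec c1 s t s1 -> exec (If e c1 c2) s t.+1 s1
| ExecIfFalse e c1 c2 s s1 t :
    (eval s e <= 0)%R -> exec c2 s t s1 -> exec (If e c1 c2) s t.+1 s1
| ExecWhileTrue e c s s1 s2 t1 t2 :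
    (0 < eval s e)%R -> exec c s t1 s1 -> exec (While e c) s1 t2 s2 ->
    exec (While e c) s (t1 + t2).+1 s2
| ExecWhileFalse e c s :
    (eval s e <= 0)%R -> exec (While e c) s 1 s.

Definition array_of (l : seq nat) (j : int) : int :=
  match j with Posz n => Posz (nth 0 l n) | Negz _ => 0%R end.

(* An arbitrary ordering vs of the vertices and, for each vertex, an arbitrary
   ordering of its neighbors; vertices are named by their index in vs. *)
Definition adjacency_lists (G : sgraph) (vs : seq G) (nb : G -> seq G) : Prop :=
  perm_eq vs (enum G) /\ forall x, perm_eq (nb x) (enum [set y | adj x y]).

(* Registers: 0 holds the number of vertices, 1 holds k, 2 holds m.
   Arrays: array 1 is the concatenation of the neighbor lists of the vertices,
   in the order of vs, and the list of the j-th vertex starts at the offset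
   stored in cell j of array 0; array 2 lists v_0, ..., v_{k+2}. The cliques
   Q_i are not part of the input. *)
Definition input (G : sgraph) (vs : seq G) (nb : G -> seq G)
    (k : nat) (v : nat -> G) (m : int) : state :=
  State
    (fun r => match r with
              | 0 => Posz #|G| | 1 => Posz k | 2 => m | _ => 0%R
              end)
    (fun a => match a with
              | 0 => array_of (0 :: scanl addn 0 [seq size (nb x) | x <- vs])
              | 1 => array_of [seq index y vs | y <- flatten (map nb vs)]
              | 2 => array_of [seq index (v i) vs | i <- iota 0 k.+3]
              | _ => fun=> 0%R
              end).

(* The position of the j-th vertex is returned in cell j of array 3. *)
Definition output (G : sgraph) (vs : seq G) (s : state) : G -> int :=
  fun x => arrs s 3 (Posz (index x vs)).

(* Main.v *)
(* Since f changes by at most B(f) along an edge, n(H) - 1 <= B(f) diam(H) for every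
   connected subgraph H, so B(G) >= beta(G). Conversely, given m >= beta(G), put
   v_i at im and treat the blocks between consecutive v_i from left to right.
   Only one number is carried from block to block: the number of leaves not yet
   placed, counted negatively when places are left free. It satisfies
   x_{i+1} = max(x_i + Lambda_i, 0) + c_i + lambda_i - (m - 1), where c_i counts the
   vertices of Q_i other than v_i and v_{i+1}, Lambda_i their leaves, and lambda_i
   the leaves of v_{i+1}. Unfolding this back to the last j where the maximum was 0,
   x_{i+1} + c_{i+1} <= m - 1 is the local density bound for the subgraph spanned by
   v_j, ..., v_{i+2}, the other vertices of Q_j, ..., Q_{i+1}, and the leaves
   in between; so there is always room for the clique. Within a block the leaves are
   ordered like their neighbors, and the clique vertices are placed around the
   only one whose leaves straddle the end of the block, so that every leaf is
   within m of its neighbor; for this vertex the bound is the local density of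
   the clique with its leaves. Every position has a closed form in prefix sums,
   which a constant number of passes over the graph computes. *)

Require Import Defs.
From mathcomp Require Import all_boot all_order all_algebra.
From mathcomp Require Import zify boolp.

Set Implicit Arguments.
Unset Strict Implicit.
Unset Printing Implicit Defensive.

Import Order.TTheory GRing.Theory Num.Theory.

(** * Positions within a block *)

(** The vertices of block [i] do not just fill $J_i$: leaves of its hubs may sit in places left free
    at the end of $J_{i-1}$, and its last leaves may spill into $J_{i+1}$. Each block instead owns a
    cell, an interval with shifted ends; cells are disjoint and ordered, which gives injectivity and
    faithfulness across blocks and leaves arithmetic on offsets within one block. There the obstacle
    is that the order of the leaves is forced by that of the hubs, so only the hubs can be moved.
    Hubs whose leaves precede the end of the block go to its left, hubs whose leaves all spill go to
    its right, and the one between them needs a place within reach of both its first and its last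
    leaf; its clique and its leaves form a set of diameter 2, hence of at most $2m+1$ vertices, so
    such a place exists. The layout is defined from predicates and prefix sums over a list of
    vertices alone, so the same formulas serve the program. For $B(G)\le\beta(G)$ the end leaves
    $v_0$ and $v_{k+2}$ may be absent and the graph may be disconnected: flags describe the ends,
    and components $K_2$ are added afterwards. *)

Section BlockArithmetic.
Local Open Scope ring_scope.

(* The z-th place of a block not used by its first a hubs, when hubs 1, ..., a-1
   come first and hub a comes right after the h-th of these places. *)
Definition fill (a h z : int) : int := a - 1 + z + (if h < z then 1 else 0).

(** The hubs before hub [a] follow the [Num.max x 0] places taken by spilled leaves, and those after
    it take the last [d - a] places of the block. *)
Definition hub_off (m x d a h b : int) : int :=
  if b < a then Num.max x 0 + b else if b <= a then b + h else m - 1 - d + b.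

Definition bare_off (x a h j : int) : int := fill a h (Num.max x 0 + j).

(** How many leaves of the block, in their order, can lie before its end: a negative [x] adds the
    [- x] free places of the preceding block, a positive [x] removes the places of spilled
    leaves. *)
Definition room (m x d e : int) : int := m - 1 - (d + e) - x.

(** The cases are the free places at the end of the preceding block, the places behind the bare
    vertices, and the first places of the next block. The place [m] itself belongs to a spine
    vertex, so spilled offsets start at [m + 1]. *)
Definition leaf_off (m x d e a h q : int) : int :=
  if q <= - x then x + q - 1
  else if q <= room m x d e then fill a h (e + q + x)
  else m + q - room m x d e.

(** The maximum discards free places of the preceding block that the [L] hub leaves do not use: they
    are out of reach of the next spine vertex, so its [l] leaves cannot take them. *)
Definition spill (m x d e L l : int) : int :=
  Num.max (x + L) 0 + (d + e) + l - (m - 1).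

(** The first offset available to the block; offset [0] is reserved for a spine vertex. *)
Definition start_off (x : int) : int := if x < 0 then x else x + 1.

(** [F] leaves belong to hubs before hub [a] and [l] to hub [a]; the inequalities with [a - 1] and
    [d - a] hold because every other hub has a leaf. The last leaf of hub [a] has offset
    [m + (F + l - room m x d e)], and [a + h] is the smallest offset behind the earlier hubs that is
    within [m] of it. *)
Definition split_at (m x d e L a h : int) : Prop :=
  (a = d /\ h = Num.max x 0 /\ L <= room m x d e) \/
  (exists F l : int,
     [/\ 1 <= a <= d, a - 1 <= F, F + l + (d - a) <= L,
         F <= room m x d e < F + l & h = Num.max (Num.max x 0) (F + l - room m x d e - a)]).

Section Block.
Variables m x d e L l a h : int.
Hypotheses (d0 : 0 <= d) (e0 : 0 <= e) (L0 : 0 <= L) (l0 : 0 <= l).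
Hypotheses (m1 : 1 <= m) (cm : d + e <= m - 1) (xcm : x + (d + e) <= m - 1).
Hypotheses (xm : - (m - 1) <= x) (x'm : spill m x d e L l <= m - 1).
Hypothesis sp_ah : split_at m x d e L a h.

Let r : int := Num.max x 0.
Let x' : int := spill m x d e L l.

(** When [L < - x], the numbers from [L + 1] to [- x] stand for places of the preceding block that
    stay free; the leaves of the next spine vertex are numbered behind them. *)
Definition leaf_index (q : int) :=
  1 <= q /\ (q <= L \/ Num.max L (- x) < q) /\ q <= Num.max L (- x) + l.

Ltac ifs := repeat (case: ifP => ?).
Ltac unf := move: x'm;
  rewrite /leaf_off /bare_off /hub_off /leaf_index /fill /start_off /x' /r /spill /room.
Ltac cs := case: sp_ah => [[? [? +]]|[F [l1 []]]]; rewrite /room.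
Ltac go := unf; cs; ifs; lia.

Lemma hub_range (b : int) : 1 <= b <= d ->
  [/\ r < hub_off m x d a h b, hub_off m x d a h b <= m - 1 &
      hub_off m x d a h b < m + start_off x'].
Proof. by move=> hb; split; go. Qed.

Lemma bare_range (j : int) : 1 <= j <= e ->
  [/\ r < bare_off x a h j, bare_off x a h j <= m - 1 &
      bare_off x a h j < m + start_off x'].
Proof. by move=> hb; split; go. Qed.

Lemma leaf_range (q : int) : leaf_index q ->
  start_off x <= leaf_off m x d e a h q < m + start_off x'.
Proof. by go. Qed.

Lemma leaf_where (q : int) : leaf_index q ->
  [\/ q <= - x /\ - m + 1 <= leaf_off m x d e a h q <= - 1,
      - x < q <= room m x d e /\ r + 1 <= leaf_off m x d e a h q <= m - 1 |
      room m x d e < q /\ m + 1 <= leaf_off m x d e a h q <= m + m - 1].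
Proof.
move=> hq; case: (ltP (- x) q) => q1; last by constructor 1; split; [lia|move: hq; go].
case: (leP q (room m x d e)) => q2; [constructor 2|constructor 3]; (split; [lia|]);
  move: hq q1 q2; go.
Qed.

Lemma leaf_mono (q q' : int) : 1 <= q -> q < q' ->
  leaf_off m x d e a h q < leaf_off m x d e a h q'.
Proof. by go. Qed.

Lemma hub_mono (b b' : int) : 1 <= b -> b < b' -> b' <= d ->
  hub_off m x d a h b < hub_off m x d a h b'.
Proof. by go. Qed.

Lemma bare_mono (j j' : int) : 1 <= j -> j < j' -> j' <= e ->
  bare_off x a h j < bare_off x a h j'.
Proof. by go. Qed.

Lemma hub_neq_bare (b j : int) : 1 <= b <= d -> 1 <= j <= e ->
  hub_off m x d a h b != bare_off x a h j.
Proof. by go. Qed.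

Lemma hub_neq_leaf (b q : int) : 1 <= b <= d -> leaf_index q ->
  hub_off m x d a h b != leaf_off m x d e a h q.
Proof. by go. Qed.

Lemma bare_neq_leaf (j q : int) : 1 <= j <= e -> leaf_index q ->
  bare_off x a h j != leaf_off m x d e a h q.
Proof. by go. Qed.

(** Left-justification rests on this. Apart from the hubs before [a], hub [a] and the later hubs,
    every offset is [fill a h z] for some [z], which belongs to a bare vertex if [z <= r + e] and
    otherwise to leaf number [z - e - x]. *)
Lemma block_onto (p : int) : r < p -> p <= m - 1 -> p <= m - 1 + x' ->
  [\/ exists2 b : int, 1 <= b <= d & p = hub_off m x d a h b,
      exists2 j : int, 1 <= j <= e & p = bare_off x a h j |
      exists2 q : int, leaf_index q & p = leaf_off m x d e a h q].
Proof.
move=> p1 p2 p3.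
have onto (z : int) : r < z -> z <= m - 1 - d -> p = fill a h z -> 
  [\/ exists2 b : int, 1 <= b <= d & p = hub_off m x d a h b,
      exists2 j : int, 1 <= j <= e & p = bare_off x a h j |
      exists2 q : int, leaf_index q & p = leaf_off m x d e a h q].
  move=> z1 z2 pz; case: (leP z (r + e)) => ze.
    constructor 2; exists (z - r); first lia.
    by rewrite pz /bare_off -/r (_ : r + (z - r) = z) //; lia.
  constructor 3; exists (z - e - x).
    move: p3 pz p1 p2 z1 z2 ze; go.
  rewrite pz /leaf_off ifF ?ifT; first by rewrite (_ : e + _ + x = z) //; lia.
    by rewrite /room; lia.
  by move: ze; rewrite /r; lia.
case: (ltP p (r + a)) => pa.
  constructor 1; exists (p - r); move: p1 pa; go.
case: (ltP p (a + h)) => ph.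
  apply: (onto (p - a + 1)); move: p1 p2 p3 pa ph; go.
case: (leP p (a + h)) => ph'.
  case: (leP a 0) => a0.
    apply: (onto p); move: p1 p2 p3 pa ph ph' a0; go.
  constructor 1; exists a; move: p1 p2 p3 pa ph ph' a0; go.
case: (leP p (m - 1 - d + a)) => pe.
  apply: (onto (p - a)); move: p1 p2 p3 pa ph ph' pe; go.
constructor 1; exists (p - (m - 1 - d)); move: p1 p2 p3 pa ph ph' pe; go.
Qed.

Lemma bare_before (j q : int) : 1 <= j <= e -> Num.max L (- x) < q ->
  leaf_index q -> bare_off x a h j < leaf_off m x d e a h q.
Proof. by go. Qed.

Lemma hub_before (b q : int) : 1 <= b <= d -> Num.max L (- x) < q ->
  leaf_index q -> hub_off m x d a h b < leaf_off m x d e a h q.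
Proof. by go. Qed.

End Block.

(** The reason depends on the place of [b]. For [b < a] all leaves precede the end of the block, and
    [b - 1 <= F] keeps those in the preceding block within reach. For [a < b] all leaves spill, and
    the bound on [spill] limits how far. For [b = a] the choice of [h] reaches the last leaf, and
    the first is reached because [w + (d + e) + 1 <= m + m], the density bound for a clique with the
    leaves of one vertex. *)
Lemma hub_leaf_near (m x d e L l a h b F w q : int) :
  1 <= m -> d + e <= m - 1 -> x + (d + e) <= m - 1 -> - (m - 1) <= x -> 0 <= l ->
  0 <= d -> 0 <= e -> spill m x d e L l <= m - 1 ->
  1 <= b <= d -> b - 1 <= F -> F + w + (d - b) <= L -> w + (d + e) + 1 <= m + m ->
  (a = d /\ h = Num.max x 0 /\ L <= room m x d e) \/
  (exists F0 l0 : int,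
     [/\ 1 <= a <= d, a - 1 <= F0, F0 + l0 + (d - a) <= L, F0 <= room m x d e < F0 + l0 &
         h = Num.max (Num.max x 0) (F0 + l0 - room m x d e - a)] /\
     [/\ b < a -> F + w <= F0, b = a -> F = F0 /\ w = l0 & a < b -> F0 + l0 <= F]) ->
  F < q -> q <= F + w ->
  `|hub_off m x d a h b - leaf_off m x d e a h q| <= m.
Proof.
rewrite /hub_off /leaf_off /fill.
move=> m1 cm xcm xm l0 d0 e0 x'm bd bF Fw N2 sp Fq qF; apply/ler_normlP.
rewrite /room /spill in sp x'm *.
case: sp => [[? [? ?]]|[F0 [l1 [[? ? ? ? ?] [lo eq hi]]]]].
  by split; repeat case: ifP => ?; lia.
case: (ltrgtP b a) => ba; [have ? := lo ba|have ? := hi ba|have [? ?] := eq ba];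
  by split; repeat case: ifP => ?; lia.
Qed.

End BlockArithmetic.

(** * Prefix sums along a list *)

Section PrefixSum.
Variable V : eqType.
Implicit Types (s : seq V) (g : V -> nat) (w : V).

Definition pre_sum s g w := \sum_(y <- take (index w s) s) g y.
Definition suf_sum s g w := \sum_(y <- drop (index w s).+1 s) g y.

Lemma pre_sum_split s g w : w \in s ->
  \sum_(y <- s) g y = pre_sum s g w + g w + suf_sum s g w.
Proof.
move=> ws; rewrite -{1}(cat_take_drop (index w s) s) big_cat /=.
by rewrite (drop_nth w) ?index_mem // big_cons nth_index // addnA.
Qed.

Lemma pre_sum_mono s g w w' : w' \in s -> index w s < index w' s ->
  pre_sum s g w + g w <= pre_sum s g w'.
Proof.
move=> ws lt_ww'.
have ws' : w \in s by rewrite -index_mem (ltn_trans lt_ww') // index_mem.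
have <- : \sum_(y <- take (index w s).+1 s) g y = pre_sum s g w + g w.
  by rewrite (take_nth w) ?index_mem // nth_index // -cats1 big_cat big_seq1.
by rewrite {1}/pre_sum -(subnKC lt_ww') takeD big_cat leq_addr.
Qed.

(** The intervals of length [g w] starting at [pre_sum s g w] tile the range below the total. This
    recovers a vertex from its rank, or the owner of a leaf from the number of the leaf. *)
Lemma pre_sum_find s g q : uniq s -> q < \sum_(y <- s) g y ->
  exists2 w, w \in s & pre_sum s g w <= q < pre_sum s g w + g w.
Proof.
elim: s q => [|w s IH] q /=; first by rewrite big_nil.
case/andP=> wNs us; rewrite big_cons; case: (ltnP q (g w)) => [qw _|qw qs].
  by exists w; rewrite ?mem_head // /pre_sum /= eqxx take0 big_nil.
have [|w' ws /andP[lo hi]] := IH (q - g w) us; first by rewrite ltn_subLR.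
have ne : w == w' = false by apply: contraNF wNs => /eqP->.
exists w'; first by rewrite inE ws orbT.
by rewrite /pre_sum /= ne /= big_cons; move: lo hi; rewrite /pre_sum; lia.
Qed.

Lemma pre_sum_le s g w : w \in s -> pre_sum s g w + g w <= \sum_(y <- s) g y.
Proof. by move/(pre_sum_split g)=> ->; rewrite leq_addr. Qed.

Lemma leq_pre_sum s g g' w : (forall y, g y <= g' y) ->
  pre_sum s g w <= pre_sum s g' w.
Proof. by move=> gg'; apply: leq_sum. Qed.

Lemma leq_suf_sum s g g' w : (forall y, g y <= g' y) ->
  suf_sum s g w <= suf_sum s g' w.
Proof. by move=> gg'; apply: leq_sum. Qed.

Lemma pre_sum_inj s g w w' q : w \in s -> w' \in s ->
  pre_sum s g w <= q < pre_sum s g w + g w ->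
  pre_sum s g w' <= q < pre_sum s g w' + g w' -> w = w'.
Proof.
move=> ws ws' /andP[l1 h1] /andP[l2 h2].
case: (ltngtP (index w s) (index w' s)) => [lt|lt|eq].
- by have := pre_sum_mono g ws' lt; lia.
- by have := pre_sum_mono g ws lt; lia.
- by rewrite -(nth_index w ws) eq nth_index.
Qed.

End PrefixSum.

(** * The layout *)

(* [sp] holds on the spine vertices v_i, [it] on the other vertices of the core
   and [lf] on the leaves off the spine, [par] maps a leaf to its neighbor, and
   [idx (v_i) = i]. Block [i] consists of the clique Q_i and its leaves; the leaves
   of v_{i+1} belong to block [i]. cell_start hub is a vertex of [it] with leaves, a bare
   vertex one without. *)
Section Layout.
Variables (V : eqType) (vs : seq V) (m : int).
Variables (sp it lf : pred V) (idx bk : V -> nat) (par : V -> V).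

(** Every count is a sum of such weights along [vs]; the rank of a vertex is then a prefix sum of
    the same weight, which one pass over the vertices computes. *)
Definition leafw p u : nat := lf u && (par u == p).
Definition lc p := \sum_(u <- vs) leafw p u.
Definition hubw i w : nat := [&& it w, bk w == i & 0 < lc w].
Definition barew i w : nat := [&& it w, bk w == i & lc w == 0].
Definition hubl i w := if it w && (bk w == i) then lc w else 0.
Definition spinew i u : nat := [&& lf u, sp (par u) & bk (par u) == i].
Definition nhub i := \sum_(w <- vs) hubw i w.
Definition nbare i := \sum_(w <- vs) barew i w.
Definition nhubl i := \sum_(w <- vs) hubl i w.
Definition nspine i := \sum_(u <- vs) spinew i u.

(* If positive, the number of leaves of the preceding blocks that are placed in
   block [i]; if negative, minus the number of places left free in block [i.-1],
   which the leaves of the hubs of block [i] then use first. *)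
Fixpoint load (i : nat) : int :=
  if i is j.+1 then spill m (load j) (nhub j) (nbare j) (nhubl j) (nspine j) else 0%R.

Definition hub_rank w := (pre_sum vs (hubw (bk w)) w).+1.
Definition bare_rank w := (pre_sum vs (barew (bk w)) w).+1.
Definition leaf_rank u := (pre_sum vs (leafw (par u)) u).+1.

Local Open Scope ring_scope.

(* The number of leaf places of the block preceding those of the leaves of w. *)
Definition first w : int :=
  if it w then Posz (pre_sum vs (hubl (bk w)) w)
  else Num.max (Posz (nhubl (bk w))) (- load (bk w)).
Definition leaf_pos u : int := first (par u) + Posz (leaf_rank u).

Variables a h : nat -> int.

Definition off x : int :=
  if it x then
    if (0 < lc x)%N then hub_off m (load (bk x)) (nhub (bk x)) (a (bk x)) (h (bk x)) (hub_rank x)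
    else bare_off (load (bk x)) (a (bk x)) (h (bk x)) (bare_rank x)
  else leaf_off m (load (bk (par x))) (nhub (bk (par x))) (nbare (bk (par x)))
         (a (bk (par x))) (h (bk (par x))) (leaf_pos x).

Definition block x := if it x then bk x else bk (par x).

Definition pos x : int :=
  if sp x then Posz (idx x) * m else Posz (block x) * m + off x.

(* The leaves of the critical hub straddle the end of the block. It has to stand
   far enough to the right to reach the last of them, hence the value of [h]. *)
Definition critical i w :=
  [&& it w, bk w == i & first w <= room m (load i) (nhub i) (nbare i) < first w + Posz (lc w)].

Definition splits i :=
  (a i = nhub i /\ h i = Num.max (load i) 0 /\ forall w, ~~ critical i w) \/
  (exists w, [/\ critical i w, a i = hub_rank w &
     h i = Num.max (Num.max (load i) 0)
            (first w + Posz (lc w) - room m (load i) (nhub i) (nbare i) - Posz (hub_rank w))]).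

Hypothesis vs_uniq : uniq vs.
Hypothesis vs_all : forall x, x \in vs.
Hypothesis sp_it : forall x, sp x -> ~~ it x.
Hypothesis sp_lf : forall x, sp x -> ~~ lf x.
Hypothesis it_lf : forall x, it x -> ~~ lf x.
Hypothesis idx_inj : {in sp &, injective idx}.
Hypothesis bk_sp : forall x, sp x -> bk x = (idx x).-1.
Hypothesis par_lf : forall u, lf u -> it (par u) || sp (par u) && (0 < idx (par u))%N.
Hypothesis m1 : 1 <= m.
Hypothesis small : forall i, Posz (nhub i) + nbare i <= m - 1.
Hypothesis load_small : forall i, load i + (Posz (nhub i) + nbare i) <= m - 1.
Hypothesis star_small : forall w, it w ->
  Posz (lc w) + (Posz (nhub (bk w)) + nbare (bk w)) + 1 <= m + m.
Hypothesis a_h : forall i, splits i.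

(** * Ranks and leaf numbers within a block *)

Lemma load_low i : - (m - 1) <= load i.
Proof. by case: i => [|i] /=; rewrite /spill; lia. Qed.

Lemma load_le i : load i <= m - 1.
Proof. have := load_small i; lia. Qed.

(** Every hub has at least one leaf, so [hubw] is bounded by [hubl]. Comparing the prefix sums of
    the two weights gives the third bound, comparing their suffix sums the fourth. *)
Lemma hub_ranges w : it w -> (0 < lc w)%N ->
  [/\ (pre_sum vs (hubl (bk w)) w + lc w <= nhubl (bk w))%N,
      (hub_rank w <= nhub (bk w))%N, (hub_rank w <= (pre_sum vs (hubl (bk w)) w).+1)%N &
      (pre_sum vs (hubl (bk w)) w + lc w + nhub (bk w) <= nhubl (bk w) + hub_rank w)%N].
Proof.
move=> iw lw.
have le y : (hubw (bk w) y <= hubl (bk w) y)%N.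
  by rewrite /hubw /hubl; case: (it y); case: (bk y == bk w) => //=; case: posnP.
have hw : hubw (bk w) w = 1 by rewrite /hubw iw eqxx lw.
have lw' : hubl (bk w) w = lc w by rewrite /hubl iw eqxx.
have := pre_sum_split (hubw (bk w)) (vs_all w).
have := pre_sum_split (hubl (bk w)) (vs_all w).
have := leq_pre_sum vs w le; have := leq_suf_sum vs w le.
rewrite /hub_rank -/(nhub _) -/(nhubl _) hw lw'; split; lia.
Qed.

Lemma bare_ranges w : it w -> lc w = 0 -> (bare_rank w <= nbare (bk w))%N.
Proof.
move=> iw lw; have := pre_sum_le (barew (bk w)) (vs_all w).
by rewrite -/(nbare _) {2}/barew iw eqxx lw /bare_rank addn1.
Qed.

(** [bk] is the predecessor of [idx], truncated at 0, so it separates spine vertices only when their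
    indices are positive. [par_lf] gives this for neighbors of leaves, and for [p] it is read off
    from one of its leaves. *)
Lemma nspineE p : sp p -> (0 < lc p)%N -> nspine (bk p) = lc p.
Proof.
move=> spp; rewrite lt0n => lp; apply: eq_bigr => u _; rewrite /spinew /leafw.
case lu: (lf u) => //=; congr (nat_of_bool _).
have [|u0 _] := @pre_sum_find _ vs (leafw p) 0 vs_uniq; first by rewrite lt0n.
rewrite /leafw; case: (boolP (lf u0 && _)) => [/andP[lu0 /eqP pu0] _|_ /andP[p1 p2]];
  last by move: (leq_ltn_trans p1 p2); rewrite addn0 ltnn.
have i0 : (0 < idx p)%N.
  by have := par_lf lu0; rewrite pu0 (negPf (sp_it spp)) spp.
apply/andP/eqP => [[spu /eqP eb]|->]; last by rewrite spp eqxx.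
apply: idx_inj; rewrite ?unfold_in //.
have := par_lf lu; rewrite (negPf (sp_it spu)) spu /= => iu.
by move: eb; rewrite !bk_sp //; lia.
Qed.

Lemma leaf_rank_le u : lf u -> (leaf_rank u <= lc (par u))%N.
Proof.
move=> lu; have := pre_sum_le (leafw (par u)) (vs_all u).
by rewrite {2}/leafw lu eqxx addn1.
Qed.

Lemma lc_par u : lf u -> (0 < lc (par u))%N.
Proof. by move/leaf_rank_le; apply: leq_trans. Qed.

Lemma leaf_pos_index u : lf u ->
  leaf_index (load (bk (par u))) (nhubl (bk (par u))) (nspine (bk (par u))) (leaf_pos u).
Proof.
move=> lu; have rl := leaf_rank_le lu; have lp := lc_par lu.
rewrite /leaf_index /leaf_pos /first; case: ifP => ip.
  have [? _ _ _] := hub_ranges ip lp; move: rl; rewrite /leaf_rank; lia.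
have /andP[spp _] : sp (par u) && (0 < idx (par u))%N by have := par_lf lu; rewrite ip.
by move: rl; rewrite -(nspineE spp lp) /leaf_rank; lia.
Qed.

Lemma room_ge0 i : 0 <= room m (load i) (nhub i) (nbare i).
Proof. rewrite /room; have := load_small i; lia. Qed.

Lemma hublP i w : (0 < hubl i w)%N -> [/\ it w, bk w = i, (0 < lc w)%N & hubl i w = lc w].
Proof. by rewrite /hubl; case: ifP => // /andP[-> /eqP->]. Qed.

Lemma find_hubl i q : (q < nhubl i)%N ->
  exists w, [/\ it w, bk w = i, (0 < lc w)%N &
    (pre_sum vs (hubl (bk w)) w <= q < pre_sum vs (hubl (bk w)) w + lc w)%N].
Proof.
move=> /(pre_sum_find vs_uniq)[w _ hq].
have [|iw bw lw e] := @hublP i w; first by move: hq; lia.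
by exists w; split; rewrite ?bw // -e.
Qed.

(** If more leaves existed, leaf number [room + 1] would belong to some hub, and that hub would be
    critical. *)
Lemma no_critical i : (forall w, ~~ critical i w) ->
  Posz (nhubl i) <= room m (load i) (nhub i) (nbare i).
Proof.
move=> nc; rewrite leNgt; apply/negP => lt; have r0 := room_ge0 i.
have [|w [iw bw lw hq]] := @find_hubl i `|room m (load i) (nhub i) (nbare i)|%N.
  by lia.
have /negP := nc w; apply; rewrite /critical iw bw eqxx /= /first iw.
by move: hq; lia.
Qed.

Lemma split_at_ok i :
  split_at m (load i) (nhub i) (nbare i) (nhubl i) (a i) (h i).
Proof.
case: (a_h i) => [[-> [-> nc]]|[w [/and3P[iw /eqP bw hq] -> ->]]].
  by left; do 2![split=> //]; apply: no_critical.
have lw : (0 < lc w)%N by lia.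
right; exists (first w), (Posz (lc w)); have := hub_ranges iw lw.
have r1 : (0 < hub_rank w)%N by [].
by move: hq; rewrite /first iw bw => hq [? ? ? ?]; split => //; lia.
Qed.

Lemma load_next i : load i.+1 =
  spill m (load i) (nhub i) (nbare i) (nhubl i) (nspine i).
Proof. by []. Qed.

Lemma unit_find (g : V -> bool) n : (n < \sum_(w <- vs) g w)%N ->
  exists2 w, g w & pre_sum vs g w = n.
Proof.
move=> /(pre_sum_find vs_uniq)[w _]; case E: (g w) => hq; last by move: hq; lia.
by exists w => //; move: hq; lia.
Qed.

Lemma hub_onto i b : (0 < b <= nhub i)%N ->
  exists w, [/\ it w, (0 < lc w)%N, bk w = i & hub_rank w = b].
Proof.
case: b => // b hb; have [w /and3P[iw /eqP bw lw] e] := unit_find hb.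
by exists w; split=> //; rewrite /hub_rank bw -e.
Qed.

Lemma bare_onto i b : (0 < b <= nbare i)%N ->
  exists w, [/\ it w, lc w = 0%N, bk w = i & bare_rank w = b].
Proof.
case: b => // b hb; have [w /and3P[iw /eqP bw /eqP lw] e] := unit_find hb.
by exists w; split=> //; rewrite /bare_rank bw -e.
Qed.

Lemma leaf_of_rank p n : (0 < n <= lc p)%N ->
  exists u, [/\ lf u, par u = p & leaf_rank u = n].
Proof.
case: n => // n hn; have [u /andP[lu /eqP pu] e] := unit_find hn.
by exists u; rewrite /leaf_rank pu -e.
Qed.

Lemma leaf_onto i q : leaf_index (load i) (nhubl i) (nspine i) q ->
  exists u, [/\ lf u, bk (par u) = i & leaf_pos u = q].
Proof.
case=> q1 [[qL|qL] qM].
  have [|w [iw bw lw hq]] := @find_hubl i `|q - 1|%N; first by lia.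
  have [|u [lu pu ru]] := @leaf_of_rank w (`|q - 1| - pre_sum vs (hubl (bk w)) w).+1.
    by lia.
  by exists u; rewrite pu bw /leaf_pos pu ru /first iw; split=> //; lia.
have n0 : (0 < nspine i)%N by lia.
have [u0 /and3P[lu0 spu0 /eqP bu0] _] := unit_find n0.
have := nspineE spu0 (lc_par lu0); rewrite bu0 => e.
have [|u [lu pu ru]] := @leaf_of_rank (par u0) `|q - Num.max (Posz (nhubl i)) (- load i)|%N.
  by rewrite -e; lia.
exists u; rewrite pu bu0 /leaf_pos pu ru /first bu0.
by rewrite (negPf (sp_it spu0)); split=> //; lia.
Qed.

(** Hub ranks and first leaf numbers are prefix sums along the same list, so both follow the order
    of [vs]. *)
Lemma hub_cmp w w' : it w -> it w' -> bk w = bk w' -> (0 < lc w)%N -> (0 < lc w')%N ->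
  [\/ w = w',
      (hub_rank w < hub_rank w')%N /\ first w + Posz (lc w) <= first w' |
      (hub_rank w' < hub_rank w)%N /\ first w' + Posz (lc w') <= first w].
Proof.
move=> iw iw' bb lw lw'.
have [hw hw'] : hubl (bk w') w = lc w /\ hubl (bk w') w' = lc w'.
  by rewrite /hubl iw iw' bb !eqxx.
have [h1 h1'] : hubw (bk w') w = 1%N /\ hubw (bk w') w' = 1%N.
  by rewrite /hubw iw iw' bb !eqxx lw lw'.
rewrite /first iw iw' /hub_rank bb.
case: (ltngtP (index w vs) (index w' vs)) => [lt|lt|eq].
- constructor 2; have := pre_sum_mono (hubw (bk w')) (vs_all w') lt.
  have := pre_sum_mono (hubl (bk w')) (vs_all w') lt; rewrite hw h1; lia.
- constructor 3; have := pre_sum_mono (hubw (bk w')) (vs_all w) lt.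
  have := pre_sum_mono (hubl (bk w')) (vs_all w) lt; rewrite hw' h1'; lia.
- by constructor 1; rewrite -(nth_index w (vs_all w)) eq nth_index.
Qed.

Lemma unit_inj (g : V -> bool) w w' : g w -> g w' -> pre_sum vs g w = pre_sum vs g w' -> w = w'.
Proof.
move=> gw gw' e; apply: (@pre_sum_inj _ vs g w w' (pre_sum vs g w)) => //.
  by rewrite gw; lia.
by rewrite e gw'; lia.
Qed.

Lemma bare_inj w w' : it w -> it w' -> bk w = bk w' -> lc w = 0%N -> lc w' = 0%N ->
  bare_rank w = bare_rank w' -> w = w'.
Proof.
move=> iw iw' bb lw lw'; rewrite /bare_rank bb => -[]; apply: unit_inj.
  by rewrite iw bb eqxx lw.
by rewrite iw' eqxx lw'.
Qed.

Lemma hub_inj w w' : it w -> it w' -> bk w = bk w' -> (0 < lc w)%N -> (0 < lc w')%N ->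
  hub_rank w = hub_rank w' -> w = w'.
Proof. by move=> iw iw' bb lw lw' e; case: (hub_cmp iw iw' bb lw lw') => // -[]; lia. Qed.

Lemma spine_par_eq u u' : lf u -> lf u' -> bk (par u) = bk (par u') ->
  ~~ it (par u) -> ~~ it (par u') -> par u = par u'.
Proof.
move=> lu lu' bb iu iu'.
have := par_lf lu; rewrite (negPf iu) => /andP[su i0].
have := par_lf lu'; rewrite (negPf iu') => /andP[su' i0'].
by apply: idx_inj => //; move: bb; rewrite !bk_sp //; lia.
Qed.

Lemma leaf_pos_inj u u' : lf u -> lf u' -> bk (par u) = bk (par u') ->
  leaf_pos u = leaf_pos u' -> u = u'.
Proof.
move=> lu lu' bb e.
have pp : par u = par u'.
  have l1 := lc_par lu; have l1' := lc_par lu'.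
  have r1 := leaf_rank_le lu; have r1' := leaf_rank_le lu'.
  move: e; rewrite /leaf_pos.
  case iu: (it (par u)); case iu': (it (par u')).
  - case: (hub_cmp iu iu' bb l1 l1') => // -[_]; rewrite /leaf_rank in r1 r1' *; lia.
  - have [? _ _ _] := hub_ranges iu l1; rewrite /first iu iu' -bb.
    by have : (0 < leaf_rank u')%N by []; lia.
  - have [? _ _ _] := hub_ranges iu' l1'; rewrite /first iu iu' bb.
    by have : (0 < leaf_rank u)%N by []; lia.
  - by move=> _; apply: spine_par_eq; rewrite ?iu ?iu'.
move: e; rewrite /leaf_pos /leaf_rank pp => e.
apply: (@unit_inj (fun y => lf y && (par y == par u'))); rewrite ?lu ?lu' ?pp ?eqxx //.
by rewrite /leafw in e *; lia.
Qed.

(** Block [i] lies between [cell_start i] and [cell_start i.+1]. A negative load moves the start of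
    the cell into the free end of the preceding block, a positive one moves it behind the spilled
    leaves. *)
Definition cell_start i : int := Posz i * m + start_off (load i).

Lemma cell_start_step i : cell_start i <= cell_start i.+1.
Proof.
have l1 : load i.+1 = spill m (load i) (nhub i) (nbare i) (nhubl i) (nspine i) by [].
have e : Posz i.+1 * m = Posz i * m + m by rewrite intS mulrDl mul1r addrC.
by rewrite /cell_start e l1 /start_off /spill; repeat case: ifP => ?; lia.
Qed.

Lemma cell_start_mono i j : (i <= j)%N -> cell_start i <= cell_start j.
Proof.
by move/subnKC <-; elim: (j - i)%N => [|n IH];
  rewrite ?addn0 // addnS (le_trans IH) ?cell_start_step.
Qed.

Ltac block_hyps i :=
  have := split_at_ok i; have := load_low i; have := load_le i.+1; have := load_small i;
  have := small i; rewrite load_next => sm1 ls1 ll1 lo1 sp1;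
  have d0 : 0 <= Posz (nhub i) by []; have e0 : 0 <= Posz (nbare i) by [];
  have L0 : 0 <= Posz (nhubl i) by []; have l0 : 0 <= Posz (nspine i) by [].

Lemma it_off_range x : it x ->
  [/\ Num.max (load (bk x)) 0 < off x, off x <= m - 1 &
      off x < m + start_off (load (bk x).+1)].
Proof.
move=> ix; rewrite /off ix; block_hyps (bk x).
case: ifPn => lx; last first.
  have lx0 : lc x = 0%N by apply/eqP; rewrite -leqn0 leqNgt.
  apply: (@bare_range _ _ (nhub (bk x)) (nbare (bk x)) (nhubl (bk x)) (nspine (bk x))) => //.
  by rewrite lez_nat bare_ranges.
have [_ ? _ _] := hub_ranges ix lx.
by apply: (@hub_range _ _ (nhub (bk x)) (nbare (bk x)) (nhubl (bk x)) (nspine (bk x))).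
Qed.

Lemma lf_off u : lf u -> off u = leaf_off m (load (bk (par u))) (nhub (bk (par u)))
  (nbare (bk (par u))) (a (bk (par u))) (h (bk (par u))) (leaf_pos u).
Proof. by move=> lu; rewrite /off ifN //; apply/negP => /it_lf; rewrite lu. Qed.

Lemma lf_block u : lf u -> block u = bk (par u).
Proof. by move=> lu; rewrite /block ifN //; apply/negP => /it_lf; rewrite lu. Qed.

Lemma it_block x : it x -> block x = bk x.
Proof. by rewrite /block => ->. Qed.

Lemma lf_off_where u (i := bk (par u)) : lf u ->
  [\/ leaf_pos u <= - load i /\ - m + 1 <= off u <= - 1,
      - load i < leaf_pos u <= room m (load i) (nhub i) (nbare i) /\
        Num.max (load i) 0 + 1 <= off u <= m - 1 |
      room m (load i) (nhub i) (nbare i) < leaf_pos u /\ m + 1 <= off u <= m + m - 1].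
Proof.
move=> lu; rewrite lf_off //; block_hyps i.
by apply: (@leaf_where _ _ _ _ (nhubl i) (nspine i)) => //; apply: leaf_pos_index.
Qed.

Definition placed x := it x || lf x.

Lemma off_range x : placed x ->
  start_off (load (block x)) <= off x < m + start_off (load (block x).+1).
Proof.
case/orP => [ix|lx].
  have [? ? ?] := it_off_range ix; rewrite it_block //.
  by apply/andP; split=> //; rewrite /start_off; case: ifP; lia.
rewrite lf_block // lf_off //; block_hyps (bk (par x)).
by apply: leaf_range => //; apply: leaf_pos_index.
Qed.

Lemma off_where x : placed x ->
  [|| - m + 1 <= off x <= - 1, 1 <= off x <= m - 1 | m + 1 <= off x <= m + m - 1].
Proof.
case/orP => [ix|lx]; first by have [? ? ?] := it_off_range ix; lia.
by case: (lf_off_where lx); lia.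
Qed.

Lemma placed_sp x : placed x -> sp x = false.
Proof.
by case/orP => [ix|lx]; apply/negP => spx; [have := sp_it spx|have := sp_lf spx];
  rewrite ?ix ?lx.
Qed.

Lemma posE x : placed x -> pos x = Posz (block x) * m + off x.
Proof. by move=> px; rewrite /pos placed_sp. Qed.

Lemma pos_range x : placed x -> cell_start (block x) <= pos x < cell_start (block x).+1.
Proof.
move=> px; have := off_range px; rewrite posE // /cell_start intS mulrDl mul1r; lia.
Qed.

Lemma pos_lt_block x y : placed x -> placed y -> (block x < block y)%N -> pos x < pos y.
Proof.
move=> px py lt; have /andP[_ hx] := pos_range px; have /andP[hy _] := pos_range py.
exact: lt_le_trans hx (le_trans (cell_start_mono lt) hy).
Qed.

Lemma off_inj x y : placed x -> placed y -> block x = block y -> off x = off y -> x = y.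
Proof.
(* By symmetry the mixed pair is only met with the core vertex first. *)
wlog: x y / it x || lf y.
  move=> W px py bb oo; case/orP: (px) => [ix|lx]; first by apply: W; rewrite ?ix.
  by apply/esym/W; rewrite ?lx ?orbT.
move=> xy px py; case/orP: (px) => [ix|lx]; last first.
  have ly : lf y by case/orP: xy => // ix; have := it_lf ix; rewrite lx.
  rewrite !lf_block // !lf_off // => bb oo; apply: leaf_pos_inj => //.
  have [p1 _] := leaf_pos_index lx; have [p1' _] := leaf_pos_index ly.
  rewrite -bb in oo; block_hyps (bk (par x)).
  case: (ltrgtP (leaf_pos x) (leaf_pos y)) => // lt.
    by have := leaf_mono d0 e0 L0 l0 m1 sm1 ls1 lo1 ll1 sp1 p1 lt; rewrite oo ltxx.
  by have := leaf_mono d0 e0 L0 l0 m1 sm1 ls1 lo1 ll1 sp1 p1' lt; rewrite oo ltxx.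
rewrite (it_block ix); case/orP: (py) => [iy|ly].
  rewrite (it_block iy) /off ix iy => bb; rewrite -bb; block_hyps (bk x).
  case: (posnP (lc x)) => lx; case: (posnP (lc y)) => ly oo.
  - apply: bare_inj => //; have := bare_ranges ix lx; have := bare_ranges iy ly.
    rewrite -bb => r1 r2; case: (ltngtP (bare_rank x) (bare_rank y)) => // lt.
      by have := bare_mono d0 e0 L0 l0 m1 sm1 ls1 lo1 ll1 sp1 (j:= bare_rank x) (j' := bare_rank y);
        rewrite oo ltxx; move/(_ isT lt r1).
    by have := bare_mono d0 e0 L0 l0 m1 sm1 ls1 lo1 ll1 sp1 (j:= bare_rank y) (j' := bare_rank x);
        rewrite oo ltxx; move/(_ isT lt r2).
  - have := bare_ranges ix lx; have [_ r1 _ _] := hub_ranges iy ly; rewrite -bb in r1 => r2.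
    by have := @hub_neq_bare _ _ _ _ _ _ _ _ d0 e0 L0 l0 m1 sm1 ls1 lo1 ll1 sp1
         (hub_rank y) (bare_rank x) r1 r2; rewrite oo eqxx.
  - have := bare_ranges iy ly; have [_ r1 _ _] := hub_ranges ix lx; rewrite -bb => r2.
    by have := @hub_neq_bare _ _ _ _ _ _ _ _ d0 e0 L0 l0 m1 sm1 ls1 lo1 ll1 sp1
         (hub_rank x) (bare_rank y) r1 r2; rewrite oo eqxx.
  - apply: hub_inj => //; have [_ r1 _ _] := hub_ranges ix lx; have [_ + _ _] := hub_ranges iy ly.
    rewrite -bb => r2; case: (ltngtP (hub_rank x) (hub_rank y)) => // lt.
      by have := hub_mono d0 e0 L0 l0 m1 sm1 ls1 lo1 ll1 sp1 (b:= hub_rank x) (b' := hub_rank y);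
        rewrite oo ltxx; move/(_ isT lt r2).
    by have := hub_mono d0 e0 L0 l0 m1 sm1 ls1 lo1 ll1 sp1 (b:= hub_rank y) (b' := hub_rank x);
        rewrite oo ltxx; move/(_ isT lt r1).
rewrite (lf_block ly) (lf_off ly) /off ix => bb; have qi := leaf_pos_index ly; rewrite -bb in qi *.
block_hyps (bk x).
case: (posnP (lc x)) => lx oo.
  have r2 := bare_ranges ix lx.
  by have := @bare_neq_leaf _ _ _ _ _ _ _ _ d0 e0 L0 l0 m1 sm1 ls1 lo1 ll1 sp1
         (bare_rank x) (leaf_pos y) r2 qi; rewrite oo eqxx.
have [_ r1 _ _] := hub_ranges ix lx.
by have := @hub_neq_leaf _ _ _ _ _ _ _ _ d0 e0 L0 l0 m1 sm1 ls1 lo1 ll1 sp1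
         (hub_rank x) (leaf_pos y) r1 qi; rewrite oo eqxx.
Qed.

Lemma mulz_offset_inj (i j : nat) (p q : int) :
  Posz i * m + p = Posz j * m + q -> 0 < p < m -> 0 <= q < m -> i = j /\ p = q.
Proof.
move=> e hp hq; case: (ltngtP i j) => [lt|lt|eij]; last by subst; split=> //; lia.
  by have := ler_wpM2r (le_trans ler01 m1) (_ : Posz i.+1 <= Posz j); rewrite lez_nat => /(_ lt);
    rewrite intS mulrDl mul1r; lia.
by have := ler_wpM2r (le_trans ler01 m1) (_ : Posz j.+1 <= Posz i); rewrite lez_nat => /(_ lt);
    rewrite intS mulrDl mul1r; lia.
Qed.

(** Offsets may be negative or exceed [m]; this returns to the interval $J_t$ that holds the
    position. Offsets avoid the multiples of [m], and [t] differs from the block number by at most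
    one. *)
Lemma pos_cell x : placed x -> exists (t : nat) (p : int),
  [/\ pos x = Posz t * m + p, 0 < p < m, (t <= (block x).+1)%N, (block x <= t.+1)%N &
      off x = (Posz t - Posz (block x)) * m + p].
Proof.
move=> px; rewrite posE //; case/or3P: (off_where px) => ho.
- have [i bi] : exists i, block x = i.+1.
    (* Block 0 starts with load 0, so nothing of it lies to the left of offset 1. *)
    case bx: (block x) => [|i]; last by exists i.
    by have /andP[] := off_range px; rewrite bx /= /start_off ltxx; lia.
  by exists i, (off x + m); rewrite bi; split=> //; rewrite ?intS; lia.
- by exists (block x), (off x); split=> //; lia.
- by exists (block x).+1, (off x - m); split=> //; rewrite ?intS; lia.
Qed.

(** Spine vertices sit on multiples of [m], which all others avoid; blocks are separated by their
    cells, and within a block the offsets are distinct. *)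
Lemma pos_inj : {in [pred x | sp x || placed x] &, injective pos}.
Proof.
have sp_pl x y : sp x -> placed y -> pos x <> pos y.
  move=> sx py; have [t [p [-> p0 _ _ _]]] := pos_cell py; rewrite {1}/pos sx => e.
  have := @mulz_offset_inj t (idx x) p 0; rewrite addr0 => /(_ (esym e) p0) [] //; lia.
move=> x y /orP[sx|px] /orP[sy|py] e.
- apply: idx_inj => //; move: e; rewrite /pos sx sy.
  by move/(mulIf (lt0r_neq0 (lt_le_trans ltr01 m1))); lia.
- by case: (sp_pl x y sx py).
- by case: (sp_pl y x sy px).
- case: (ltngtP (block x) (block y)) => [lt|lt|bb].
  + by have := pos_lt_block px py lt; rewrite e ltxx.
  + by have := pos_lt_block py px lt; rewrite e ltxx.
  + apply: off_inj => //; move: e; rewrite !posE // bb; lia.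
Qed.

Lemma leaf_near u : lf u -> `|pos (par u) - pos u| <= m.
Proof.
move=> lu; have pu : placed u by rewrite /placed lu orbT.
rewrite [pos u]posE // lf_block //; case/orP: (par_lf lu) => [ip|/andP[spp i0]]; last first.
  have ei : idx (par u) = (bk (par u)).+1 by rewrite bk_sp // prednK.
  (* Leaves of a spine vertex are numbered past the free places of the preceding block, so their
     offsets lie strictly between $0$ and $2m$, while the spine vertex has offset $m$. *)
  have qf : - load (bk (par u)) < leaf_pos u.
    by rewrite /leaf_pos /first (negPf (sp_it spp)) /leaf_rank; lia.
  by case: (lf_off_where lu); rewrite /pos spp ei intS mulrDl mul1r; lia.
rewrite posE ?/placed ?ip // it_block // (lf_off lu); set i := bk (par u).
have lp := lc_par lu; have rl := leaf_rank_le lu.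
rewrite [off (par u)]/off ip lp -/i opprD addrACA subrr add0r.
have [f1 f2 f3 f4] := hub_ranges ip lp; rewrite -/i in f1 f2 f3 f4.
have r1 : (0 < hub_rank (par u))%N by []; have r2 : (0 < leaf_rank u)%N by [].
have ff : first (par u) = pre_sum vs (hubl i) (par u) by rewrite /first ip.
block_hyps i; have := star_small ip; rewrite -/i => ss.
apply: (@hub_leaf_near m (load i) (nhub i) (nbare i) (nhubl i) (nspine i) (a i) (h i)
  (hub_rank (par u)) (first (par u)) (lc (par u))) => //.
- by rewrite ff; lia.
- by rewrite ff; lia.
- case: (a_h i) => [[ea [eh nc]]|[w [cw ea eh]]]; [left|right].
    by split=> //; split=> //; apply: no_critical.
  have /and3P[iw /eqP bw hq] := cw; have lw : (0 < lc w)%N by lia.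
  exists (first w), (Posz (lc w)); rewrite -ea in eh.
  have [g1 g2 g3 g4] := hub_ranges iw lw; rewrite bw in g1 g2 g3 g4.
  have fw : first w = pre_sum vs (hubl i) w by rewrite /first iw bw.
  have r3 : (0 < hub_rank w)%N by [].
  split; first by split=> //; rewrite ?ea ?fw; lia.
  have bb : bk (par u) = bk w by rewrite bw.
  rewrite ea; case: (hub_cmp ip iw bb lp lw) => [<-|[g5 g6]|[g5 g6]]; by split; lia.
- by rewrite /leaf_pos; lia.
- by rewrite /leaf_pos; lia.
Qed.

Lemma spine_leaf_gt u : lf u -> sp (par u) -> Posz (bk (par u)) * m < pos u.
Proof.
move=> lu spp; have pu : placed u by rewrite /placed lu orbT.
rewrite posE // lf_block //.
have qf : - load (bk (par u)) < leaf_pos u.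
  by rewrite /leaf_pos /first (negPf (sp_it spp)) /leaf_rank; lia.
by case: (lf_off_where lu); lia.
Qed.

Lemma it_before_spine_leaf x u : it x -> lf u -> sp (par u) -> bk (par u) = bk x ->
  pos x < pos u.
Proof.
move=> ix lu spp bb; have pu : placed u by rewrite /placed lu orbT.
have px : placed x by rewrite /placed ix.
rewrite !posE // (lf_block lu) (it_block ix) bb ltrD2l (lf_off lu) /off ix bb.
have qi := leaf_pos_index lu; rewrite bb in qi *.
have qf : Num.max (Posz (nhubl (bk x))) (- load (bk x)) < leaf_pos u.
  by rewrite /leaf_pos /first (negPf (sp_it spp)) /leaf_rank bb; lia.
block_hyps (bk x); case: (posnP (lc x)) => lx.
  by have r2 := bare_ranges ix lx; apply: (@bare_before _ _ _ _ (nhubl (bk x)) (nspine (bk x))).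
have [_ r1 _ _] := hub_ranges ix lx.
by apply: (@hub_before _ _ _ _ (nhubl (bk x)) (nspine (bk x))).
Qed.

Lemma leaf_faithful u v : lf u -> lf v -> pos (par u) < pos (par v) -> pos u < pos v.
Proof.
move=> lu lv lt; have pu : placed u by rewrite /placed lu orbT.
have pv : placed v by rewrite /placed lv orbT.
(* Neighbors of the leaves of block $i$ have positions above $im$ and at most $(i+1)m$, so for
   leaves of different blocks the order of the neighbors is the order of the blocks. *)
have par_range w : lf w -> Posz (bk (par w)) * m < pos (par w) <= Posz (bk (par w)) * m + m.
  move=> lw; case/orP: (par_lf lw) => [iw|/andP[sw i0]].
    rewrite posE ?/placed ?iw // it_block //; have [] := it_off_range iw; lia.
  by rewrite /pos sw -(prednK i0) -bk_sp // intS mulrDl mul1r; lia.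
case: (ltngtP (bk (par u)) (bk (par v))) => bb.
- by apply: pos_lt_block; rewrite // !lf_block.
- have /andP[l1 _] := par_range _ lu; have /andP[_ l2] := par_range _ lv.
  have := ler_wpM2r (le_trans ler01 m1) (_ : Posz (bk (par v)).+1 <= Posz (bk (par u))).
  by rewrite lez_nat => /(_ bb); rewrite intS mulrDl mul1r; lia.
rewrite !posE // !lf_block // bb ltrD2l !lf_off // bb.
have [q1 _] := leaf_pos_index lu.
block_hyps (bk (par v));
  apply: (@leaf_mono _ _ _ _ (nhubl (bk (par v))) (nspine (bk (par v)))) => //.
have l1 := lc_par lu; have l2 := lc_par lv.
have r1 := leaf_rank_le lu; have r2 := leaf_rank_le lv.
have r1' : (0 < leaf_rank u)%N by []; have r2' : (0 < leaf_rank v)%N by [].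
rewrite /leaf_pos.
case iu: (it (par u)); case iv: (it (par v)).
- case: (hub_cmp iu iv bb l1 l2) => [e|[rr ?]|[rr _]]; [by rewrite e ltxx in lt|lia|].
  have [_ g2 _ _] := hub_ranges iu l1; rewrite bb in g2.
  move: lt; rewrite !posE ?/placed ?iu ?iv // !it_block // bb ltrD2l /off iu iv l1 l2 bb.
  have := @hub_mono _ _ _ _ _ _ _ _ d0 e0 L0 l0 m1 sm1 ls1 lo1 ll1 sp1 (hub_rank (par v)) (hub_rank (par u)).
  by move=> /(_ isT rr g2); lia.
- by have [f1 _ _ _] := hub_ranges iu l1; rewrite bb in f1; rewrite /first iu iv bb; lia.
- have := par_lf lu; rewrite iu => /andP[sw i0].
  have := par_range _ lv; move: lt; rewrite {1}/pos sw -(prednK i0) -bk_sp // bb.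
  rewrite intS mulrDl mul1r; lia.
- by move: lt; rewrite (spine_par_eq lu lv bb) ?iu ?iv // ltxx.
Qed.

(** * Occupied places and left-justification within a block *)

Definition occ (t : nat) (p : int) := exists2 y, placed y & pos y = Posz t * m + p.

Lemma occ_off (i t : nat) (p q : int) y : placed y -> block y = i ->
  off y = q -> Posz t * m + p = Posz i * m + q -> occ t p.
Proof. by move=> py <- <- e; exists y; rewrite // posE. Qed.

Lemma occ_leaf (i t : nat) (p q : int) :
  leaf_index (load i) (nhubl i) (nspine i) q ->
  Posz t * m + p = Posz i * m + leaf_off m (load i) (nhub i) (nbare i) (a i) (h i) q -> occ t p.
Proof.
move=> qi e; have [u [lu bu eu]] := leaf_onto qi.
by apply: (@occ_off i t p _ u); rewrite ?lf_block ?lf_off ?bu ?eu // /placed lu orbT.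
Qed.

(** Place [p] holds leaf number [room + p] of the preceding block. Leaves spill by one block only,
    because the earlier spilled leaves and the clique always fit into a block. *)
Lemma occ_spilled t p : 0 < p -> p <= load t -> occ t p.
Proof.
case: t => [|i] p0 pl; first by move: pl => /=; lia.
have r0 := room_ge0 i; apply: (@occ_leaf i _ _ (room m (load i) (nhub i) (nbare i) + p)).
  by have := small i; move: pl r0; rewrite load_next /leaf_index /spill /room; lia.
have := load_small i; rewrite /leaf_off ifN ?ifN; first by rewrite intS mulrDl mul1r; lia.
  by rewrite -ltNge; lia.
by rewrite -ltNge; move: r0; rewrite /room; have := small i; lia.
Qed.

Lemma occ_own t p : 0 < p -> p <= m - 1 -> p <= m - 1 + load t.+1 -> occ t p.
Proof.
move=> p0 p1 p2; case: (leP p (load t)) => pl; first exact: occ_spilled.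
block_hyps t; have pr : Num.max (load t) 0 < p by lia.
rewrite load_next in p2.
case: (block_onto d0 e0 L0 l0 m1 sm1 ls1 lo1 ll1 sp1 pr p1 p2) => -[].
- move=> b hb ->; have [|w [iw lw bw rw]] := @hub_onto t `|b|%N; first by lia.
  apply: (@occ_off t t _ _ w); rewrite /placed ?iw ?it_block // /off iw lw bw rw.
  congr (_ + hub_off _ _ _ _ _ _); lia.
- move=> b hb ->; have [|w [iw lw bw rw]] := @bare_onto t `|b|%N; first by lia.
  apply: (@occ_off t t _ _ w); rewrite /placed ?iw ?it_block // /off iw lw bw rw.
  congr (_ + bare_off _ _ _ _); lia.
- by move=> q qi ->; apply: occ_leaf qi _.
Qed.

(** The occupant of [p] may belong to block [t.+1], [t] or [t.-1]. Leaves of the next block use the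
    free places of block [t] from left to right; the places of block [t] before them are filled by
    [occ_own]; spilled leaves occupy an initial piece. *)
Lemma occ_left t p q : 0 < q -> q < p -> p < m -> occ t p -> occ t q.
Proof.
move=> q0 qp pm [y py ey].
have [t' [p' [et' hp' le1 le2 eo]]] := pos_cell py.
have [et ep] : t = t' /\ p = p'.
  by apply: mulz_offset_inj; rewrite -?ey -?et'; lia.
subst t' p'; have oy := off_range py.
case: (ltngtP t (block y)) => [lt|lt|bt].
- have bt : block y = t.+1 by lia.
  rewrite bt in oy eo; have {}eo : off y = p - m by rewrite eo intS; lia.
  have ly : lf y by case/orP: (py) => // iy; have [+ _ _] := it_off_range iy; lia.
  have [] := lf_off_where ly; rewrite -?lf_block ?bt; try lia.
  move=> [lo hi] ; case: (leP q (m - 1 + load t.+1)) => ql.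
    by apply: occ_own => //; lia.
  have qi := leaf_pos_index ly; rewrite -lf_block // bt in qi.
  move: eo; rewrite (lf_off ly) -lf_block // bt /leaf_off lo => eo.
  (* The leaf whose offset [load t.+1 + _ - 1] in block [t.+1] is [q - m]. *)
  apply: (@occ_leaf t.+1 _ _ (q - m - load t.+1 + 1)).
    by move: qi; rewrite /leaf_index; lia.
  by rewrite /leaf_off ifT ?intS ?mulrDl ?mul1r; lia.
- have bt : t = (block y).+1 by lia.
  rewrite -bt in oy; apply: occ_spilled => //.
  by move: oy eo; rewrite bt intS /start_off; case: ifP; case: ifP; lia.
- rewrite -bt in oy eo; have {}eo : off y = p by lia.
  apply: occ_own => //; first by lia.
  by move: oy; rewrite eo /start_off; case: ifP; case: ifP; lia.
Qed.

(** A leaf of block at most [i] beyond [i.+1 m] forces the cell of block [i.+1] to start later than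
    its first place, so [load i.+1] is positive and block [i] has no free place. *)
Lemma full_of_spill i u : lf u -> (bk (par u) <= i)%N -> Posz i.+1 * m < pos u ->
  forall p, 0 < p < m -> occ i p.
Proof.
move=> lu bi gt p hp; have pu : placed u by rewrite /placed lu orbT.
have /andP[_ hi] := pos_range pu; rewrite lf_block // in hi.
have := lt_le_trans hi (cell_start_mono (_ : (bk (par u)).+1 <= i.+1)%N) => /(_ bi).
rewrite /cell_start => lt; have lg : 0 < load i.+1 by move: lt gt; rewrite /start_off; case: ifP;
  lia.
by apply: occ_own; lia.
Qed.

End Layout.

(** * Blocks of graphs *)

Section Graph.
Variable G : sgraph.
Implicit Types (A B S T : {set G}) (x y z u : G).

Lemma inducedE A x y : induced A x y = [&& x \in A, y \in A & adj x y].
Proof. by []. Qed.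

Lemma induced_connect_sym A : connect_sym (induced A).
Proof. by apply: sym_connect_sym => x y; rewrite !inducedE andbCA adj_sym. Qed.

Lemma connect_induced_sub A B : A \subset B ->
  subrel (connect (induced A)) (connect (induced B)).
Proof.
move=> /subsetP AB; apply: connect_sub => x y /and3P[xA yA xy].
by apply: connect1; rewrite inducedE !AB.
Qed.

Lemma connect_induced_in A x y : connect (induced A) x y -> x \in A -> y \in A.
Proof.
case/connectP=> p + -> {y}; elim: p x => //= y p IH x /andP[/and3P[_ yA _]] pp _.
exact: IH pp yA.
Qed.

Lemma components_le1 A :
  components A <= 1 <-> {in A &, forall x y, connect (induced A) x y}.
Proof.
have rA x : x \in A -> fingraph.root (induced A) x \in [predI roots (induced A) & A].
  move=> xA; apply/andP; split; first exact: roots_root (induced_connect_sym A) x.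
  exact: connect_induced_in (connect_root _ x) xA.
split=> [/card_le1_eqP le1 x y xA yA|con].
  rewrite -(root_connect (induced_connect_sym A)); apply/eqP/le1; exact: rA.
apply/card_le1_eqP=> x y; rewrite !inE => /andP[/eqP ex xA] /andP[/eqP ey yA].
by rewrite -ex -ey; apply/eqP; rewrite (root_connect (induced_connect_sym A)) con.
Qed.

Lemma components_gt0 A x : x \in A -> 0 < components A.
Proof.
move=> xA; apply/card_gt0P; exists (fingraph.root (induced A) x); apply/andP; split.
  exact: roots_root (induced_connect_sym A) x.
exact: connect_induced_in (connect_root _ x) xA.
Qed.

Lemma connectedP A : connected A <->
  (exists x, x \in A) /\ {in A &, forall x y, connect (induced A) x y}.
Proof.
rewrite -components_le1 /connected; split=> [/eqP e|[[x /components_gt0]]]; last lia.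
rewrite e; split=> //; have : 0 < components A by rewrite e.
by case/card_gt0P=> x; rewrite inE => /andP[_ ?]; exists x.
Qed.

Lemma nonseparableP S : nonseparable S <->
  [/\ exists x, x \in S, {in S &, forall x y, connect (induced S) x y} &
      forall z, {in S :\ z &, forall x y, connect (induced (S :\ z)) x y}].
Proof.
split=> [/andP[/[dup] cS /connectedP[ne con] /eqP cut0]|[ne con cut]].
  split=> // z; apply/components_le1; case: (boolP (z \in S)) => zS.
    by move/eqP: cS => <-; rewrite leqNgt; move/setP/(_ z): cut0; rewrite !inE zS /= => ->.
  by rewrite (setDidPl _) ?(eqP cS) // disjoint_sym disjoints1.
have cS : connected S by apply/connectedP.
rewrite /nonseparable cS; apply/eqP/setP => z; rewrite !inE; apply/negP=> /andP[_].
by rewrite (eqP cS) ltnNge; case/negP; apply/components_le1.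
Qed.

Lemma connect_clique S x y : clique S -> x \in S -> y \in S -> connect (induced S) x y.
Proof.
move=> cS xS yS; case: (eqVneq x y) => [->//|ne].
by apply: connect1; rewrite inducedE xS yS cS.
Qed.

Lemma clique_sub S T : S \subset T -> clique T -> clique S.
Proof. by move=> /subsetP ST cT x y /ST xT /ST; apply: cT. Qed.

Lemma clique_nonseparable S x : x \in S -> clique S -> nonseparable S.
Proof.
move=> xS cS; apply/nonseparableP; split=> [|a b aS bS|z a b aS bS]; first by exists x.
  exact: connect_clique.
by apply: connect_clique => //; apply: clique_sub cS; apply: subsetDl.
Qed.

(** Whichever vertex is deleted, one of the two common vertices survives and joins the remains of
    the two sets. *)
Lemma nonseparable_union S T x y : nonseparable S -> nonseparable T ->
  x \in S :&: T -> y \in S :&: T -> x != y -> nonseparable (S :|: T).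
Proof.
move=> /nonseparableP[_ conS cutS] /nonseparableP[_ conT cutT] xST yST xy.
have glue A B w : w \in A :&: B -> {in A &, forall a b, connect (induced A) a b} ->
    {in B &, forall a b, connect (induced B) a b} ->
    {in A :|: B &, forall a b, connect (induced (A :|: B)) a b}.
  rewrite inE => /andP[wA wB] cA cB.
  have toW a : a \in A :|: B -> connect (induced (A :|: B)) a w.
    rewrite inE => /orP[aA|aB].
      by apply: (connect_induced_sub (subsetUl A B)); apply: cA.
    by apply: (connect_induced_sub (subsetUr A B)); apply: cB.
  move=> a b /toW aw /toW bw; apply: connect_trans aw _.
  by rewrite induced_connect_sym.
apply/nonseparableP; split.
- by exists x; move: xST; rewrite !inE => /andP[->].
- exact: glue xST conS conT.
move=> z; rewrite setDUl.
have [w wz wST] : exists2 w, w != z & w \in S :&: T.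
  by case: (eqVneq x z) => [e|]; [exists y; rewrite // eq_sym -e|exists x].
by apply: (glue _ _ w); rewrite ?cutS ?cutT // !inE wz; move: wST; rewrite inE.
Qed.

Lemma blocksP A B : B \in blocks A -> B \subset A /\ nonseparable B.
Proof. by rewrite inE => /maxsetp /andP. Qed.

Lemma block_max A B S : B \in blocks A -> B \subset S -> S \subset A ->
  nonseparable S -> S = B.
Proof. by rewrite inE => /maxsetP[_ mx] BS SA nS; apply: mx; rewrite ?SA. Qed.

Lemma sub_block A S : S \subset A -> nonseparable S ->
  exists2 B, B \in blocks A & S \subset B.
Proof.
move=> SA nS; have [B mB SB] := @maxset_exists _ (fun S => (S \subset A) && nonseparable S) S
  (introT andP (conj SA nS)).
by exists B; rewrite // inE.
Qed.

Lemma block_eq A B S x y : B \in blocks A -> S \subset A -> nonseparable S ->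
  x \in S :&: B -> y \in S :&: B -> x != y -> S \subset B.
Proof.
move=> BA SA nS xSB ySB xy; have [BsA nB] := blocksP BA.
rewrite -(@block_max _ _ (S :|: B) BA) ?subsetUr ?subsetUl ?subUset ?SA //.
exact: nonseparable_union xy.
Qed.

Lemma blocks_meet A B B' x y : B \in blocks A -> B' \in blocks A ->
  x \in B :&: B' -> y \in B :&: B' -> x != y -> B = B'.
Proof.
move=> BA BA' xB yB xy; have [s n] := blocksP BA; have [s' n'] := blocksP BA'.
apply/eqP; rewrite eqEsubset (block_eq BA' s n xB yB xy) /=.
by rewrite setIC in xB yB; apply: (block_eq BA s' n' xB yB xy).
Qed.

Lemma connect_path A x p : path adj x p -> {subset x :: p <= A} ->
  forall y, y \in x :: p -> connect (induced A) x y.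
Proof.
elim: p x => [|z p IH] x /=; first by move=> _ _ y; rewrite inE => /eqP->.
case/andP=> xz zp sub y; rewrite inE => /predU1P[->//|yp].
apply: (@connect_trans _ _ z).
  by apply: connect1; rewrite inducedE xz !sub // !inE eqxx ?orbT.
by apply: IH => // w wp; apply: sub; rewrite inE wp orbT.
Qed.

(** The cycle is a path closed by [u]. Deleting [u] leaves the path; deleting a vertex of the path
    leaves two pieces, each of which is still attached to [u] at an end of the path. *)
Lemma cycle_nonseparable u x p : u \notin x :: p -> uniq (x :: p) -> path adj x p ->
  adj u x -> adj u (last x p) -> nonseparable (u |: [set w in x :: p]).
Proof.
move=> uNp up pp ux ul; set C := u |: _.
have uC : u \in C by rewrite !inE eqxx.
have inC w : w \in x :: p -> w \in C by move=> wp; rewrite inE in_set wp orbT.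
have CP w : w \in C -> w = u \/ w \in x :: p by rewrite inE in_set1 in_set => /predU1P[]; tauto.
have hub A c : {in A, forall a, connect (induced A) a c} ->
    {in A &, forall a b, connect (induced A) a b}.
  by move=> h a b /h ac /h bc; apply: connect_trans ac _; rewrite induced_connect_sym.
have adj1 A a b : a \in A -> b \in A -> adj a b -> connect (induced A) a b.
  by move=> aA bA ab; apply: connect1; rewrite inducedE aA bA.
apply/nonseparableP; split; first by exists u.
  apply: (hub _ x) => a /CP[->|ap]; first by apply: adj1 => //; apply: inC; apply: mem_head.
  by rewrite induced_connect_sym; apply: connect_path ap => // w; apply: inC.
move=> z; case: (eqVneq z u) => [->|zu].
  apply: (hub _ x) => a; rewrite !inE => /andP[au]; rewrite (negPf au) /= => ap.
  rewrite induced_connect_sym; apply: (@connect_path _ x p) => // w wp.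
  by rewrite in_setD1 inC // andbT; apply: contraNneq uNp => <-.
have uCz : u \in C :\ z by rewrite !inE eq_sym zu eqxx.
case: (boolP (z \in x :: p)) => zp; last first.
  rewrite (_ : C :\ z = C); last first.
    by apply/setDidPl; rewrite disjoint_sym disjoints1 !inE negb_or zu -in_cons.
  apply: (hub _ x) => a /CP[->|ap]; first by apply: adj1 => //; apply: inC; apply: mem_head.
  by rewrite induced_connect_sym; apply: connect_path ap => // w; apply: inC.
apply: (hub _ u) => a; rewrite 2!inE => /andP[az /CP[->//|ap]].
have inCz s : z \notin s -> {subset s <= x :: p} -> {subset s <= C :\ z}.
  move=> zs sp w ws; rewrite in_setD1 inC ?sp // andbT.
  by apply: contraNneq zs => <-.
have cut s : z \in s -> exists p1 p2, s = p1 ++ z :: p2.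
  by case/splitPr => p1 p2; exists p1, p2.
have [p1 [p2 ep]] := cut _ zp.
have := up; rewrite ep cat_uniq /= => /and3P[_ zp1 /andP[zp2 _]].
rewrite negb_or in zp1; have {}zp1 := proj1 (andP zp1).
have : a \in p1 \/ a \in p2.
  by move: ap; rewrite ep mem_cat inE (negPf az) /=; case/orP; tauto.
case=> [a1|a2].
  case: p1 => // y p1 in ep zp1 a1 *; case: ep => exy ep; subst y.
  have sub1 : {subset x :: p1 <= C :\ z}.
    by apply: inCz => // w; rewrite ep -cat_cons mem_cat => ->.
  apply: (@connect_trans _ _ x); last first.
    by rewrite induced_connect_sym; apply: adj1 => //; apply: sub1; apply: mem_head.
  rewrite induced_connect_sym; apply: (@connect_path _ x p1) a1 => //.
  by move: pp; rewrite ep cat_path => /andP[].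
case/lastP: p2 => // p2 y in ep zp2 a2 *.
have ey : last x p = y.
  by have := congr1 (last x) ep; rewrite /= last_cat /= last_rcons.
have sub2 : {subset rcons p2 y <= C :\ z}.
  by apply: inCz => // w; rewrite ep mem_cat inE => ->; rewrite !orbT.
apply: (@connect_trans _ _ y); last first.
  rewrite induced_connect_sym; apply: adj1 => //; last by rewrite -ey.
  by apply: sub2; rewrite mem_rcons mem_head.
rewrite induced_connect_sym; apply: (@connect_path _ y (rev p2)).
- rewrite -[path _ _ _]/(sorted adj (y :: rev p2)) -rev_rcons rev_sorted.
  rewrite (eq_sorted (e' := adj)); last by move=> ? ?; rewrite adj_sym.
  have : sorted adj (x :: p) by []. 
  by rewrite ep => /cat_sorted2[_] /= /path_sorted.
- by move=> w; rewrite -rev_rcons mem_rev; apply: sub2.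
- by rewrite -rev_rcons mem_rev.
Qed.
(** If [u] lay in a single block, all its neighbors in [A] would lie in that clique, and every walk
    through [u] could be rerouted, so that deleting [u] would separate nothing. *)
Lemma cutvertex_two_blocks A u : block_graph A -> u \in cutvertices A ->
  exists B B', [/\ B \in blocks A, B' \in blocks A, u \in B, u \in B' & B != B'].
Proof.
move=> bgA; rewrite inE => /andP[uA cut].
have c1 x : clique [set x] by move=> a b /set1P-> /set1P->; rewrite eqxx.
have [B BA] : exists2 B, B \in blocks A & [set u] \subset B.
  by apply: sub_block; [rewrite sub1set|apply: (@clique_nonseparable _ u); rewrite ?inE].
rewrite sub1set => uB.
case: (boolP [exists B', [&& B' \in blocks A, u \in B' & B != B']]) => [/existsP[B']|].
  by case/and3P=> ? ? ?; exists B, B'.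
move=> /existsPn one; move: cut; rewrite ltnNge => /negP[].
have nbB y : y \in A -> adj u y -> y \in B.
  move=> yA uy; have cl : clique [set u; y].
    by move=> a b /set2P[]-> /set2P[]->; rewrite ?eqxx // adj_sym.
  have [|B' BA'] := @sub_block A [set u; y] _ (clique_nonseparable (set21 u y) cl).
    by rewrite subUset !sub1set uA.
  rewrite subUset !sub1set => /andP[uB' yB'].
  by have := one B'; rewrite BA' uB' /= negbK => /eqP->.
have cB := bgA _ BA; have [/subsetP BsA _] := blocksP BA.
have con x y : x \in A :\ u -> y \in A :\ u -> connect (induced A) x y ->
    connect (induced (A :\ u)) x y.
  case: (boolP [exists y, (y \in A) && adj u y]) => [/existsP[w /andP[wA uw]]|/existsPn iso].
    have wu : w != u by apply: contraTneq uw => ->; rewrite adj_irr.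
    (* The reroute: [w] is a neighbor of [u] and hence equal or adjacent to every other neighbor of
       [u]. *)
    pose g z := if z == u then w else z.
    move=> xA yA xy; have : connect (induced (A :\ u)) (g x) (g y); last first.
      by move: xA yA; rewrite /g !in_setD1 => /andP[/negPf-> _] /andP[/negPf-> _].
    case/connectP: xy => p + -> {y yA}; elim: p x {xA} => //= z p IH x /andP[/and3P[xA zA xz]].
    move/IH; apply: connect_trans; rewrite /g.
    have link a : a \in A -> adj u a -> connect (induced (A :\ u)) w a.
      move=> aA ua; have au : a != u by apply: contraTneq ua => ->; rewrite adj_irr.
      case: (eqVneq w a) => [->//|wa]; apply: connect1.
      by rewrite inducedE !in_setD1 wu au wA aA cB // nbB.
    case: eqP => [xu|/eqP xu]; case: eqP => [zu|/eqP zu] //.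
    - by apply: link; rewrite -?xu.
    - by rewrite induced_connect_sym; apply: link; rewrite -?zu // adj_sym.
    - by apply: connect1; rewrite inducedE !in_setD1 xu zu xA zA.
  move=> xA yA; apply: connect_sub => a b /and3P[aA bA ab]; apply: connect1.
  rewrite inducedE !in_setD1 aA bA ab !andbT; apply/andP; split; apply/eqP => e; subst.
    by have := iso b; rewrite bA ab.
  by have := iso a; rewrite aA adj_sym ab.
(* By [con] distinct components of [A :\ u] lie in distinct components of [A], so mapping roots to
   roots is injective. *)
pose f x := fingraph.root (induced A) x.
have sA := induced_connect_sym A; have sU := induced_connect_sym (A :\ u).
rewrite /components /n_comp_mem -(@card_in_image _ _ f); last first.
  move=> x y /andP[/eqP rx xA] /andP[/eqP ry yA] /eqP; rewrite /f (root_connect sA).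
  by move/(con x y xA yA); rewrite -(root_connect sU) rx ry => /eqP.
apply/subset_leq_card/subsetP => _ /imageP[x /andP[_ xA] ->]; apply/andP; split.
  exact: roots_root sA x.
by apply: connect_induced_in (connect_root _ x) _; move: xA; rewrite !inE => /andP[].
Qed.

(* With k = 0 this is the core of a star: the single vertex v 1. *)
Record chain (k : nat) (v : nat -> G) (Q : nat -> {set G}) : Prop := {
  ch_v1 : v 1 \in core G;
  ch_cover : forall x, x \in core G -> x = v 1 \/ exists2 i, 1 <= i <= k & x \in Q i;
  ch_core : forall i, 1 <= i <= k -> Q i \subset core G;
  ch_clique : forall i, 1 <= i <= k -> clique (Q i);
  ch_edge : forall x y, x \in core G -> y \in core G -> adj x y ->
    exists i, [/\ 1 <= i <= k, x \in Q i & y \in Q i];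
  ch_left : forall i, 1 <= i <= k -> v i \in Q i;
  ch_right : forall i, 1 <= i <= k -> v i.+1 \in Q i;
  ch_neq : forall i, 1 <= i <= k -> v i != v i.+1;
  ch_meet : forall i j x, 1 <= i -> i < j -> j <= k -> x \in Q i -> x \in Q j ->
    j = i.+1 /\ x = v j
}.

Lemma chain_of_blocks k v Q : block_path (core G) -> 1 <= k ->
  {in [pred i | 1 <= i <= k] &, injective Q} ->
  (forall B, B \in blocks (core G) <-> exists2 i, 1 <= i <= k & B = Q i) ->
  (forall i, 1 <= i <= k -> v i \in Q i) -> (forall i, 1 <= i <= k -> v i.+1 \in Q i) ->
  v 1 != v 2 -> v k.+1 != v k -> chain k v Q.
Proof.
move=> [bg nb _] k1 Qinj Qb vl vr v12 vkk.
have blk i : 1 <= i <= k -> Q i \in blocks (core G) by move=> hi; apply/Qb; exists i.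
have sub i : 1 <= i <= k -> Q i \subset core G by move/blk/blocksP => [].
have cl i : 1 <= i <= k -> clique (Q i) by move/blk/bg.
have cover x S : x \in S -> S \subset core G -> clique S ->
    exists2 i, 1 <= i <= k & S \subset Q i.
  move=> xS Sc cS; have [B /Qb[i hi ->] SB] := sub_block Sc (clique_nonseparable xS cS).
  by exists i.
(* Otherwise the walk from $v_{a+1}$ to $v_b$ avoids [x] and is closed by [x] to a cycle. The cycle
   shares two vertices with [Q a], hence lies in it; then [Q a] and [Q b] share both [x] and $v_b$
   and coincide. *)
have near a b x : 1 <= a -> a < b -> b <= k -> x \in Q a -> x \in Q b ->
    exists2 t, a < t <= b & x = v t.
  move=> a1 ab bk xa xb.
  case: (boolP (has (fun t => x == v t) (iota a.+1 (b - a)))) => [/hasP[t]|/hasPn no].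
    by rewrite mem_iota => ht /eqP xt; exists t => //; lia.
  have xv t : a < t <= b -> x != v t by move=> ht; apply: no; rewrite mem_iota; lia.
  have vin t i : a < t <= b -> 1 <= i <= k -> v t \in Q i -> v t \in core G :\ x.
    move=> ht hi vQ; rewrite in_setD1 eq_sym xv //=.
    exact: (subsetP (sub i hi)).
  have ha : 1 <= a <= k by lia.
  have hb : 1 <= b <= k by lia.
  have con n : a.+1 + n <= b -> connect (induced (core G :\ x)) (v a.+1) (v (a.+1 + n)).
    elim: n => [|n IH] le; first by rewrite addn0.
    apply: connect_trans (IH _) _; first lia.
    rewrite addnS; case: (eqVneq (v (a.+1 + n)) (v (a.+1 + n).+1)) => [->//|ne].
    have hi : 1 <= a.+1 + n <= k by lia.
    apply: connect1; rewrite inducedE (@vin _ (a.+1 + n)) ?vl //=; last lia.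
    by rewrite (@vin _ (a.+1 + n)) ?vr ?(cl _ hi) ?vl ?vr //; lia.
  have := con (b - a.+1); rewrite subnKC // leqnn => /(_ isT) /connectP[p0 pp0 lp0].
  case/shortenP: pp0 lp0 => p pp up _ lp.
  have sx : {subset v a.+1 :: p <= core G :\ x}.
    move=> y; rewrite inE => /predU1P[->|yp]; first by apply: (@vin _ a); rewrite ?vr //; lia.
    elim: p (v a.+1) pp {up lp} yp => //= z p IH w /andP[/and3P[_ zc _] zp].
    by rewrite inE => /predU1P[->//|]; apply: IH zp.
  have ap : path adj (v a.+1) p.
    by apply: sub_path pp => y z /and3P[].
  have nS : nonseparable (x |: [set y in v a.+1 :: p]).
    apply: cycle_nonseparable => //.
    - by apply/negP => /sx; rewrite !inE eqxx.
    - by apply: (cl a ha _ _ xa (vr a ha)); apply: xv; rewrite ltnSn.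
    - by rewrite -lp; apply: (cl b hb _ _ xb (vl b hb)); apply: xv; rewrite ab leqnn.
  set S := x |: _ in nS.
  have Ssub : S \subset core G.
    apply/subsetP => y /setU1P[->|]; first exact: (subsetP (sub a ha)).
    by rewrite in_set => /sx; rewrite in_setD1 => /andP[].
  have xS : x \in S by rewrite !inE eqxx.
  have bS : v b \in S by rewrite inE in_set lp mem_last orbT.
  have aS : v a.+1 \in S by rewrite inE in_set mem_head orbT.
  have xb' : x != v b by apply: xv; rewrite ab leqnn.
  have SA : S \subset Q a.
    apply: (block_eq (blk a ha) Ssub nS (x := x) (y := v a.+1)).
    - by apply/setIP.
    - by apply/setIP; rewrite aS vr.
    - by apply: xv; rewrite ltnSn.
  have eQ : Q a = Q b.
    apply: (blocks_meet (blk a ha) (blk b hb) (x := x) (y := v b)) => //.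
    - by apply/setIP.
    - by apply/setIP; rewrite vl // (subsetP SA).
  by move: ab; rewrite (Qinj a b ha hb eQ) ltnn.
(* A count: each of the $k-1$ cutvertices lies in two blocks and is therefore some $v_t$ by [near],
   so a list of $k-1$ entries that contains all of them has no repetition. *)
have uv : uniq (map v (iota 2 k.-1)).
  apply: (@leq_size_uniq _ (enum (cutvertices (core G)))); first exact: enum_uniq.
    move=> x; rewrite mem_enum => /(cutvertex_two_blocks bg)[B [B' []]].
    move=> /Qb[i hi ->] /Qb[j hj ->] xi xj ij.
    have {}ij : i <> j by move=> e; rewrite e eqxx in ij.
    have [t ht ->] : exists2 t, 2 <= t <= k & x = v t.
      case: (ltngtP i j) ij => // ij _.
        have [i1 jk] : 1 <= i /\ j <= k by lia.
        by have [t ht ->] := near i j x i1 ij jk xi xj; exists t => //; lia.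
      have [j1 ik] : 1 <= j /\ i <= k by lia.
      by have [t ht ->] := near j i x j1 ij ik xj xi; exists t => //; lia.
    by apply: map_f; rewrite mem_iota; lia.
  rewrite size_map size_iota -cardE.
  suff : #|blocks (core G)| = k by rewrite nb => <-.
  rewrite -[RHS](size_iota 1 k) -(size_map Q).
  have uQ : uniq (map Q (iota 1 k)).
    by rewrite map_inj_in_uniq ?iota_uniq // => i j; rewrite !mem_iota => hi hj;
      apply: Qinj; rewrite inE; lia.
  rewrite -(card_uniqP uQ); apply: eq_card => B; apply/idP/mapP.
    by move/Qb => [i hi ->]; exists i => //; rewrite mem_iota; lia.
  by case=> i; rewrite mem_iota => hi ->; apply: blk; lia.
have vinj i j : 2 <= i <= k -> 2 <= j <= k -> v i = v j -> i = j.
  move=> hi hj e; have := @uniqP _ (v 0) _ uv => /(_ (i - 2) (j - 2)).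
  rewrite !inE size_map size_iota !(nth_map 0) ?size_iota ?nth_iota; try lia.
  by rewrite !subnKC; try lia; move=> W; have := W _ _ e; lia.
(* [near] gives $x=v_t$. If $t<j$, applying it to $Q_t$ and $Q_j$ yields a second index for [x]; if
   $i+1<j$, so does applying it to $Q_i$ and $Q_{j-1}$, which contains $v_j$. *)
have meet i j x : 1 <= i -> i < j -> j <= k -> x \in Q i -> x \in Q j ->
    j = i.+1 /\ x = v j.
  move=> i1 ij jk xi xj; have [t ht xt] := near i j x i1 ij jk xi xj.
  have tj : t = j.
    case: (ltngtP t j) ht => [tj ht|_ /andP[]//|//].
    have t1 : 1 <= t by lia.
    have xt' : x \in Q t by rewrite xt vl //; lia.
    have [s hs xs] := near t j x t1 tj jk xt' xj.
    by have : t = s; [apply: vinj; rewrite -?xt -?xs //|]; lia.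
  subst t; split=> //; case: (ltngtP i.+1 j) ij => // ij _.
  have [ij' jk' j0] : [/\ i < j.-1, j.-1 <= k & 0 < j] by split; lia.
  have xj' : x \in Q j.-1 by rewrite xt -[in v _](prednK j0) vr //; lia.
  have [s hs xs] := near i j.-1 x i1 ij' jk' xi xj'.
  by have : j = s; [apply: vinj; rewrite -?xt -?xs //|]; lia.
split=> //.
- by apply: (subsetP (sub 1 _)); rewrite ?vl.
- move=> x xc; right; have c1 : clique [set x] by move=> a b /set1P-> /set1P->; rewrite eqxx.
  have [|i hi] := cover x [set x] (set11 x) _ c1; first by rewrite sub1set.
  by rewrite sub1set; exists i.
- move=> x y xc yc xy.
  have c2 : clique [set x; y].
    by move=> a b /set2P[]-> /set2P[]->; rewrite ?eqxx // adj_sym.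
  have [|i hi] := cover x [set x; y] (set21 x y) _ c2; first by rewrite subUset !sub1set xc.
  by rewrite subUset !sub1set => /andP[? ?]; exists i.
- move=> i hi; case: (ltngtP 1 i) => [i1|i1|<-//]; last lia.
  case: (ltngtP i k) => [ik|ik|->]; [|lia|by rewrite eq_sym].
  by apply/eqP => e; have : i = i.+1; [apply: vinj => //|]; lia.
Qed.

End Graph.

(** * Local density *)

Section Density.
Variable G : sgraph.
Implicit Types (S : {set G}) (x y z u : G) (H : {set G} * {set G * G}) (r : rel G).

Lemma dist_le r x y p : path r x p -> last x p = y -> dist r x y <= size p.
Proof.
(* The search that defines [dist] stops at [#|G|], so a path of at least that length bounds it
   trivially. *)
move=> pp lp; rewrite /dist; set a := (X in find X _); case: (ltnP (size p) #|G|) => sp; last first.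
  by rewrite (leq_trans (find_size _ _)) // size_iota.
rewrite leqNgt; apply/negP => /(before_find 0); rewrite nth_iota // add0n /a.
by move/existsP => []; exists (in_tuple p); rewrite pp lp eqxx.
Qed.

Lemma dist_path r x y : connect r x y ->
  exists p, [/\ path r x p, last x p = y & size p = dist r x y].
Proof.
case/connectP=> p0 pp0 ->; case/shortenP: pp0 => p pp up _.
rewrite /dist; set a := (X in find X _).
have sp : size p < #|G| by have := max_card (mem (x :: p)); rewrite (card_uniqP up).
have ha : has a (iota 0 #|G|).
  apply/hasP; exists (size p); first by rewrite mem_iota.
  by apply/existsP; exists (in_tuple p); rewrite pp eqxx.
have := nth_find 0 ha; rewrite nth_iota; last by move: ha; rewrite has_find size_iota.
case/existsP=> t /andP[pt /eqP lt]; exists t; rewrite size_tuple; split=> //.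
Qed.

Lemma dist_gt0 r x y : x != y -> 0 < dist r x y.
Proof.
move=> xy; rewrite /dist; case: (#|G|) (fintype0 x) => // n _ /=.
case: existsP => // -[t /andP[_]]; rewrite (tuple0 t) /= => /eqP e.
by rewrite e eqxx in xy.
Qed.

Lemma diam_leP H d :
  reflect {in H.1 &, forall x y, dist (sub_rel H) x y <= d} (diam H <= d).
Proof.
apply: (iffP (bigmax_leqP _ _ _)) => [le x y xH yH|le x xH].
  by have /bigmax_leqP := le x xH; apply.
by apply/bigmax_leqP => y yH; apply: le.
Qed.

Lemma ceil_div_leP n d m : 0 < d -> (ceil_div n d <= m) = (n <= m * d).
Proof. by move=> d0; rewrite -ltnS /ceil_div ltn_divLR // mulSn; lia. Qed.

Lemma diam_gt0 H : 1 < #|H.1| -> 0 < diam H.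
Proof.
case/card_gt1P=> x [y [xH yH xy]]; rewrite ltnNge; apply/negP => /diam_leP.
by move/(_ x y xH yH); rewrite leqNgt dist_gt0.
Qed.

(** The form in which the density is applied: the induced subgraph on [S] is taken for $H$, and an
    upper bound on its diameter suffices. *)
Lemma density_le S d m : 1 < #|S| ->
  {in S &, forall x y, exists p, [/\ path (induced S) x p, last x p = y & size p <= d]} ->
  local_density G <= m -> #|S| <= m * d + 1.
Proof.
move=> S2 con /bigmax_leqP le; pose H := (S, [set p : G * G | induced S p.1 p.2]).
have sr : sub_rel H =2 induced S by move=> x y; rewrite /sub_rel /= inE.
have dH : diam H <= d.
  apply/diam_leP => x y xS yS; have [p [pp lp sp]] := con x y xS yS.
  by apply: leq_trans sp; apply: dist_le; rewrite // (eq_path sr).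
have /= := le H; rewrite S2 andbT ceil_div_leP ?diam_gt0 //.
have -> : subgraph H.
  apply/forallP => x; apply/forallP => y; apply/implyP; rewrite !inE /= !inducedE.
  by case/and3P=> -> -> xy; rewrite [adj y x]adj_sym xy.
have -> : sub_connected H.
  rewrite /sub_connected (eq_n_comp (eq_connect sr)).
  apply/connectedP; split=> [|x y xS yS].
    by have [x [y [xS _ _]]] := card_gt1P S2; exists x.
  by have [p [pp <- _]] := con x y xS yS; apply/connectP; exists p.
move/(_ isT) => h; have : m * diam H <= m * d by rewrite leq_mul2l dH orbT.
by move: h; lia.
Qed.

Local Open Scope ring_scope.

Lemma width_leP (f : G -> int) (m : nat) :
  (forall x y, adj x y -> `|f x - f y| <= m%:Z) <-> (width f <= m)%N.
Proof.
split=> [le|/bigmax_leqP le x y xy].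
  by apply/bigmax_leqP => -[x y] /= /le; lia.
by have /= := le (x, y) xy; lia.
Qed.

Lemma path_width (f : G -> int) H x p : subgraph H -> path (sub_rel H) x p ->
  (`|f x - f (last x p)| <= width f * size p)%N.
Proof.
move=> /forallP sH; elim: p x => [|y p IH] x /=; first by rewrite subrr.
case/andP=> xy /IH; have := (width_leP f (width f)).2 (leqnn _) x y.
have /forallP/(_ y)/implyP/(_ xy)/and4P[_ _ -> _] := sH x.
by move/(_ isT); rewrite mulnS; lia.
Qed.

(** The distances to the minimum of [f] on [S] are distinct natural numbers, so the largest is at
    least [#|S| - 1]. *)
Lemma spread (f : G -> int) S : injective f -> (0 < #|S|)%N ->
  exists x y, [/\ x \in S, y \in S & (#|S| - 1 <= `|f y - f x|)%N].
Proof.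
move=> fi /card_gt0P[x0 x0S].
case: (@Order.TotalTheory.arg_minP _ _ _ x0 (mem S) f x0S) => x xS xmin.
case: (@Order.TotalTheory.arg_maxP _ _ _ x0 (mem S) f x0S) => y yS ymax.
exists x, y; split=> //; rewrite leq_subLR.
pose g z := `|f z - f x|%N.
have ug : uniq (map g (enum S)).
  rewrite map_inj_in_uniq ?enum_uniq // => a b; rewrite !mem_enum => aS bS.
  rewrite /g => e; apply: fi; have := xmin a aS; have := xmin b bS; lia.
rewrite cardE -(size_map g) -(size_iota 0 (1 + _)); apply: uniq_leq_size => //.
move=> _ /mapP[z + ->]; rewrite mem_enum mem_iota => zS.
by rewrite /g; have := xmin z zS; have := ymax z zS; lia.
Qed.

Lemma density_le_width (f : G -> int) : injective f -> (local_density G <= width f)%N.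
Proof.
move=> fi; apply/bigmax_leqP => H /and3P[sH cH H2]; rewrite ceil_div_leP ?diam_gt0 //.
have [|x [y [xH yH sp]]] := @spread f H.1 fi; first exact: ltnW H2.
have srs : connect_sym (sub_rel H).
  apply: sym_connect_sym => a b; have /forallP/(_ a)/forallP/(_ b)/implyP h1 := sH.
  have /forallP/(_ b)/forallP/(_ a)/implyP h2 := sH.
  by apply/idP/idP => [/h1/and4P[]|/h2/and4P[]].
have cl a b : sub_rel H a b -> b \in H.1.
  by move=> ab; have /forallP/(_ a)/forallP/(_ b)/implyP/(_ ab)/and4P[] := sH.
have cin a b : connect (sub_rel H) a b -> a \in H.1 -> b \in H.1.
  by case/connectP=> p + ->; elim: p a => //= c p IH a /andP[ac cp] _; apply: IH cp (cl _ _ ac).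
have xy : connect (sub_rel H) y x.
  rewrite -(root_connect srs); apply/eqP.
  have le1 : (#|[predI roots (sub_rel H) & H.1]| <= 1)%N.
    by move: cH; rewrite /sub_connected /n_comp_mem => /eqP->.
  by move/card_le1_eqP: le1; apply; apply/andP; split;
    first [exact: roots_root srs _|exact: cin (connect_root _ _) _].
have [p [pp lp sz]] := dist_path xy.
apply: (leq_trans sp); rewrite -lp; apply: (leq_trans (path_width f sH pp)).
by rewrite leq_mul2l sz; apply/orP; right; apply/diam_leP: yH xH.
Qed.

End Density.

(** * The spine of a caterpillar *)

Section Reach.
Variable G : sgraph.
Implicit Types (S : {set G}) (x y z : G).

(** The premise of [density_le]. Unlike exact distances, these bounds compose. *)
Definition reach S n x y :=
  exists p, [/\ path (induced S) x p, last x p = y & size p <= n].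

Lemma reach0 S n x : reach S n x x.
Proof. by exists [::]. Qed.

Lemma reach_trans S n n' N x y z : reach S n x y -> reach S n' y z -> n + n' <= N ->
  reach S N x z.
Proof.
move=> [p [pp lp sp]] [q [pq lq sq]] le; exists (p ++ q).
by rewrite cat_path last_cat size_cat lp pp pq; split=> //; lia.
Qed.

Lemma reach1 S n x y : x \in S -> y \in S -> adj x y -> 0 < n -> reach S n x y.
Proof. by move=> xS yS xy n0; exists [:: y]; rewrite /path inducedE xS yS xy. Qed.

Lemma reach_sym S n x y : reach S n x y -> reach S n y x.
Proof.
move=> [p [pp <- sp]]; exists (rev (belast x p)); split; last by rewrite size_rev size_belast.
  by rewrite rev_path (eq_path (e' := induced S)) // => a b; rewrite !inducedE adj_sym andbCA.
by case: p {pp sp} => //= c p; rewrite rev_cons last_rcons.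
Qed.

End Reach.

Lemma sum_eqn a b n : \sum_(a <= t < b) (n == t) = (a <= n < b) :> nat.
Proof.
case: (leqP a b) => ab; last by rewrite big_geq ?(ltnW ab) //; case: andP => // -[]; lia.
rewrite -(subnKC ab); elim: (b - a) => [|l IH].
  by rewrite addn0 big_geq //; case: andP => // -[]; lia.
by rewrite addnS big_nat_recr ?leq_addr //= IH; case: eqP; lia.
Qed.

Lemma sum_indicator (I : finType) (s : seq I) (P : pred I) : perm_eq s (enum I) ->
  \sum_(x <- s) (P x : nat) = #|[set x | P x]|.
Proof.
move=> ps; rewrite (perm_big _ ps) /= big_enum /= cardsE -sum1_card.
by rewrite [RHS]big_mkcond; apply: eq_bigr => x _; rewrite unfold_in; case: (P x).
Qed.

Section Spine.
Variables (G : sgraph) (k : nat) (v : nat -> G) (Q : nat -> {set G}) (bl br : bool) (m : nat).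
Implicit Types (x y z u w : G).

(** The unique neighbor of a leaf; an isolated vertex gets itself. *)
Definition par u := odflt u [pick y | adj u y].
(** The condition on [par u] excludes the two vertices of a component $K_2$, which are leaves of
    each other. *)
Definition hangs u := (u \in leaves G) && (par u \in core G).

(* The flags [bl] and [br] tell whether there are distinguished leaves v_0 and
   v_{k+2}. If not, the corresponding end clique has no leaves that could play
   this role, so the layout can start at v_1 or stop at v_{k+1}. *)
Record ends : Prop := {
  end_l : bl -> v 0 \in leaves_at (v 1);
  end_r : br -> v k.+2 \in leaves_at (v k.+1);
  end_lr : bl -> br -> v 0 != v k.+2;
  end_nl : ~~ bl -> forall u, hangs u ->
    par u != v 1 /\ (0 < k -> par u \in Q 1 -> par u = v 2);
  end_nr : ~~ br -> forall u, hangs u ->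
    par u != v k.+1 /\ (0 < k -> par u \in Q k -> par u = v k)
}.

Definition lo := if bl then 0 else 1.
Definition hi := if br then k.+2 else k.+1.
Definition spine := [seq v i | i <- iota lo (hi.+1 - lo)].
Definition sp x := x \in spine.
Definition idx x := lo + index x spine.
Definition it x := (x \in core G) && ~~ sp x.
Definition lf x := hangs x && ~~ sp x.
(** $v_{i+1}$ belongs to block $i$, with its leaves, because it stands at the end of that block. The
    successor after [find] shifts to the numbering of the cliques from 1. *)
Definition bk x := if sp x then (idx x).-1 else (find (fun i => x \in Q i) (iota 1 k)).+1.

Hypothesis ch : chain k v Q.
Hypothesis en : ends.

Lemma parP u y : u \in leaves G -> adj u y = (y == par u).
Proof.
rewrite inE => /cards1P[z /setP ez]; have az w : adj u w = (w == z).
  by have := ez w; rewrite !inE.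
by rewrite /par; case: pickP => [w|/(_ z)]; rewrite !az ?eqxx // => /eqP->.
Qed.

Lemma leaf_core u : (u \in core G) = (u \notin leaves G).
Proof. by rewrite inE. Qed.

Lemma leaves_atE x u : (u \in leaves_at x) = (u \in leaves G) && (par u == x).
Proof.
by rewrite inE; case uL: (u \in leaves G) => //=; rewrite adj_sym parP // eq_sym.
Qed.

Lemma v_core i : 1 <= i <= k.+1 -> v i \in core G.
Proof.
move=> hi; case: (ltnP i k.+1) => ik.
  have hi' : 1 <= i <= k by lia.
  exact: (subsetP (ch_core ch hi')) _ (ch_left ch hi').
have ei : i = k.+1 by lia.
rewrite ei; case: (posnP k) => k0; first by rewrite k0 (ch_v1 ch).
have hk : 1 <= k <= k by lia.
exact: (subsetP (ch_core ch hk)) _ (ch_right ch hk).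
Qed.

Lemma v_inj_core i j : 1 <= i -> i < j -> j <= k.+1 -> v i != v j.
Proof.
move=> i1 ij jk; have hi' : 1 <= i <= k by lia.
have [ej|ij2] : j = i.+1 \/ i.+1 < j by lia.
  by rewrite ej; apply: (ch_neq ch).
have j0 : 0 < j by lia.
have hj : 1 <= j.-1 <= k by lia.
have ij' : i < j.-1 by lia.
have hj2 : j.-1 <= k by lia.
apply/eqP => e; have xj := ch_right ch hj; rewrite prednK // -e in xj.
have [ej ev] := ch_meet ch i1 ij' hj2 (ch_left ch hi') xj.
by have := ch_neq ch hi'; rewrite {1}ev ej eqxx.
Qed.

Lemma end_leaf i : lo <= i <= hi -> ~~ (1 <= i <= k.+1) -> v i \in leaves G.
Proof.
rewrite /lo /hi => h1 h2; case: (posnP i) => i0.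
  have b : bl by case: bl h1; rewrite // i0.
  by have := end_l en b; rewrite leaves_atE i0 => /andP[].
have b : br by case: br h1 => //; lia.
have -> : i = k.+2 by move: h1; rewrite b; lia.
by have := end_r en b; rewrite leaves_atE => /andP[].
Qed.

Lemma v_neq i j : lo <= i -> i < j -> j <= hi -> v i != v j.
Proof.
move=> li ij jh; case: (boolP (1 <= i <= k.+1)) => ci; case: (boolP (1 <= j <= k.+1)) => cj.
- by apply: v_inj_core; lia.
- have := end_leaf _ cj; have := v_core ci; rewrite leaf_core => c l.
  by apply: contraNneq c => ->; apply: l; lia.
- have := end_leaf _ ci; have := v_core cj; rewrite leaf_core => c l.
  by apply: contraNneq c => <-; apply: l; lia.
have b : bl by move: li ij jh ci cj; rewrite /lo /hi; case: bl => //; case: br; lia.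
have b' : br by move: li ij jh ci cj; rewrite /lo /hi; case: br => //; case: bl; lia.
have -> : i = 0 by move: jh; rewrite /hi b'; lia.
have -> : j = k.+2 by move: jh; rewrite /hi b'; lia.
exact: end_lr en b b'.
Qed.

Lemma v_inj i j : lo <= i <= hi -> lo <= j <= hi -> v i = v j -> i = j.
Proof.
move=> /andP[i1 i2] /andP[j1 j2] e; case: (ltngtP i j) => // ij.
  by have := v_neq i1 ij j2; rewrite e eqxx.
by have := v_neq j1 ij i2; rewrite e eqxx.
Qed.

Lemma lo_hi : lo <= hi.
Proof. by rewrite /lo /hi; case: bl; case: br. Qed.

Lemma spine_uniq : uniq spine.
Proof.
rewrite map_inj_in_uniq ?iota_uniq // => i j; rewrite !mem_iota => hi' hj.
by apply: v_inj; have := lo_hi; lia.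
Qed.

Lemma spP x : reflect (exists2 i, lo <= i <= hi & x = v i) (sp x).
Proof.
apply: (iffP mapP) => -[i hi' ->]; exists i => //; move: hi'; rewrite mem_iota; have := lo_hi; lia.
Qed.

Lemma sp_v i : lo <= i <= hi -> sp (v i).
Proof. by move=> hi'; apply/spP; exists i. Qed.

Lemma idx_v i : lo <= i <= hi -> idx (v i) = i.
Proof.
move=> hi'; have lh := lo_hi; rewrite /idx /spine.
have -> : v i = nth (v 0) (map v (iota lo (hi.+1 - lo))) (i - lo).
  by rewrite (nth_map 0) ?size_iota ?nth_iota ?subnKC //; lia.
by rewrite index_uniq ?spine_uniq ?size_map ?size_iota ?subnKC //; lia.
Qed.

Lemma sp_idx x : sp x -> v (idx x) = x /\ lo <= idx x <= hi.
Proof. by case/spP => i hi' ->; rewrite idx_v. Qed.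

Lemma sp_core x : sp x -> x \in core G -> 1 <= idx x <= k.+1.
Proof.
move=> /sp_idx[ex h] xc; apply: contraTT xc => c; rewrite leaf_core negbK -ex.
exact: end_leaf.
Qed.

Lemma range_lohi i : 1 <= i <= k.+1 -> lo <= i <= hi.
Proof. by rewrite /lo /hi; case: bl; case: br; lia. Qed.

Lemma sp_it x : sp x -> ~~ it x.
Proof. by rewrite /it => ->; rewrite andbF. Qed.

Lemma sp_lf x : sp x -> ~~ lf x.
Proof. by rewrite /lf => ->; rewrite andbF. Qed.

Lemma it_lf x : it x -> ~~ lf x.
Proof. by rewrite /it /lf /hangs leaf_core => /andP[/negPf->]. Qed.

Lemma idx_inj : {in sp &, injective idx}.
Proof. by move=> x y /sp_idx[ex _] /sp_idx[ey _] e; rewrite -ex -ey e. Qed.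

Lemma bk_sp x : sp x -> bk x = (idx x).-1.
Proof. by rewrite /bk => ->. Qed.

Lemma it_bk x : it x -> 1 <= bk x <= k /\ x \in Q (bk x).
Proof.
case/andP=> xc nsp; rewrite /bk (negPf nsp).
have hQ : has (fun i => x \in Q i) (iota 1 k).
  case: (ch_cover ch xc) => [e|[i hi' xi]].
    by case/negP: nsp; rewrite e; apply: sp_v; apply: range_lohi.
  by apply/hasP; exists i; rewrite // mem_iota; lia.
have fk : find (fun i => x \in Q i) (iota 1 k) < k by rewrite -{2}(size_iota 1 k) -has_find.
by split=> //; have := nth_find 0 hQ; rewrite nth_iota // add1n.
Qed.

(** Two cliques of the chain meet only in a spine vertex. *)
Lemma it_bk_uniq x i : it x -> 1 <= i <= k -> x \in Q i -> bk x = i.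
Proof.
move=> ix hi' xi; have [hb xb] := it_bk ix; have /andP[_ /negP nsp] := ix.
have no a b : 1 <= a -> a < b -> b <= k -> x \in Q a -> x \in Q b -> False.
  move=> a1 ab bk' xa xb'; apply: nsp.
  have [_ ->] := ch_meet ch a1 ab bk' xa xb'.
  by apply: sp_v; apply: range_lohi; lia.
case: (ltngtP (bk x) i) => // lt; exfalso.
  by apply: (no (bk x) i); rewrite //; case/andP: hb; case/andP: hi'.
by apply: (no i (bk x)); rewrite //; case/andP: hb; case/andP: hi'.
Qed.

Lemma it_Q i x : 1 <= i <= k -> x \in Q i -> x != v i -> x != v i.+1 -> it x /\ bk x = i.
Proof.
move=> hi' xi n1 n2; suff ix : it x by split=> //; apply: it_bk_uniq.
have xc := subsetP (ch_core ch hi') _ xi; rewrite /it xc; apply/negP => spx.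
have hx := sp_core spx xc; have [ex _] := sp_idx spx; have /andP[i1 ik] := hi'.
case: (ltngtP (idx x) i) => lt; last by rewrite -ex lt eqxx in n1.
  have hx' : 1 <= idx x <= k by lia.
  have xq := ch_left ch hx'; rewrite ex in xq.
  by have [_ e] := ch_meet ch (proj1 (andP hx')) lt ik xq xi; rewrite e eqxx in n1.
have x0 : 0 < idx x by lia.
have hx' : 1 <= (idx x).-1 <= k by lia.
have := ch_right ch hx'; rewrite prednK // ex => xq.
case: (ltngtP i (idx x).-1) => lt'; [|lia|by rewrite -ex -(prednK x0) -lt' eqxx in n2].
have [e1 e2] := ch_meet ch i1 lt' (proj2 (andP hx')) xi xq.
by rewrite e1 in e2; rewrite e2 eqxx in n2.
Qed.

Lemma lf_par u : lf u -> par u \in core G /\ adj u (par u).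
Proof. by case/andP=> /andP[uL pc] _; rewrite parP. Qed.

Lemma par_lf u : lf u -> it (par u) || sp (par u) && (0 < idx (par u)).
Proof.
case/lf_par=> pc _; rewrite /it pc /=; case: (boolP (sp (par u))) => //= s.
by have := sp_core s pc; lia.
Qed.

Lemma adj_spine a : lo <= a -> a < hi -> adj (v a) (v a.+1).
Proof.
move=> la ah; case: (posnP a) => a0.
  have b : bl by move: la; rewrite /lo a0; case: bl.
  by have := end_l en b; rewrite inE a0 adj_sym => /andP[].
case: (ltnP k a) => ak; last first.
  have ha : 1 <= a <= k by lia.
  exact: (ch_clique ch ha (ch_left ch ha) (ch_right ch ha) (ch_neq ch ha)).
have b : br by move: ah; rewrite /hi; case: br => //; lia.
have -> : a = k.+1 by move: ah; rewrite /hi b; lia.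
by have := end_r en b; rewrite inE => /andP[].
Qed.

(** * Density bounds for cliques, for cliques with the leaves of one vertex, and for segments *)

Variable vs : seq G.
Hypothesis vs_enum : perm_eq vs (enum G).
Hypothesis m1 : 0 < m.
Hypothesis dm : local_density G <= m.

Let nH i := nhub vs it lf bk par i.
Let nB i := nbare vs it lf bk par i.
Let nL i := nhubl vs it lf bk par i.
Let nS i := nspine vs sp lf bk par i.
Let lcG w := lc vs lf par w.
Let loadG i := load vs m sp it lf bk par i.

Lemma it_neq_v i x : it x -> lo <= i <= hi -> x != v i.
Proof. by move=> /andP[_ nsp] hi'; apply: contraNneq nsp => ->; apply: sp_v. Qed.

Lemma card_setE (S : {set G}) : \sum_(x <- vs) (x \in S : nat) = #|S|.
Proof. by rewrite (sum_indicator _ vs_enum) cardsE. Qed.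

Lemma ints_split i x :
  hubw vs it lf bk par i x + barew vs it lf bk par i x = it x && (bk x == i).
Proof.
rewrite /hubw /barew; case: (it x) => //=; case: (bk x == i) => //=.
by case: posnP => // ->.
Qed.

Lemma small_clique i : 1 <= i <= k -> nH i + nB i + 2 <= #|Q i|.
Proof.
move=> hi'.
have <- : \sum_(x <- vs) (x \in [set v i; v i.+1] : nat) = 2.
  by rewrite card_setE cards2 (ch_neq ch).
rewrite -card_setE -!big_split /=; apply: leq_sum => x _; rewrite ints_split in_set2.
case: (boolP (it x)) => ix /=; last first.
  by case: eqP => [->|_]; case: eqP => [->|_]; rewrite ?(ch_left ch) ?(ch_right ch).
rewrite !(negPf (it_neq_v ix (range_lohi _))) /= ?addn0; try lia.
by case: eqP => //= <-; have [_ ->] := it_bk ix.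
Qed.

Lemma no_ints i : ~~ (1 <= i <= k) -> nH i = 0 /\ nB i = 0 /\ nL i = 0.
Proof.
move=> hi'; have no x : it x && (bk x == i) = false.
  by apply: contraNF hi' => /andP[/it_bk[hb _] /eqP <-].
rewrite /nH /nB /nL /nhub /nbare /nhubl /hubw /barew /hubl.
by split; [|split]; apply: big1 => x _; rewrite ?andbA no.
Qed.

(** A clique has diameter 1, so $|Q_i|\le m+1$, and two of its vertices are $v_i$ and $v_{i+1}$. *)
Lemma small i : (Posz (nH i) + nB i <= m%:Z - 1)%R.
Proof.
case: (boolP (1 <= i <= k)) => hi'; last by have [-> [-> _]] := no_ints hi'; lia.
have := small_clique hi'; have := @density_le G (Q i) 1 m.
have h2 : 1 < #|Q i| by have := small_clique hi'; lia.
move=> /(_ h2 _ dm); have cl : {in Q i &, forall x y,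
    exists p, [/\ path (induced (Q i)) x p, last x p = y & size p <= 1]}.
  move=> x y xi yi; case: (eqVneq x y) => [->|xy]; first exact: reach0.
  by apply: reach1 => //; apply: (ch_clique ch hi').
by move=> /(_ cl); lia.
Qed.

(** The clique of [w] with the leaves of [w] has diameter 2, so at most $2m+1$ vertices. *)
Lemma star_small w : it w ->
  (Posz (lcG w) + (Posz (nH (bk w)) + nB (bk w)) + 1 <= m%:Z + m%:Z)%R.
Proof.
move=> iw; have [hb wQ] := it_bk iw; have qc := small_clique hb.
pose S := Q (bk w) :|: [set u | lf u && (par u == w)].
have lfQ u : lf u -> u \in Q (bk w) -> False.
  move=> lu uQ; have := subsetP (ch_core ch hb) _ uQ.
  by rewrite leaf_core; case/andP: lu => /andP[-> _].
have cS : #|S| = #|Q (bk w)| + lcG w.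
  rewrite cardsU (_ : _ :&: _ = set0) ?cards0 ?subn0; last first.
    by apply/setP => u; rewrite !inE; apply/negP => /andP[uQ /andP[lu _]]; apply: lfQ lu uQ.
  by rewrite /lcG /lc /leafw (sum_indicator (fun u => lf u && (par u == w)) vs_enum).
have wS : w \in S by rewrite inE wQ.
have tow x : x \in S -> reach S 1 x w.
  move=> xS; case/setUP: (xS) => [xQ|].
    case: (eqVneq x w) => [->|xw]; first exact: reach0.
    by apply: reach1 => //; apply: (ch_clique ch hb).
  by rewrite inE => /andP[lx /eqP pw]; apply: reach1 => //; rewrite -pw; case: (lf_par lx).
have S2 : 1 < #|S| by rewrite cS; lia.
have := @density_le G S 2 m S2 _ dm.
have con : {in S &, forall x y,
    exists p, [/\ path (induced S) x p, last x p = y & size p <= 2]}.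
  by move=> x y /tow xw /tow /reach_sym wy; apply: reach_trans xw wy _.
by move=> /(_ con); lia.
Qed.

Lemma nhublE i : nL i = \sum_(u <- vs) [&& lf u, it (par u) & bk (par u) == i].
Proof.
transitivity (\sum_(w <- vs) \sum_(u <- vs)
    ((it w && (bk w == i)) && (lf u && (par u == w)) : nat)).
  apply: eq_bigr => w _. rewrite /hubl; case: ifP => // _;
  by rewrite big1.
rewrite exchange_big; apply: eq_bigr => u _ /=.
have un : uniq vs by rewrite (perm_uniq vs_enum) enum_uniq.
have pu : par u \in vs by rewrite (perm_mem vs_enum) mem_enum.
rewrite (bigD1_seq (par u)) //= eqxx andbT big1 ?addn0; last first.
  by move=> w nw; rewrite [par u == w]eq_sym (negPf nw) !andbF.
by case: (lf u); rewrite ?andbT ?andbF.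
Qed.

(** The unfolding ends at a [j] with [loadG j + nL j <= 0]. The hub leaves of block [j] itself then
    drop out, which is why their sum starts at [j.+1]. *)
Lemma load_sum i : 0 < i -> (bl || (1 < i)) -> exists j,
  [/\ lo <= j, j < i & (loadG i + ((i - j) * (m - 1))%:Z <=
    Posz (\sum_(j <= t < i) (nH t + nB t + nS t) + \sum_(j.+1 <= t < i) nL t))%R].
Proof.
have [nh0 [nb0 nl0]] := @no_ints 0 isT.
have step i' : (loadG i'.+1 = spill m (loadG i') (nH i') (nB i') (nL i') (nS i'))%R by [].
have fresh i' : lo <= i' -> (loadG i' + nL i' <= 0)%R -> exists j,
  [/\ lo <= j, j < i'.+1 & (loadG i'.+1 + ((i'.+1 - j) * (m - 1))%:Z <=
    Posz (\sum_(j <= t < i'.+1) (nH t + nB t + nS t) + \sum_(j.+1 <= t < i'.+1) nL t))%R].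
  move=> li le; exists i'; split=> //; rewrite big_nat1 big_geq // step /spill subSnn; lia.
elim: i => // i IH _; case: i IH => [|i] IH hb.
  have b : bl by case: bl hb.
  by apply: fresh; rewrite ?nl0 // /lo b.
case: (leP (loadG i.+1 + nL i.+1)%R 0%R) => le.
  by apply: fresh; rewrite // /lo; case: bl.
case: (boolP (bl || (1 < i.+1))) => hb'; last first.
  (* Without $v_0$ the unfolding must end at block 1 at the latest. It does: neither $v_1$ nor the
     hubs of block 1 then have leaves, so the maximum is 0 there. *)
  have [nb i0] : ~~ bl /\ i = 0 by move: hb'; case: bl => //=; case: i {IH le hb}.
  subst i; exfalso; move: le; have sp0 : nS 0 = 0.
    apply: big1 => u _; rewrite /spinew; case: and3P => // -[lu spu /eqP b0].
    have := par_lf lu; rewrite (negPf (sp_it spu)) spu /= => i1.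
    have e1 : idx (par u) = 1 by move: b0; rewrite bk_sp //; lia.
    have [ev _] := sp_idx spu; rewrite e1 in ev.
    by have [] := end_nl en nb (proj1 (andP lu)); rewrite -ev eqxx.
  have nl1 : nL 1 = 0.
    rewrite nhublE; apply: big1 => u _; case: and3P => // -[lu iu /eqP b1].
    have [hb1 uq] := it_bk iu; rewrite b1 in hb1 uq.
    have [_ e] := end_nl en nb (proj1 (andP lu)).
    have k0 : 0 < k by lia.
    have h2 : lo <= 2 <= hi by apply: range_lohi; lia.
    by have := it_neq_v iu h2; rewrite (e k0 uq) eqxx.
  by rewrite step nh0 nb0 nl0 sp0 nl1 /spill /loadG /=; lia.
have [j [lj ji le']] := IH isT hb'; exists j; split=> //; first exact: ltnW.
rewrite step !(big_nat_recr i.+1) //; last exact: ltnW.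
rewrite /spill subSn 1?ltnW // mulSn; move: le' le => /=; lia.
Qed.

(** Hub leaves of the two extreme blocks and leaves of the extreme spine vertices $v_j$ and
    $v_{i+2}$ are left out: with them the diameter could exceed $i+2-j$. *)
Definition segment j i : {set G} := [set x |
  [|| sp x && (j <= idx x < i.+3), it x && (j <= bk x < i.+2) |
      lf x && (if it (par x) then j < bk (par x) < i.+1 else j <= bk (par x) < i.+1)]].

Lemma segment_reach j i : lo <= j -> j <= i -> i.+2 <= hi ->
  {in segment j i &, forall x y, reach (segment j i) (i.+2 - j) x y}.
Proof.
move=> lj ji ih; set S := segment j i.
have vS t : j <= t <= i.+2 -> v t \in S.
  by move=> ht; rewrite inE sp_v ?idx_v; lia.
have itS w : it w -> j <= bk w < i.+2 -> w \in S by move=> iw hw; rewrite inE iw hw orbT.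
have walk a n : j <= a -> a + n <= i.+2 -> reach S n (v a) (v (a + n)).
  move=> ja; elim: n => [|n IH] le; first by rewrite addn0; apply: reach0.
  apply: reach_trans (IH _) _ _; [lia| |exact: eq_leq (addn1 n)].
  by rewrite addnS; apply: reach1; rewrite ?vS ?adj_spine //; lia.
have vv a b N : j <= a -> a <= b -> b <= i.+2 -> b - a <= N -> reach S N (v a) (v b).
  move=> ja ab bi le; have := walk a (b - a) ja; rewrite subnKC // => /(_ bi) W.
  by apply: reach_trans W (reach0 S 0 _) _; rewrite addn0.
have iv w : it w -> j <= bk w < i.+2 -> reach S 1 w (v (bk w)) /\ reach S 1 w (v (bk w).+1).
  move=> iw hw; have [hb wq] := it_bk iw; have cl := ch_clique ch hb.
  have [v1 v2] : v (bk w) \in S /\ v (bk w).+1 \in S by split; apply: vS; lia.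
  have [h1 h2] : lo <= bk w <= hi /\ lo <= (bk w).+1 <= hi by split; apply: range_lohi; lia.
  split; apply: (reach1 (itS w iw hw)) => //.
    exact: cl wq (ch_left ch hb) (it_neq_v iw h1).
  exact: cl wq (ch_right ch hb) (it_neq_v iw h2).
have ii w w' : it w -> it w' -> j <= bk w < i.+2 -> bk w = bk w' -> reach S 1 w w'.
  move=> iw iw' hw e; case: (eqVneq w w') => [->|ne]; first exact: reach0.
  have [hb wq] := it_bk iw; have [_ wq'] := it_bk iw'; rewrite -e in wq'.
  by apply: reach1; rewrite ?itS -?e //; apply: (ch_clique ch hb).
(* Every vertex is [c <= 1] steps away from a spine vertex or from a clique vertex, and the
   inequalities leave [c] steps of slack to either end of the segment. The detours at the two ends
   of a walk along the spine are thus paid for by the parts of the spine that it skips. *)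
pose anchor x t c := [/\ reach S c x (v t), j + c <= t & t + c <= i.+2].
pose hook x w c := [/\ reach S c x w, it w, j + c <= bk w & bk w + c < i.+2].
have cases x : x \in S -> (exists t c, anchor x t c) \/ (exists w c, hook x w c).
  move=> xS; have := xS; rewrite inE => /or3P[/andP[sx hx]|/andP[ix hx]|/andP[lx hx]].
  - left; exists (idx x), 0; rewrite /anchor (proj1 (sp_idx sx)).
    by split; [exact: reach0|lia|lia].
  - by right; exists x, 0; split; [exact: reach0| |lia|lia].
  have [_ xp] := lf_par lx; case ip: (it (par x)) hx => hx.
    right; exists (par x), 1; split=> //; try lia.
    by apply: reach1 => //; apply: itS => //; lia.
  have := par_lf lx; rewrite ip => /andP[sx x0]; have [ev _] := sp_idx sx.
  move: hx; rewrite bk_sp // => hx; left; exists (idx (par x)), 1; split; try lia.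
  by rewrite ev; apply: reach1 => //; rewrite -ev vS //; lia.
have AA x y t c t' c' : t <= t' -> anchor x t c -> anchor y t' c' -> reach S (i.+2 - j) x y.
  move=> tt [r1 a1 b1] [/reach_sym r2 a2 b2].
  apply: reach_trans r1 (reach_trans (vv t t' (t' - t) _ tt _ (leqnn _)) r2 (leqnn _)) _; lia.
have AH x y t c w c' : anchor x t c -> hook y w c' -> reach S (i.+2 - j) x y.
  move=> [r1 a1 b1] [/reach_sym r2 iw a2 b2].
  have hw : j <= bk w < i.+2 by lia.
  have [/reach_sym w1 /reach_sym w2] := iv w iw hw.
  case: (leqP t (bk w)) => tw.
    apply: reach_trans r1 (reach_trans (vv t (bk w) (bk w - t) _ tw _ (leqnn _))
             (reach_trans w1 r2 (leqnn _)) (leqnn _)) _; lia.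
  apply: reach_trans r1 (reach_trans (reach_sym (vv (bk w).+1 t (t - (bk w).+1) _ tw _ (leqnn _)))
             (reach_trans w2 r2 (leqnn _)) (leqnn _)) _; lia.
have HH x y w c w' c' : bk w <= bk w' -> hook x w c -> hook y w' c' -> reach S (i.+2 - j) x y.
  move=> ww [r1 iw a1 b1] [/reach_sym r2 iw' a2 b2].
  have hw : j <= bk w < i.+2 by lia.
  have hw' : j <= bk w' < i.+2 by lia.
  case: (ltngtP (bk w) (bk w')) ww => // [lt _|e _].
    have [_ w1] := iv w iw hw; have [/reach_sym w2 _] := iv w' iw' hw'.
    apply: reach_trans r1 (reach_trans w1 (reach_trans
      (vv (bk w).+1 (bk w') (bk w' - (bk w).+1) _ lt _ (leqnn _))
      (reach_trans w2 r2 (leqnn _)) (leqnn _)) (leqnn _)) _; lia.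
  apply: reach_trans r1 (reach_trans (ii w w' iw iw' hw e) r2 (leqnn _)) _; lia.
move=> x y /cases[[t [c X]]|[w [c X]]] /cases[[t' [c' Y]]|[w' [c' Y]]].
- by case/orP: (leq_total t t') => le; [apply: AA X Y|apply/reach_sym/(AA _ _ _ _ _ _ le Y X)].
- exact: AH X Y.
- exact/reach_sym/(AH _ _ _ _ _ _ Y X).
- by case/orP: (leq_total (bk w) (bk w')) => le;
  [apply: HH X Y|apply/reach_sym/(HH _ _ _ _ _ _ le Y X)].
Qed.

(** Exchanging the sums over blocks and over vertices reduces this to one vertex at a time, where at
    most one of the kinds applies. *)
Lemma segment_card j i : lo <= j -> j <= i -> i.+2 <= hi ->
  \sum_(j <= t < i.+2) (nH t + nB t) + \sum_(j <= t < i.+1) nS t +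
  \sum_(j.+1 <= t < i.+1) nL t + (i.+3 - j) <= #|segment j i|.
Proof.
move=> lj ji ih.
have e1 : \sum_(j <= t < i.+2) (nH t + nB t) =
    \sum_(x <- vs) \sum_(j <= t < i.+2) (it x && (bk x == t) : nat).
  rewrite [RHS]exchange_big; apply: eq_bigr => t _ /=; rewrite /nH /nB /nhub /nbare -big_split.
  by apply: eq_bigr => x _; apply: ints_split.
have e2 : \sum_(j <= t < i.+1) nS t =
    \sum_(x <- vs) \sum_(j <= t < i.+1) ([&& lf x, sp (par x) & bk (par x) == t] : nat).
  by rewrite [RHS]exchange_big; apply: eq_bigr => t _.
have e3 : \sum_(j.+1 <= t < i.+1) nL t =
    \sum_(x <- vs) \sum_(j.+1 <= t < i.+1) ([&& lf x, it (par x) & bk (par x) == t] : nat).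
  by rewrite [RHS]exchange_big; apply: eq_bigr => t _; rewrite nhublE.
have e4 : i.+3 - j <= \sum_(x <- vs) (sp x && (j <= idx x < i.+3) : nat).
  rewrite (sum_indicator (fun x => sp x && (j <= idx x < i.+3)) vs_enum).
  rewrite -(size_iota j (i.+3 - j)) -(size_map v).
  have u : uniq (map v (iota j (i.+3 - j))).
    by rewrite map_inj_in_uniq ?iota_uniq // => a b; rewrite !mem_iota => ha hb; apply: v_inj; lia.
  rewrite -(card_uniqP u); apply/subset_leq_card/subsetP => _ /mapP[t + ->].
  by rewrite mem_iota inE => ht; rewrite sp_v ?idx_v; lia.
have fac (b : bool) f a c : \sum_(a <= t < c) (b && (f == t) : nat) = b && (a <= f < c) :> nat.
  by case: b => /=; [apply: sum_eqn|rewrite big1].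
apply: (leq_trans (n := \sum_(x <- vs) ((it x && (j <= bk x < i.+2)) +
   ([&& lf x, sp (par x) & j <= bk (par x) < i.+1]) +
   ([&& lf x, it (par x) & j < bk (par x) < i.+1]) + (sp x && (j <= idx x < i.+3))))).
  rewrite e1 e2 e3 [leqRHS]big_split leq_add //=; apply: eq_leq.
  rewrite [RHS]big_split [X in _ = X + _]big_split /=.
  congr (_ + _ + _); apply: eq_bigr => x _; first exact: fac.
    by under eq_bigr do rewrite andbA; rewrite fac -andbA.
  by under eq_bigr do rewrite andbA; rewrite fac -andbA.
rewrite -card_setE; apply: leq_sum => x _; rewrite inE.
case: (boolP (sp x)) => sx; first by rewrite (negPf (sp_it sx)) (negPf (sp_lf sx)) /=; lia.
case: (boolP (it x)) => ix; first by rewrite (negPf (it_lf ix)) /=; lia.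
case: (boolP (lf x)) => lx //=; have := par_lf lx.
case: (boolP (it (par x))) => ip /=; last by case/andP=> -> _; lia.
by rewrite (negPf (contraL (@sp_it _) ip)) /=; lia.
Qed.

Lemma bare_end i : 0 < i -> ~~ br -> k <= i -> nS i = 0 /\ nL i = 0.
Proof.
move=> i0 nb ki; have nr := end_nr en nb.
split; last first.
  rewrite nhublE; apply: big1 => u _; case: and3P => // -[lu iu /eqP b1].
  have [hb uq] := it_bk iu; have bk' : bk (par u) = k by lia.
  have k0 : 0 < k by lia.
  rewrite bk' in uq hb; have [_ e] := nr u (proj1 (andP lu)).
  have hk : lo <= k <= hi by apply: range_lohi; lia.
  by have := it_neq_v iu hk; rewrite (e k0 uq) eqxx.
apply: big1 => u _; rewrite /spinew; case: and3P => // -[lu spu /eqP b0].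
have [pc _] := lf_par lu; have hx := sp_core spu pc; have [ev _] := sp_idx spu.
have e1 : idx (par u) = k.+1 by move: b0; rewrite bk_sp //; lia.
by rewrite e1 in ev; have [] := nr u (proj1 (andP lu)); rewrite -ev eqxx.
Qed.

Lemma spine_end i : k < i -> nS i = 0.
Proof.
move=> ki; apply: big1 => u _; rewrite /spinew; case: and3P => // -[lu spu /eqP b0].
have [pc _] := lf_par lu; have hx := sp_core spu pc.
by move: b0; rewrite bk_sp //; lia.
Qed.

(** The segment from [j] to [i] has at most $m(i+2-j)+1$ vertices; subtracting its $i+3-j$ spine
    vertices and the $(i+1-j)(m-1)$ of [load_sum] leaves exactly $m-1$. *)
Lemma load_small i : (loadG i + (Posz (nH i) + nB i) <= m%:Z - 1)%R.
Proof.
have [nh0 [nb0 nl0]] := @no_ints 0 isT.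
have step i' : (loadG i'.+1 = spill m (loadG i') (nH i') (nB i') (nL i') (nS i'))%R by [].
elim: i => [|i IH]; first by rewrite nh0 nb0 /loadG /=; lia.
case: (boolP ((i.+2 <= hi) && (bl || (0 < i)))) => [/andP[ih hb]|].
  have [j [lj ji le]] := @load_sum i.+1 isT hb.
  have := segment_card lj ji ih.
  have S2 : 1 < #|segment j i|.
    apply: leq_trans (segment_card lj ji ih); lia.
  have := density_le S2 (segment_reach lj ji ih) dm.
  rewrite big_nat_recr /=; last lia.
  move: le; rewrite !big_split /=.
  rewrite (_ : i.+2 - j = (i.+1 - j).+1); last lia.
  rewrite (_ : i.+3 - j = (i.+1 - j).+2); last lia.
  (* The only product of two unknowns is named, so that the rest is linear. *)
  case: m m1 => // m' _; rewrite subn1 /= mulSn mulnC !mulnS; set P := (i.+1 - j) * m'.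
  lia.
(* No segment is available at an absent left end, where [load 1] is [1 - m], nor beyond the right
   end, where no clique vertices follow and the last block has neither hub leaves nor leaves of its
   right spine vertex. *)
rewrite negb_and => hn; case: (boolP (bl || (0 < i))) hn => [hb|nb _]; last first.
  have [{}nb i0] : ~~ bl /\ i = 0 by move: nb; case: bl => //=; case: i {IH}.
  subst i; have sp0 : nS 0 = 0.
    apply: big1 => u _; rewrite /spinew; case: and3P => // -[lu spu /eqP b0].
    have [pc _] := lf_par lu; have hx := sp_core spu pc; have [ev _] := sp_idx spu.
    have e1 : idx (par u) = 1 by move: b0; rewrite bk_sp //; lia.
    by rewrite e1 in ev; have [] := end_nl en nb (proj1 (andP lu)); rewrite -ev eqxx.
  by have := small 1; rewrite step nh0 nb0 nl0 sp0 /spill /loadG /=; lia.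
rewrite orbF -ltnNge => ih; have ki : k <= i by move: ih; rewrite /hi; case: br; lia.
have [[-> [-> _]] [nL0 nS0]] : (nH i.+1 = 0 /\ nB i.+1 = 0 /\ nL i.+1 = 0) /\ nL i = 0 /\ nS i = 0.
  split; first by apply: no_ints; lia.
  case: (ltnP k i) => ki'.
    by split; [have [|_ [_ ->]] := @no_ints i; first lia|apply: spine_end].
  have nb : ~~ br by move: ih; rewrite /hi; case: br => //; lia.
  case: (posnP i) => i0; last by have [-> ->] := bare_end i0 nb ki.
  subst i; split=> //; apply: big1 => u _; rewrite /spinew; case: and3P => // -[lu spu /eqP b0].
  have [pc _] := lf_par lu; have hx := sp_core spu pc; have [ev _] := sp_idx spu.
  have e1 : idx (par u) = k.+1 by move: b0; rewrite bk_sp //; lia.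
  by rewrite e1 in ev; have [] := end_nr en nb (proj1 (andP lu)); rewrite -ev eqxx.
by rewrite step nL0 nS0 /spill; have := small i; move: IH; lia.
Qed.

End Spine.

(** * Left-justification *)

Section Embedding.
Variables (G : sgraph) (k : nat) (v : nat -> G) (Q : nat -> {set G}) (bl br : bool) (m : nat).
Variables (vs : seq G) (a h : nat -> int).
Hypothesis ch : chain k v Q.
Hypothesis en : ends k v Q bl br.
Hypothesis vs_enum : perm_eq vs (enum G).
Hypothesis m1 : 0 < m.
Hypothesis dm : local_density G <= m.
Implicit Types (x y z u w : G).

Local Notation spG := (sp k v bl br).
Local Notation idxG := (idx k v bl br).
Local Notation itG := (it k v bl br).
Local Notation lfG := (lf k v bl br).
Local Notation bkG := (bk k v Q bl br).
Local Notation parG := (@par G).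

Definition cpos : G -> int := pos vs m spG itG lfG idxG bkG parG a h.
Hypothesis a_h : forall i, splits vs m spG itG lfG bkG parG a h i.

Local Open Scope ring_scope.

Let vs_uniq : uniq vs. Proof. by rewrite (perm_uniq vs_enum) enum_uniq. Qed.
Let vs_all x : x \in vs. Proof. by rewrite (perm_mem vs_enum) mem_enum. Qed.
Let sp_it' : forall x, spG x -> ~~ itG x := @sp_it G k v bl br.
Let sp_lf' : forall x, spG x -> ~~ lfG x := @sp_lf G k v bl br.
Let it_lf' : forall x, itG x -> ~~ lfG x := @it_lf G k v bl br.
Let idx_inj' : {in spG &, injective idxG} := idx_inj ch en.
Let bk_sp' : forall x, spG x -> bkG x = (idxG x).-1 := @bk_sp G k v Q bl br.
Let par_lf' : forall u, lfG u -> itG (parG u) || spG (parG u) && (0 < idxG (parG u))%N :=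
  par_lf ch en.
Let m1' : 1 <= m%:Z. Proof. by []. Qed.
Let small' := small bl br ch vs_enum m1 dm.
Let load_small' := load_small ch en vs_enum m1 dm.
Let star_small' := star_small (bl := bl) (br := br) ch vs_enum m1 dm.

Local Notation placedG := (placed itG lfG).

Lemma core_placed x : x \in core G -> spG x || itG x.
Proof. by rewrite /it => ->; rewrite /= orbN. Qed.

Lemma hang_placed x : hangs x -> spG x || lfG x.
Proof. by rewrite /lf => ->; rewrite orbN. Qed.

Lemma cpos_v i : (lo bl <= i <= hi k br)%N -> cpos (v i) = i%:Z * m.
Proof.
move=> hi'; have spv : spG (v i) by apply: sp_v.
by rewrite /cpos /pos spv (idx_v ch en hi').
Qed.

Lemma cpos_inj : {in [pred x | (x \in core G) || hangs x] &, injective cpos}.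
Proof.
have sub x : (x \in core G) || hangs x -> spG x || placedG x.
  by case/orP => [/core_placed|/hang_placed] /orP[->//|e]; rewrite /placed e ?orbT.
move=> x y hx hy; apply: (pos_inj (a := a) (h :=
  h) vs_uniq vs_all sp_it' sp_lf' it_lf' idx_inj' bk_sp' par_lf' m1'
  small' load_small' a_h); exact: sub.
Qed.

Lemma it_cpos x : itG x -> (bkG x)%:Z * m < cpos x < (bkG x).+1%:Z * m.
Proof.
move=> ix; have px : placedG x by rewrite /placed ix.
rewrite /cpos (posE _ _ _ _ _ _ _ sp_it' sp_lf' px) it_block //.
have [] := it_off_range vs_uniq vs_all m1' small' load_small' a_h ix.
by rewrite intS mulrDl mul1r; lia.
Qed.

Lemma Q_cpos i x : (1 <= i <= k)%N -> x \in Q i -> i%:Z * m <= cpos x <= i.+1%:Z * m.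
Proof.
move=> hi' xi; have [hl hr] : (lo bl <= i <= hi k br)%N /\ (lo bl <= i.+1 <= hi k br)%N.
  by split; apply: range_lohi; lia.
case: (eqVneq x (v i)) => [->|n1]; first by rewrite cpos_v // intS mulrDl; lia.
case: (eqVneq x (v i.+1)) => [->|n2]; first by rewrite cpos_v // intS mulrDl; lia.
have [ix <-] := it_Q ch en hi' xi n1 n2.
by have := it_cpos ix; lia.
Qed.

Lemma leaf_cases u : hangs u -> lfG u \/
  (bl /\ u = v 0 /\ parG u = v 1) \/ (br /\ u = v k.+2 /\ parG u = v k.+1).
Proof.
move=> hu; case/orP: (hang_placed hu) => [su|]; last by left.
right; have [ev hx] := sp_idx ch en su; have /andP[uL _] := hu.
have nc : ~~ (1 <= idx k v bl br u <= k.+1)%N.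
  by apply: contraL uL => c; rewrite -leaf_core -ev (v_core ch).
move: hx nc ev; rewrite /lo /hi; case: bl en => en'; case: br en' => en' hx nc ev.
- have [e|e] : idx k v true true u = 0%N \/ idx k v true true u = k.+2 by lia.
    by left; have := end_l en' isT; rewrite -ev e leaves_atE => /andP[_ /eqP].
  by right; have := end_r en' isT; rewrite -ev e leaves_atE => /andP[_ /eqP].
- have e : idx k v true false u = 0%N by lia.
  by left; have := end_l en' isT; rewrite -ev e leaves_atE => /andP[_ /eqP].
- have e : idx k v false true u = k.+2 by lia.
  by right; have := end_r en' isT; rewrite -ev e leaves_atE => /andP[_ /eqP].
- lia.
Qed.

(** A core edge lies in one clique $Q_i$, whose vertices have positions from $im$ to $(i+1)m$. A
    leaf edge is covered by [leaf_near], unless the leaf is an end of the spine. *)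
Lemma cpos_near x y : (x \in core G) || hangs x -> (y \in core G) || hangs y ->
  adj x y -> `|cpos x - cpos y| <= m%:Z.
Proof.
have lc u y' : hangs u -> adj u y' -> `|cpos u - cpos y'| <= m%:Z.
  move=> hu; have /andP[uL _] := hu; rewrite (parP _ uL) => /eqP->.
  case: (leaf_cases hu) => [lu|[[b [eu ep]]|[b [eu ep]]]].
  - rewrite distrC; exact: (leaf_near vs_uniq vs_all sp_it' sp_lf' it_lf' idx_inj' bk_sp' par_lf' m1'
      small' load_small' star_small' a_h lu).
  - have h0 : (lo bl <= 0 <= hi k br)%N by rewrite /lo b.
    have h1 : (lo bl <= 1 <= hi k br)%N by apply: range_lohi.
    by rewrite ep eu !cpos_v //; lia.
  - have h0 : (lo bl <= k.+2 <= hi k br)%N by rewrite /lo /hi b; case: bl => /=; lia.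
    have h1 : (lo bl <= k.+1 <= hi k br)%N by apply: range_lohi; lia.
    by rewrite ep eu !cpos_v // [k.+2%:Z]intS mulrDl mul1r; lia.
case/orP => [xc|hx]; last by move=> _; apply: lc.
case/orP => [yc|hy] xy; last by rewrite distrC; apply: lc; rewrite // adj_sym.
have [i [hi' xi yi]] := ch_edge ch xc yc xy.
have := Q_cpos hi' xi; have := Q_cpos hi' yi; rewrite intS mulrDl mul1r; lia.
Qed.

Lemma bk_v t : (1 <= t <= k.+1)%N -> bkG (v t) = t.-1.
Proof.
move=> ht; have hl : (lo bl <= t <= hi k br)%N by apply: range_lohi.
by rewrite bk_sp ?(idx_v ch en) //; apply: sp_v.
Qed.

Lemma sp_not_inside x i : spG x -> ~ inJ m i (cpos x).
Proof.
move=> sx; rewrite /inJ /cpos /pos sx intS mulrDl mul1r => hp.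
have := @mulz_offset_inj _ _ _ vs_uniq m1' i (idxG x) ((idxG x)%:Z * m - i%:Z * m) 0.
by rewrite addr0 addrC subrK => W; have [] := W erefl _ _; lia.
Qed.

End Embedding.

(** * The left-justified representation when both end leaves are present *)

Section Justified.
Variables (G : sgraph) (k : nat) (v : nat -> G) (Q : nat -> {set G}) (m : nat).
Variables (vs : seq G) (a h : nat -> int).
Hypothesis ch : chain k v Q.
Hypothesis en : ends k v Q true true.
Hypothesis vs_enum : perm_eq vs (enum G).
Hypothesis m1 : 0 < m.
Hypothesis dm : local_density G <= m.
Hypothesis k1 : 0 < k.
Hypothesis all_hang : forall x : G, (x \in core G) || hangs x.
Hypothesis Q0 : Q 0 = [set v 0; v 1].
Hypothesis Qk : Q k.+1 = [set v k.+1; v k.+2].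
Implicit Types (x y z u w : G).

Local Notation sp := (sp k v true true).
Local Notation idx := (idx k v true true).
Local Notation it := (it k v true true).
Local Notation lf := (lf k v true true).
Local Notation bk := (bk k v Q true true).
Local Notation par := (@par G).
Local Notation f := (cpos k v Q true true m vs a h).
Local Notation placedG := (placed it lf).

Hypothesis a_h : forall i, splits vs m sp it lf bk par a h i.

Let vs_uniq : uniq vs. Proof. by rewrite (perm_uniq vs_enum) enum_uniq. Qed.
Let vs_all x : x \in vs. Proof. by rewrite (perm_mem vs_enum) mem_enum. Qed.
Let sp_it' : forall x, sp x -> ~~ it x := @sp_it G k v true true.
Let sp_lf' : forall x, sp x -> ~~ lf x := @sp_lf G k v true true.
Let it_lf' : forall x, it x -> ~~ lf x := @it_lf G k v true true.
Let idx_inj' : {in sp &, injective idx} := idx_inj ch en.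
Let bk_sp' : forall x, sp x -> bk x = (idx x).-1 := @bk_sp G k v Q true true.
Let par_lf' : forall u, lf u -> it (par u) || sp (par u) && (0 < idx (par u)) := par_lf ch en.
Let m1' : (1 <= m%:Z)%R. Proof. by []. Qed.
Let small' := small true true ch vs_enum m1 dm.
Let load_small' := load_small ch en vs_enum m1 dm.

Lemma kinds x : sp x || placedG x.
Proof.
by case/orP: (all_hang x) => [/(core_placed k v true true)|/(hang_placed k v true true)] /orP[->//|e];
  rewrite /placed e ?orbT.
Qed.

Lemma leaf_v0 : v 0 \in leaves G /\ par (v 0) = v 1.
Proof. by have := end_l en isT; rewrite leaves_atE => /andP[-> /eqP]. Qed.

Lemma leaf_vk : v k.+2 \in leaves G /\ par (v k.+2) = v k.+1.
Proof. by have := end_r en isT; rewrite leaves_atE => /andP[-> /eqP]. Qed.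

Lemma core_in_Q i y : i <= k.+1 -> y \in core G -> y \in Q i ->
  [\/ 0 < i /\ y = v i, i <= k /\ y = v i.+1 | it y /\ bk y = i].
Proof.
move=> ik yc yi; have nc t : v t \in leaves G -> y <> v t.
  by move=> vt e; move: yc; rewrite e leaf_core vt.
case: (posnP i) => i0.
  subst i; move: yi; rewrite Q0 => /set2P[/nc|->]; last by constructor 2.
  by case; have [] := leaf_v0.
case: (ltnP k i) => ki.
  have ei : i = k.+1 by lia.
  subst i; move: yi; rewrite Qk => /set2P[->|/nc]; first by constructor 1.
  by case; have [] := leaf_vk.
have hi' : 1 <= i <= k by lia.
case: (eqVneq y (v i)) => [->|n1]; first by constructor 1.
case: (eqVneq y (v i.+1)) => [->|n2]; first by constructor 2.
by constructor 3; apply: (it_Q ch en).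
Qed.

Local Open Scope ring_scope.

Lemma occP (t : nat) (p : int) : inJ m t (t%:Z * m + p) ->
  occupied f (t%:Z * m + p) <-> occ vs m sp it lf idx bk par a h t p.
Proof.
move=> hJ; split=> [[x fx]|[x px fx]]; last by exists x.
exists x => //; have := kinds x; case/orP => // sx; exfalso.
by have := sp_not_inside (Q := Q) (a := a) (h := h) vs_enum m1 dm (i := t) sx; rewrite fx; apply.
Qed.

Lemma inJP (t : nat) (p : int) : inJ m t p <-> 0 < p - t%:Z * m < m%:Z.
Proof. by rewrite /inJ intS mulrDl mul1r; split; lia. Qed.

Lemma fv i : (i <= k.+2)%N -> f (v i) = i%:Z * m.
Proof. by move=> ik; apply: (cpos_v _ _ _ _ ch en). Qed.

Lemma par_range b : lf b -> m%:Z <= f (par b) <= k.+1%:Z * m.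
Proof.
move=> lb; have [pc _] := lf_par lb.
case: (ch_cover ch pc) => [->|[i hi' pQ]].
  by rewrite fv // mul1r lexx -[leLHS]mul1r ler_pM2r ?ltz_nat // lez_nat.
have /andP[l1 l2] := Q_cpos ch en vs_enum m1 dm a_h hi' pQ; have /andP[i1 ik] := hi'.
apply/andP; split.
  by apply: le_trans l1; rewrite -[leLHS]mul1r ler_pM2r ?lez_nat // ltz_nat.
by apply: le_trans l2 _; rewrite ler_pM2r ?lez_nat // ltz_nat.
Qed.

(** The end leaves $v_0$ and $v_{k+2}$ have to be the outermost leaves. The others lie in the cells
    0 to $k$; these start at 1 and end by $(k+2)m$, because the load after them is at most $m-1$. *)
Lemma lf_range b : lf b -> 0 < f b < k.+2%:Z * m.
Proof.
move=> lb; have pb : placedG b by rewrite /placed lb orbT.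
have /andP[lo' up] : cell_start vs m sp it lf bk par (block it bk par b) <= f b <
    cell_start vs m sp it lf bk par (block it bk par b).+1.
  exact: (pos_range vs_uniq vs_all sp_it' sp_lf' it_lf' idx_inj' bk_sp' par_lf' m1'
    small' load_small' a_h pb).
have Am := @cell_start_mono _ vs m sp it lf bk par vs_uniq m1'.
have bb : (block it bk par b <= k)%N.
  rewrite (lf_block bk par it_lf' lb); case/orP: (par_lf' lb) => [ib|/andP[sb _]].
    by have [/andP[]] := it_bk ch ib.
  have [pc _] := lf_par lb; have /andP[_ ik] := sp_core ch en sb pc.
  by rewrite bk_sp' // -subn1 leq_subLR add1n.
have l0 := le_trans (Am _ _ (leq0n _)) lo'.
have l1 := lt_le_trans up (Am (block it bk par b).+1 k.+1 bb).
have A0 : cell_start vs m sp it lf bk par 0 = 1 by rewrite /cell_start mul0r.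
rewrite (lt_le_trans _ l0) ?A0 //= (lt_le_trans l1) //.
rewrite /cell_start /start_off [k.+2%:Z]intS mulrDl mul1r addrC lerD2r.
by move: (load_small' k.+1); clear; case: ifP; lia.
Qed.

Lemma cpos_left_justified : left_justified k v Q m f.
Proof.
split.
- split=> [x y e|x y xy].
    exact: (cpos_inj ch en vs_enum m1 dm a_h (all_hang x) (all_hang y) e).
  exact: (cpos_near ch en vs_enum m1 dm a_h (all_hang x) (all_hang y) xy).
- move=> x y u w lt; rewrite !leaves_atE => /andP[uL /eqP pu] /andP[wL /eqP pw].
  have hu : hangs u by have := all_hang u; rewrite leaf_core uL.
  have hw : hangs w by have := all_hang w; rewrite leaf_core wL.
  rewrite -{}pu -{}pw in lt.
  have ngt t t' : (t' <= t <= k.+2)%N -> ~ f (v t) < f (v t').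
    by move=> ht; rewrite !fv; [|lia|lia]; apply/negP; rewrite -leNgt ler_pM2r ?lez_nat; lia.
  case: (leaf_cases ch en vs_enum m1 dm hu) => [lu|[[_ [eu pu]]|[_ [eu pu]]]].
  + case: (leaf_cases ch en vs_enum m1 dm hw) => [lw|[[_ [ew pw]]|[_ [ew pw]]]].
    * exact: (leaf_faithful vs_uniq vs_all sp_it' sp_lf' it_lf' idx_inj' bk_sp' par_lf' m1'
        small' load_small' a_h lu lw lt).
    * by have := par_range lu; move: lt; rewrite pw fv // mul1r; lia.
    * by have := lf_range lu; rewrite ew fv //; lia.
  + case: (leaf_cases ch en vs_enum m1 dm hw) => [lw|[[_ [ew pw]]|[_ [ew pw]]]].
    * by have := lf_range lw; rewrite eu fv //; lia.
    * by move: lt; rewrite pu pw ltxx.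
    * by rewrite eu ew !fv //; lia.
  + case: (leaf_cases ch en vs_enum m1 dm hw) => [lw|[[_ [ew pw]]|[_ [ew pw]]]].
    * by have := par_range lw; move: lt; rewrite pu fv //; lia.
    * by move: lt; rewrite pu pw => /ngt; case; lia.
    * by move: lt; rewrite pu pw ltxx.
- exact: fv.
- move=> i ik p q pJ qJ op oq; rewrite ltNge; apply/negP => qp.
  have {}qp : q < p by rewrite lt_neqAle qp andbT; apply/eqP => e; apply: oq; rewrite e.
  case: oq.
  have ep : p = i%:Z * m + (p - i%:Z * m) by lia.
  have eq : q = i%:Z * m + (q - i%:Z * m) by lia.
  rewrite eq; apply/occP; rewrite -?eq //.
  have hp := (inJP i p).1 pJ; have hq := (inJP i q).1 qJ.
  apply: (occ_left vs_uniq vs_all sp_it' sp_lf' it_lf' idx_inj' bk_sp' par_lf' m1'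
      small' load_small' a_h (p := p - i%:Z * m)); try lia.
  by apply/occP; rewrite -ep.
- move=> i ik nfull x xN xQ xJ; apply: nfull => p pJ.
  have [sx|] := boolP (sp x); first by have := sp_not_inside vs_enum m1 dm sx xJ.
  have := kinds x; case/orP => [->//|px _].
  have ep : p = i%:Z * m + (p - i%:Z * m) by lia.
  rewrite ep; apply/occP; rewrite -?ep //.
  (* A core vertex off the spine inside $J_{i+1}$ would belong to $Q_{i+1}$, which is excluded. A
     leaf there has its neighbor in $Q_i$, so its block is at most [i], and it witnesses that $J_i$
     is full. *)
  case/orP: px => [ix|lx].
    have [hb xq] := it_bk ch ix; have hx := it_cpos ch en vs_enum m1 dm a_h ix.
    have hJ := (inJP _ _).1 xJ; rewrite [(bk x).+1%:Z]intS mulrDl mul1r in hx.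
    have [eb _] : bk x = i.+1 /\ f x - (bk x)%:Z * m = f x - i.+1%:Z * m.
      by apply: (@mulz_offset_inj _ _ _ vs_uniq m1'); lia.
    by move: xQ; rewrite -eb xq => /(_ _); case: (leqP i k) => // ki W; [have := W isT|lia].
  apply: (full_of_spill vs_uniq vs_all sp_it' sp_lf' it_lf' idx_inj' bk_sp' par_lf' m1'
      small' load_small' a_h lx); [|by have := (inJP _ _).1 xJ; rewrite /cpos;
        lia|exact: (inJP i p).1].
  move: xN; rewrite inE => /existsP[y /andP[yi xy]].
  have [pc _] := lf_par lx; have /andP[/andP[xL _] _] := lx.
  rewrite (parP _ xL) in xy; rewrite (eqP xy) in yi.
  case: (core_in_Q ik pc yi) => [[i0 ->]|[ik' ->]|[_ ->]//]; rewrite (bk_v ch en); lia.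
- move=> i ik x y /setD1P[nx xQ]; rewrite leaves_atE => /andP[yL /eqP py] nxy.
  have hy : hangs y by have := all_hang y; rewrite leaf_core yL.
  have vi j : (j <= k.+2)%N -> par y = v j -> j = i.+1.
    by move=> jk; rewrite py => /(v_inj ch en) -> //; rewrite /lo /hi /=; lia.
  case: (leaf_cases ch en vs_enum m1 dm hy) => [ly|[[_ [ey pvy]]|[_ [ey pvy]]]]; last first.
  + have [ei] := vi k.+1 (ltnW (ltnSn _)) pvy; subst i; rewrite ey fv //.
    have hk : (1 <= k <= k)%N by lia.
    have /andP[_ le] := Q_cpos ch en vs_enum m1 dm a_h hk xQ.
    by rewrite [k.+2%:Z]intS mulrDl mul1r; lia.
  (* Here [i = 0] and [y] is $v_0$, while the only vertex of $Q_0$ other than $v_1$ is $v_0$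
     again. *)
  + have [ei] := vi 1%N isT pvy; subst i; move: xQ nx nxy.
    by rewrite Q0 ey => /set2P[]->; rewrite eqxx.
  have [pc _] := lf_par ly; have ki : (i <= k)%N.
    rewrite leqNgt; apply/negP => ki; have ei : i = k.+1 by apply/eqP; rewrite eqn_leq ik.
    by have [l _] := leaf_vk; move: pc; rewrite py ei leaf_core l.
  have hv : (1 <= i.+1 <= k.+1)%N by rewrite ltnS.
  have sy : sp (par y) by rewrite py; apply/sp_v/range_lohi.
  have by' : bk (par y) = i by rewrite py (bk_v ch en).
  have gt := spine_leaf_gt vs_uniq vs_all sp_it' sp_lf' it_lf' idx_inj' bk_sp' par_lf' m1'
      small' load_small' a_h ly sy.
  rewrite by' in gt; case: (boolP (x \in core G)) => xc.
    case: (core_in_Q ik xc xQ) => [[i0 ex]|[_ ex]|[ix bx]].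
    * by rewrite ex fv ?gt // (leq_trans ki) // !leqW.
    * by rewrite ex eqxx in nx.
    * by apply: (it_before_spine_leaf vs_uniq vs_all sp_it' sp_lf' it_lf' idx_inj' bk_sp' par_lf' m1'
      small' load_small' a_h ix ly sy); rewrite by' bx.
  case: (posnP i) => i0; last first.
    have hi' : (1 <= i <= k)%N by rewrite i0.
    by rewrite (subsetP (ch_core ch hi') _ xQ) in xc.
  move: xQ xc; rewrite i0 Q0 => /set2P[->|->]; last by rewrite (ch_v1 ch).
  by move=> _; rewrite fv //; move: gt; rewrite i0.
Qed.

End Justified.

(** * Existence of split points *)

Section SplitPoints.
Variables (V : finType) (vs : seq V) (m : int) (sp it lf : pred V) (bk : V -> nat) (par : V -> V).

Lemma splits_exist : exists a h, forall i, splits vs m sp it lf bk par a h i.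
Proof.
pose c i := [pick w | critical vs m sp it lf bk par i w].
exists (fun i => if c i is Some w then Posz (hub_rank vs it lf bk par w)
  else Posz (nhub vs it lf bk par i)).
exists (fun i => let x := load vs m sp it lf bk par i in
  if c i is Some w then
    Num.max (Num.max x 0) (first vs m sp it lf bk par w + Posz (lc vs lf par w)
      - room m x (nhub vs it lf bk par i) (nbare vs it lf bk par i)
      - Posz (hub_rank vs it lf bk par w))
  else Num.max x 0)%R => i.
rewrite /splits /c; case: pickP => [w cw|nc]; [right|left].
  by exists w.
by split=> //; split=> // w; rewrite nc.
Qed.

End SplitPoints.

(** * Programs *)

Section Programs.
Local Open Scope ring_scope.

Definition runs (c : cmd) (s : state) (B : nat) (P : state -> Prop) :=
  exists t s', [/\ exec c s t s', (t <= B)%N & P s'].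

(** Weakest preconditions compute on loop-free commands, whose cost is bounded by [steps]; loops are
    excluded here and handled by [runs_for]. *)
Fixpoint wp (c : cmd) (s : state) (P : state -> Prop) : Prop :=
  match c with
  | Skip => P s
  | Assign r e => P (set_reg s r (eval s e))
  | Store a e1 e2 => P (set_arr s a (eval s e1) (eval s e2))
  | Seq c1 c2 => wp c1 s (fun s1 => wp c2 s1 P)
  | If e c1 c2 => if 0 < eval s e then wp c1 s P else wp c2 s P
  | While _ _ => False
  end.

Fixpoint steps (c : cmd) : nat :=
  match c with
  | Skip | Assign _ _ | Store _ _ _ => 1
  | Seq c1 c2 => steps c1 + steps c2
  | If _ c1 c2 => (maxn (steps c1) (steps c2)).+1
  | While _ _ => 0
  end.

Lemma wp_runs c s P : wp c s P -> runs c s (steps c) P.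
Proof.
elim: c s P => [|r e|a e1 e2|c1 IH1 c2 IH2|e c1 IH1 c2 IH2|//] s P /=.
- by exists 1%N, s; split=> //; constructor.
- by exists 1%N, (set_reg s r (eval s e)); split=> //; constructor.
- by exists 1%N, (set_arr s a (eval s e1) (eval s e2)); split=> //; constructor.
- move=> /IH1[t1 [s1 [x1 le1 /IH2[t2 [s2 [x2 le2 Ps]]]]]].
  by exists (t1 + t2)%N, s2; split=> //; [apply: ExecSeq x1 x2|rewrite leq_add].
- case: ifP => [e0 /IH1|/negbT e0 /IH2] [t [s' [x le Ps]]]; exists t.+1, s'; split=> //.
  + exact: ExecIfTrue.
  + by rewrite ltnS leq_max le.
  + by apply: ExecIfFalse; rewrite // leNgt.
  + by rewrite ltnS leq_max le orbT.
Qed.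

Lemma runs_seq c1 c2 s B1 B2 B P : runs c1 s B1 (fun s1 => runs c2 s1 B2 P) ->
  (B1 + B2 <= B)%N -> runs (Seq c1 c2) s B P.
Proof.
move=> [t1 [s1 [x1 l1 [t2 [s2 [x2 l2 Ps]]]]]] le; exists (t1 + t2)%N, s2.
by split=> //; [apply: ExecSeq x1 x2|rewrite (leq_trans _ le) // leq_add].
Qed.

Lemma runs_weaken c s B B' (P P' : state -> Prop) : runs c s B P -> (B <= B')%N ->
  (forall s', P s' -> P' s') -> runs c s B' P'.
Proof. by move=> [t [s' [x l Ps]]] le PP; exists t, s'; split=> //; [lia|apply: PP]. Qed.

Fixpoint stored (c : cmd) : seq nat :=
  match c with
  | Store a _ _ => [:: a]
  | Seq c1 c2 | If _ c1 c2 => stored c1 ++ stored c2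
  | While _ c => stored c
  | _ => [::]
  end.

Fixpoint assigned (c : cmd) : seq nat :=
  match c with
  | Assign r _ => [:: r]
  | Seq c1 c2 | If _ c1 c2 => assigned c1 ++ assigned c2
  | While _ c => assigned c
  | _ => [::]
  end.

Definition frame (c : cmd) (s s' : state) :=
  (forall a, a \notin stored c -> arrs s' a =1 arrs s a) /\
  (forall r, r \notin assigned c -> regs s' r = regs s r).

Lemma exec_frame c s t s' : exec c s t s' -> frame c s s'.
Proof.
have cat_frame c1 c2 x y z : frame c1 x y -> frame c2 y z -> frame (Seq c1 c2) x z.
  move=> [a1 r1] [a2 r2]; split=> [a|r]; rewrite mem_cat negb_or => /andP[n1 n2].
    by move=> j; rewrite a2 ?a1.
  by rewrite r2 ?r1.
elim=> {c s t s'} [s|r e s|a e1 e2 s|c1 c2 s s1 s2 t1 t2 _ f1 _ f2|e c1 c2 s s1 t _ _ [fa fr]|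
  e c1 c2 s s1 t _ _ [fa fr]|e c s s1 s2 t1 t2 _ _ [a1 r1] _ [a2 r2]|e c s _] //.
- by split=> // r' /=; rewrite inE => /negPf->.
- by split=> // a' /=; rewrite inE => /negPf-> j.
- exact: cat_frame f1 f2.
- by split=> [a|r]; rewrite mem_cat negb_or => /andP[n1 _]; [apply: fa|apply: fr].
- by split=> [a|r]; rewrite mem_cat negb_or => /andP[_ n1]; [apply: fa|apply: fr].
- by split=> [a n1 j|r n1]; rewrite /= in n1; [rewrite a2 ?a1|rewrite r2 ?r1].
Qed.

Lemma runs_frame c s B P : runs c s B P -> runs c s B (fun s' => P s' /\ frame c s s').
Proof. by move=> [t [s' [x l Ps]]]; exists t, s'; split=> //; split=> //; apply: exec_frame x. Qed.

Definition For (r : nat) (e : expr) (c : cmd) :=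
  While (Minus e (Reg r)) (Seq c (Assign r (Plus (Reg r) (Lit 1)))).

(** An iteration costs [B j], which includes the increment of the counter, and one test; the failing
    test gives the outer successor. The [frame] premises spare the invariant from repeating what the
    body cannot write. *)
Lemma runs_for (r : nat) (e : expr) (c : cmd) (n l : nat) (B : nat -> nat)
    (Inv : nat -> state -> Prop) (s : state) :
  let body := Seq c (Assign r (Plus (Reg r) (Lit 1))) in
  (l <= n)%N -> regs s r = l -> Inv l s ->
  (forall j s', Inv j s' -> frame body s s' -> eval s' e = n) ->
  (forall j s', (l <= j < n)%N -> regs s' r = j -> Inv j s' -> frame body s s' ->
     runs body s' (B j) (fun s'' => regs s'' r = j.+1 /\ Inv j.+1 s'')) ->
  runs (For r e c) s (\sum_(l <= j < n) (B j).+1).+1 (fun s' => Inv n s').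
Proof.
move=> body ln rl I0 he step.
suff gen d j s0 : (n - j)%N = d -> (l <= j <= n)%N -> regs s0 r = j -> Inv j s0 ->
    frame body s s0 -> runs (For r e c) s0 (\sum_(j <= i < n) (B i).+1).+1 (fun s' => Inv n s').
  by apply: gen erefl _ rl I0 _; rewrite // leqnn.
elim: d j s0 => [|d IH] j s0 ed lj rj Ij fr0.
  have jn' : j = n by lia.
  subst j; exists 1%N, s0; split=> //; apply: ExecWhileFalse.
  by rewrite /= (he _ _ Ij fr0) rj subrr.
have [|t [s1 [x1 l1 [[r1 I1] fr1]]]] := runs_frame (step j s0 _ rj Ij fr0); first by lia.
have fr01 : frame body s s1.
  case: fr0 fr1 => a0 r0 [a1 r1']; split=> [a na z|a na]; first by rewrite a1 ?a0.
  by rewrite r1' ?r0.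
have [||t2 [s2 [x2 l2 I2]]] := IH j.+1 s1 _ _ r1 I1 fr01; try lia.
exists (t + t2).+1, s2; split=> //.
  by apply: ExecWhileTrue x1 x2; rewrite /= (he _ _ Ij fr0) rj subr_gt0 ltz_nat; lia.
by rewrite big_ltn; lia.
Qed.

End Programs.

(** * The layout program *)

Section LayoutProgram.
Local Open Scope ring_scope.

(* Register 3 is the loop counter. Array 4 marks the spine, 5 holds [bk], 6 [lc],
   7 the multiples of m, 8 [nhub], 9 [nbare], 10 [nhubl], 11 the rank of a core
   vertex in its block, 12 [first], 13 [load], 14 and 15 the split points [a]
   and [h]. *)
Fixpoint block_cmd (cs : seq cmd) : cmd :=
  match cs with [::] => Skip | [:: c] => c | c :: cs' => Seq c (block_cmd cs') end.

(* Positive exactly for the vertices of degree at least 2; isolated vertices do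
   not occur. *)
Definition spare_degree (u : expr) : expr :=
  Minus (Minus (Read 0 (Plus u (Lit 1))) (Read 0 u)) (Lit 1).

Definition vertex_step (core_cmd leaf_cmd : cmd) : cmd :=
  If (Read 4 (Reg 3)) Skip (If (spare_degree (Reg 3)) core_cmd leaf_cmd).

Definition each_vertex (core_cmd leaf_cmd : cmd) : cmd :=
  Seq (Assign 3 (Lit 0)) (For 3 (Reg 0) (vertex_step core_cmd leaf_cmd)).

(** Register 5 accumulates the multiples of [m], since the machine only adds and subtracts. *)
Definition mark_spine : cmd :=
  Seq (Assign 3 (Lit 0)) (For 3 (Plus (Reg 1) (Lit 3)) (block_cmd
    [:: Assign 4 (Read 2 (Reg 3)); Store 4 (Reg 4) (Lit 1); Store 3 (Reg 4) (Reg 5);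
        Store 7 (Reg 3) (Reg 5); Assign 5 (Plus (Reg 5) (Reg 2))])).

(** The neighbors of $v_j$ receive $j-1$, for increasing $j$. A vertex of $Q_i$ off the spine has
    only $v_i$ and $v_{i+1}$ as spine neighbors, so its final value is $i$. The cost is the degree
    sum of the spine. The entries of $v_1,\dots,v_{k+1}$ are set again by [compute_loads]. *)
Definition find_blocks : cmd :=
  Seq (Assign 3 (Lit 1)) (For 3 (Plus (Reg 1) (Lit 2)) (block_cmd
    [:: Assign 4 (Read 2 (Reg 3)); Assign 6 (Read 0 (Reg 4));
        Assign 7 (Read 0 (Plus (Reg 4) (Lit 1)));
        For 6 (Reg 7) (Store 5 (Read 1 (Reg 6)) (Minus (Reg 3) (Lit 1)))])).

Definition parent_of (u : expr) : expr := Read 1 (Read 0 u).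

Definition count_leaf : cmd :=
  Seq (Assign 4 (parent_of (Reg 3))) (Store 6 (Reg 4) (Plus (Read 6 (Reg 4)) (Lit 1))).

Definition rank_core : cmd :=
  Seq (Assign 4 (Read 5 (Reg 3)))
    (If (Read 6 (Reg 3))
       (block_cmd
          [:: Store 8 (Reg 4) (Plus (Read 8 (Reg 4)) (Lit 1)); Store 11 (Reg 3) (Read 8 (Reg 4));
              Store 12 (Reg 3) (Read 10 (Reg 4));
              Store 10 (Reg 4) (Plus (Read 10 (Reg 4)) (Read 6 (Reg 3)))])
       (block_cmd
          [:: Store 9 (Reg 4) (Plus (Read 9 (Reg 4)) (Lit 1)); Store 11 (Reg 3) (Read 9 (Reg 4))])).

(** The cell of $v_{i+1}$ in array 12 gets $\max(\Lambda_i,-x_i)$, the value of [first]; adding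
    $x_i$ to it gives $\max(x_i+\Lambda_i,0)$, so the recurrence takes no second maximum. Arrays 14
    and 15 get the values for a block without critical hub, which [split_core] overrides. *)
Definition compute_loads : cmd :=
  Seq (Assign 3 (Lit 0)) (For 3 (Plus (Reg 1) (Lit 1)) (block_cmd
    [:: Assign 4 (Read 2 (Plus (Reg 3) (Lit 1))); Store 5 (Reg 4) (Reg 3);
        If (Minus (Minus (Lit 0) (Read 13 (Reg 3))) (Read 10 (Reg 3)))
          (Store 12 (Reg 4) (Minus (Lit 0) (Read 13 (Reg 3))))
          (Store 12 (Reg 4) (Read 10 (Reg 3)));
        Store 14 (Reg 3) (Read 8 (Reg 3));
        If (Read 13 (Reg 3)) (Store 15 (Reg 3) (Read 13 (Reg 3))) (Store 15 (Reg 3) (Lit 0));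
        Store 13 (Plus (Reg 3) (Lit 1))
          (Minus (Plus (Plus (Plus (Read 13 (Reg 3)) (Read 12 (Reg 4)))
             (Plus (Read 8 (Reg 3)) (Read 9 (Reg 3)))) (Read 6 (Reg 4)))
             (Minus (Reg 2) (Lit 1)))])).

Definition room_expr (i : expr) : expr :=
  Minus (Minus (Minus (Reg 2) (Lit 1)) (Plus (Read 8 i) (Read 9 i))) (Read 13 i).

(** A test asks for a positive value, so [Lit 1] is added to test a weak inequality. *)
Definition split_core : cmd :=
  If (Read 6 (Reg 3))
    (block_cmd
      [:: Assign 4 (Read 5 (Reg 3)); Assign 5 (room_expr (Reg 4));
          If (Plus (Minus (Reg 5) (Read 12 (Reg 3))) (Lit 1))
           (If (Minus (Plus (Read 12 (Reg 3)) (Read 6 (Reg 3))) (Reg 5))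
             (block_cmd
               [:: Store 14 (Reg 4) (Read 11 (Reg 3));
                   Assign 6 (Minus (Minus (Plus (Read 12 (Reg 3)) (Read 6 (Reg 3))) (Reg 5)) (Read 11 (Reg 3)));
                   If (Read 13 (Reg 4)) (Assign 7 (Read 13 (Reg 4))) (Assign 7 (Lit 0));
                   If (Minus (Reg 6) (Reg 7)) (Store 15 (Reg 4) (Reg 6)) (Store 15 (Reg 4) (Reg 7))])
             Skip) Skip]) Skip.

Definition fill_cmd : cmd :=
  Seq (Assign 9 (Plus (Minus (Read 14 (Reg 4)) (Lit 1)) (Reg 8)))
    (If (Minus (Reg 8) (Read 15 (Reg 4))) (Assign 9 (Plus (Reg 9) (Lit 1))) Skip).

Definition place_core : cmd :=
  block_cmd
      [:: Assign 4 (Read 5 (Reg 3));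
          If (Read 13 (Reg 4)) (Assign 6 (Read 13 (Reg 4))) (Assign 6 (Lit 0));
          If (Read 6 (Reg 3))
            (If (Minus (Read 14 (Reg 4)) (Read 11 (Reg 3))) (Assign 9 (Plus (Reg 6) (Read 11 (Reg 3))))
              (If (Plus (Minus (Read 14 (Reg 4)) (Read 11 (Reg 3))) (Lit 1))
                 (Assign 9 (Plus (Read 11 (Reg 3)) (Read 15 (Reg 4))))
                 (Assign 9 (Plus (Minus (Minus (Reg 2) (Lit 1)) (Read 8 (Reg 4))) (Read 11 (Reg 3))))))
            (Seq (Assign 8 (Plus (Reg 6) (Read 11 (Reg 3)))) fill_cmd);
          Store 3 (Reg 3) (Plus (Read 7 (Reg 4)) (Reg 9))].

(** Array 12 doubles as a counter: after some leaves of a vertex are placed, its cell holds the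
    number of the last of them. *)
Definition place_leaf : cmd :=
  block_cmd
      [:: Assign 7 (parent_of (Reg 3)); Assign 4 (Read 5 (Reg 7));
          Store 12 (Reg 7) (Plus (Read 12 (Reg 7)) (Lit 1)); Assign 10 (Read 12 (Reg 7));
          Assign 5 (room_expr (Reg 4));
          If (Plus (Minus (Minus (Lit 0) (Read 13 (Reg 4))) (Reg 10)) (Lit 1))
            (Assign 9 (Minus (Plus (Read 13 (Reg 4)) (Reg 10)) (Lit 1)))
            (If (Plus (Minus (Reg 5) (Reg 10)) (Lit 1))
              (Seq (Assign 8 (Plus (Plus (Read 9 (Reg 4)) (Reg 10)) (Read 13 (Reg 4)))) fill_cmd)
              (Assign 9 (Minus (Plus (Reg 2) (Reg 10)) (Reg 5))));
          Store 3 (Reg 3) (Plus (Read 7 (Reg 4)) (Reg 9))].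

Definition layout_cmd : cmd := block_cmd
  [:: mark_spine; find_blocks; each_vertex Skip count_leaf; each_vertex rank_core Skip;
      compute_loads; each_vertex split_core Skip; each_vertex place_core place_leaf].

(** * Correctness and running time of the layout program *)

Section Correctness.
Variables (G : sgraph) (k : nat) (v : nat -> G) (Q : nat -> {set G}) (m : nat).
Variables (vs : seq G) (nb : G -> seq G).
Hypothesis ch : chain k v Q.
Hypothesis en : ends k v Q true true.
Hypothesis vs_enum : perm_eq vs (enum G).
Hypothesis nbP : forall x, perm_eq (nb x) (enum [set y | adj x y]).
Hypothesis k1 : (0 < k)%N.
Hypothesis all_hang : forall x : G, (x \in core G) || hangs x.
Implicit Types (x y z u w : G) (s : state).

Local Notation sp := (sp k v true true).
Local Notation idx := (idx k v true true).
Local Notation it := (it k v true true).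
Local Notation lf := (lf k v true true).
Local Notation bk := (bk k v Q true true).
Local Notation par := (@par G).
Local Notation s_in := (input vs nb k v m).
Local Notation lcG := (lc vs lf par).
Local Notation nhubG := (nhub vs it lf bk par).
Local Notation nbareG := (nbare vs it lf bk par).
Local Notation nhublG := (nhubl vs it lf bk par).
Local Notation loadG := (load vs m sp it lf bk par).
Local Notation hub_rankG := (hub_rank vs it lf bk par).
Local Notation bare_rankG := (bare_rank vs it lf bk par).
Local Notation firstG := (first vs m sp it lf bk par).

Definition nm x : int := Posz (index x vs).

Let vs_uniq : uniq vs. Proof. by rewrite (perm_uniq vs_enum) enum_uniq. Qed.
Let vs_all x : x \in vs. Proof. by rewrite (perm_mem vs_enum) mem_enum. Qed.

Lemma nm_inj : injective nm.
Proof.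
move=> x y [e]; by rewrite -(nth_index x (vs_all x)) e nth_index.
Qed.

Lemma nm_eq x y : (nm x == nm y) = (x == y).
Proof. exact: (inj_eq nm_inj). Qed.

Lemma size_nb x : size (nb x) = #|[set y | adj x y]|.
Proof. by rewrite (perm_size (nbP x)) -cardE. Qed.

Lemma mem_nb x y : (y \in nb x) = adj x y.
Proof. by rewrite (perm_mem (nbP x)) mem_enum inE. Qed.

Lemma nb_leaf u : u \in leaves G -> nb u = [:: par u].
Proof.
move=> uL; have := size_nb u; have := uL; rewrite inE => /eqP->.
have := mem_nb u (par u); rewrite parP // eqxx.
by case: (nb u) => [|a [|b l]] //; rewrite mem_seq1 => /eqP->.
Qed.

Definition base s := [/\ regs s 0%N = #|G|, regs s 1%N = k, regs s 2%N = m &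
  forall a, (a <= 2)%N -> arrs s a =1 arrs s_in a].

Lemma base_in : base s_in. Proof. by []. Qed.

Lemma base_frame c s s' : base s -> frame c s s' ->
  all (fun r => 2 < r)%N (assigned c) -> all (fun a => 2 < a)%N (stored c) -> base s'.
Proof.
move=> [b0 b1 b2 b3] [fa fr] hr ha.
have nr r : (r <= 2)%N -> r \notin assigned c.
  by move=> r2; apply/negP => /(allP hr); rewrite ltnNge r2.
have na a : (a <= 2)%N -> a \notin stored c.
  by move=> r2; apply/negP => /(allP ha); rewrite ltnNge r2.
by split; rewrite ?fr ?nr // => a a2 j; rewrite fa ?na // b3.
Qed.

Section Offsets.
Variables (pre post : seq G) (x : G).
Hypothesis evs : vs = pre ++ x :: post.

Definition offset := size (flatten (map nb pre)).

Lemma nm_split : nm x = size pre.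
Proof.
have := vs_uniq; rewrite evs cat_uniq => /and3P[_ /norP[xp _] _].
by rewrite /nm evs index_cat (negPf xp) /= eqxx addn0.
Qed.

Lemma sum_sizes (l : seq G) : foldl addn 0%N [seq size (nb y) | y <- l] = size (flatten (map nb l)).
Proof.
rewrite -[RHS]add0n; elim: l 0%N => [|y l IH] n /=; first by rewrite addn0.
by rewrite IH size_cat addnA.
Qed.

Lemma offset_nth i : (i <= size vs)%N ->
  nth 0%N (0%N :: scanl addn 0%N [seq size (nb y) | y <- vs]) i =
    size (flatten (map nb (take i vs))).
Proof.
case: i => [|i] hi; first by rewrite take0.
by rewrite /= nth_scanl ?size_map // -map_take sum_sizes.
Qed.

Lemma read_offset s : base s -> arrs s 0%N (nm x) = offset.
Proof.
move=> [_ _ _ b3]; rewrite b3 // nm_split /= offset_nth; last by rewrite evs size_cat leq_addr.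
by rewrite evs take_size_cat.
Qed.

Lemma read_next_offset s : base s -> arrs s 0%N (nm x + 1) = (offset + size (nb x))%N.
Proof.
move=> [_ _ _ b3]; rewrite b3 // nm_split -PoszD /= addn1 offset_nth; last first.
  by rewrite evs size_cat /= addnS ltnS leq_addr.
by rewrite evs -cat_rcons take_size_cat ?size_rcons // map_rcons flatten_rcons size_cat.
Qed.

Lemma read_nbr s t x0 : base s -> (t < size (nb x))%N ->
  arrs s 1%N (Posz (offset + t)) = nm (nth x0 (nb x) t).
Proof.
move=> [_ _ _ b3] ht; rewrite b3 // /nm; congr Posz.
have e : flatten (map nb vs) = flatten (map nb pre) ++ nb x ++ flatten (map nb post).
  by rewrite evs map_cat flatten_cat.
have lt : (offset + t < size (flatten (map nb vs)))%N.
  by rewrite e !size_cat ltn_add2l ltn_addr.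
rewrite (nth_map x0) // e nth_cat ltnNge leq_addr /= addKn nth_cat ht //.
Qed.

End Offsets.

Lemma split_vs x : exists pre post, vs = pre ++ x :: post.
Proof.
by case/splitPr: (vs_all x) => p1 p2; exists p1, p2.
Qed.

Lemma size_it x : it x -> (1 < size (nb x))%N.
Proof.
move=> ix; have [hb xq] := it_bk ch ix; have [hl hr] : (lo true <= bk x <= hi k true)%N /\
  (lo true <= (bk x).+1 <= hi k true)%N by split; apply: range_lohi; lia.
have a1 := ch_clique ch hb xq (ch_left ch hb) (it_neq_v ix hl).
have xc : x \in core G by case/andP: ix.
rewrite leaf_core inE -size_nb in xc.
by move: a1 xc; rewrite -mem_nb; case: (nb x) => [|a [|b l]].
Qed.

Lemma size_leaf x : x \in leaves G -> size (nb x) = 1%N.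
Proof. by move/nb_leaf=> ->. Qed.

Lemma lf_leaf u : lf u -> u \in leaves G.
Proof. by case/andP=> /andP[]. Qed.

Lemma kind_cases x : [\/ sp x, it x | lf x].
Proof.
case/orP: (all_hang x) => [/(core_placed k v true true)|/(hang_placed k v true true)] /orP[|];
  by [constructor 1|constructor 2|constructor 3].
Qed.

Lemma eval_spare s x : base s -> regs s 3%N = nm x ->
  eval s (spare_degree (Reg 3)) = Posz (size (nb x)) - 1.
Proof.
move=> bs r3; have [pre [post e]] := split_vs x.
by rewrite /spare_degree /= r3 (read_offset e bs) (read_next_offset e bs) PoszD; lia.
Qed.

Lemma eval_parent s u : base s -> regs s 3%N = nm u -> u \in leaves G ->
  eval s (parent_of (Reg 3)) = nm (par u).
Proof.
move=> bs r3 uL; have [pre [post e]] := split_vs u.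
rewrite /parent_of /= r3 (read_offset e bs) -[offset pre]addn0 (read_nbr e u bs) nb_leaf //.
Qed.

Lemma size_vs : size vs = #|G|.
Proof. by rewrite (perm_size vs_enum) -cardE. Qed.

Lemma runs_wp c s B P : wp c s P -> (steps c <= B)%N -> runs c s B P.
Proof. by move=> w le; apply: runs_weaken (wp_runs w) le _. Qed.

(** [Inv] speaks of the vertices already visited, so prefix sums along [vs] become invariants. The
    step may write neither the counter in register 3 nor the marks in array 4; [.+2] per vertex pays
    for the increment and the test. *)
Lemma vertex_loop core_cmd leaf_cmd s (Inv : seq G -> (nat -> int -> int) -> Prop) :
  let step := vertex_step core_cmd leaf_cmd in
  base s -> (forall x, arrs s 4%N (nm x) = sp x) ->
  all (fun r => 3 < r)%N (assigned step) -> all (fun a => (2 < a) && (a != 4))%N (stored step) ->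
  Inv [::] (arrs s) ->
  (forall pre x post s', vs = pre ++ x :: post -> regs s' 3%N = nm x -> base s' ->
     (forall a, a \notin stored step -> arrs s' a =1 arrs s a) -> Inv pre (arrs s') ->
     [/\ sp x -> Inv (rcons pre x) (arrs s'),
         it x -> wp core_cmd s' (fun s'' => Inv (rcons pre x) (arrs s'')) &
         lf x -> wp leaf_cmd s' (fun s'' => Inv (rcons pre x) (arrs s''))]) ->
  runs (each_vertex core_cmd leaf_cmd) s (((steps step).+2 * #|G|).+2) (fun s' => Inv vs (arrs s')).
Proof.
move=> step bs m4 ra sa I0 H.
have ra2 : all (fun r => 2 < r)%N (assigned step ++ [:: 3%N]).
  by rewrite all_cat /= andbT; apply: sub_all ra => r; apply: ltn_trans.
have sa2 : all (fun a => 2 < a)%N (stored step ++ [::]).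
  by rewrite cats0; apply: sub_all sa => a /andP[].
have n3 : 3%N \notin assigned step by apply/negP => /(allP ra).
have n4 : 4%N \notin stored step by apply/negP => /(allP sa).
apply: (@runs_seq _ _ _ 1 ((steps step).+2 * #|G|).+1); last by rewrite add1n.
apply: (runs_weaken (wp_runs (c := Assign 3 (Lit 0)) (P := eq^~ _) (erefl _)) (leqnn _)) => s0 ->.
set s1 := set_reg _ _ _.
have bs1 : base s1 by case: bs => b0 b1 b2 b3; split.
have loop := @runs_for 3 (Reg 0) step (size vs) 0 (fun=> (steps step).+1)
  (fun j s' => Inv (take j vs) (arrs s')) s1 (leq0n _) erefl.
rewrite take0 in loop; have := loop I0 _ _; move=> {}loop.
apply: runs_weaken (loop _ _) _ _ => [j s' _ fr|j s' /andP[_ jn] r3 Ij fr| |s'].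
- by have [b0 _ _ _] := base_frame bs1 fr ra2 sa2; rewrite /= b0 size_vs.
- have b' := base_frame bs1 fr ra2 sa2.
  have evs : vs = take j vs ++ nth (v 0%N) vs j :: drop j.+1 vs.
    by rewrite -drop_nth // cat_take_drop.
  set x := nth _ _ _ in evs.
  have nmx : nm x = j by rewrite (nm_split evs) size_takel // ltnW.
  have frs a : a \notin stored step -> arrs s' a =1 arrs s a.
    by move=> na i; rewrite fr.1 // mem_cat orbF.
  have [Hs Hi Hl] := H _ _ _ s' evs (etrans r3 (esym nmx)) b' frs Ij.
  have W : wp step s' (fun s'' => Inv (rcons (take j vs) x) (arrs s'')).
    have e4 : eval s' (Read 4 (Reg 3)) = sp x by rewrite /= r3 -nmx frs // m4.
    have e5 := eval_spare b' (etrans r3 (esym nmx)).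
    have -> : wp step s' = fun P => if 0 < eval s' (Read 4 (Reg 3)) then P s'
      else if 0 < eval s' (spare_degree (Reg 3)) then wp core_cmd s' P else wp leaf_cmd s' P by [].
    rewrite e4 e5.
    case: (kind_cases x) => kx; first by rewrite kx; apply: Hs.
      by rewrite (negPf (contraL (@sp_it _ _ _ _ _ x) kx)) /= subr_gt0 ltz_nat size_it //;
        apply: Hi.
    rewrite (negPf (contraL (@sp_lf _ _ _ _ _ x) kx)) /= size_leaf; last exact: lf_leaf.
    by rewrite subrr ltxx; apply: Hl.
  have [t [s2 [x2 l2 [I2 f2]]]] := runs_frame (wp_runs W).
  exists (t + 1)%N, (set_reg s2 3 (j.+1)); split=> //.
  + apply: ExecSeq x2 _; have -> : Posz j.+1 = eval s2 (Plus (Reg 3) (Lit 1)).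
      by rewrite /= f2.2 // r3 -PoszD addn1.
    by constructor.
  + by rewrite addn1 ltnS.
  + by split=> //; rewrite (take_nth (v 0%N)).
- by rewrite sum_nat_const_nat subn0 size_vs mulnC.
- by rewrite take_size.
Qed.

Lemma read_spine s i : base s -> (i <= k.+2)%N -> arrs s 2%N i = nm (v i).
Proof.
move=> [_ _ _ b3] hi'; rewrite b3 //.
have -> : arrs s_in 2%N = array_of [seq index (v i) vs | i <- iota 0 k.+3] by [].
by rewrite /array_of /nm (nth_map 0%N) ?size_iota // nth_iota.
Qed.

Lemma runs_assign_seq r e c s B P : runs c (set_reg s r (eval s e)) B P ->
  runs (Seq (Assign r e) c) s B.+1 P.
Proof.
move=> [t [s' [x l Ps]]]; exists t.+1, s'; split=> //.
by rewrite -add1n; apply: ExecSeq x; constructor.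
Qed.

Lemma base_set_reg s r (c : int) : base s -> (2 < r)%N -> base (set_reg s r c).
Proof.
move=> [b0 b1 b2 b3] r2; split=> //=; case: eqP => // e; by rewrite -e in r2.
Qed.

Definition marked j x := x \in take j (spine k v true true).
Arguments marked : simpl never.

Lemma markedS j x : (j <= k.+2)%N -> marked j.+1 x = (x == v j) || marked j x.
Proof.
move=> jk; rewrite /marked (take_nth (v 0%N)) ?size_map ?size_iota //.
by rewrite mem_rcons inE (nth_map 0%N) ?size_iota // nth_iota.
Qed.

Lemma mark_spine_runs s : base s -> regs s 5%N = 0 -> (forall j, arrs s 4%N j = 0) ->
  runs mark_spine s (7 * k.+3).+2 (fun s' =>
    [/\ forall x, arrs s' 4%N (nm x) = sp x,
        forall i, (i <= k.+2)%N -> arrs s' 3%N (nm (v i)) = Posz i * m &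
        forall i, (i <= k.+2)%N -> arrs s' 7%N i = Posz i * m]).
Proof.
move=> bs r5 z4; apply: runs_assign_seq; set s1 := set_reg _ _ _.
have bs1 : base s1 by apply: base_set_reg.
pose Inv (j : nat) s' := [/\ regs s' 5%N = Posz j * m,
  forall x, arrs s' 4%N (nm x) = marked j x,
  forall i, (i < j)%N -> arrs s' 3%N (nm (v i)) = Posz i * m &
  forall i, (i < j)%N -> arrs s' 7%N i = Posz i * m].
apply: runs_weaken (@runs_for 3 _ _ k.+3 0 (fun=> 6%N) Inv s1 _ _ _ _ _) _ _ => //.
- by split=> //= [|x]; rewrite ?z4 // r5 mul0r.
- by move=> j s' _ fr; have [_ b1 _ _] := base_frame bs1 fr isT isT; rewrite /= b1 -PoszD addn3.
- move=> j s' /andP[_ jk] r3 [i5 i4 i3 i7] fr; have b' := base_frame bs1 fr isT isT.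
  have rv := read_spine b' (jk : (j <= k.+2)%N).
  apply: runs_wp => //=; rewrite r3 rv i5; split; first by rewrite -PoszD addn1.
  have inj i : (i < j)%N -> nm (v i) == nm (v j) = false.
    move=> ij; rewrite nm_eq; apply/negbTE; apply: (v_neq ch en) => //.
  split.
  + by rewrite /=; case: b' => _ _ -> _; rewrite intS mulrDl mul1r addrC.
  + by move=> x; rewrite markedS //= nm_eq i4; case: (x == v j).
  + move=> i; rewrite ltnS leq_eqVlt /= => /predU1P[->|ij]; first by rewrite eqxx.
    by rewrite inj // i3.
  + move=> i; rewrite ltnS leq_eqVlt /= => /predU1P[->|ij]; first by rewrite eqxx.
    by rewrite ifF ?i7 //; apply/negbTE; rewrite eqz_nat neq_ltn ij.
- by rewrite sum_nat_const_nat subn0 mulnC.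
- move=> s' [_ i4 i3 i7]; split=> // x.
  by rewrite i4 /marked take_oversize // size_map size_iota.
Qed.

(** This makes the overwriting in [find_blocks] safe: after $v_{i+1}$ no spine vertex touches the
    entry of a vertex of block $i$. *)
Lemma it_spine_nbr w i : it w -> (1 <= i <= k.+1)%N -> adj (v i) w ->
  i = bk w \/ i = (bk w).+1.
Proof.
move=> iw hi' vw; have vc := v_core ch hi'; have wc : w \in core G by case/andP: iw.
have [t [ht vt wt]] := ch_edge ch vc wc vw.
rewrite (it_bk_uniq ch iw ht wt); case: (eqVneq (v i) (v t)) => [e|n1].
  by left; apply: (v_inj ch en) e; apply: range_lohi; lia.
case: (eqVneq (v i) (v t.+1)) => [e|n2].
  by right; apply: (v_inj ch en) e; apply: range_lohi; lia.
have [iv _] := it_Q ch en ht vt n1 n2.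
have hl : (lo true <= i <= hi k true)%N by apply: range_lohi.
by have := sp_it (sp_v v hl); rewrite iv.
Qed.

Lemma it_right_nbr w : it w -> adj (v (bk w).+1) w.
Proof.
move=> iw; have [hb wq] := it_bk ch iw.
have hl : (lo true <= (bk w).+1 <= hi k true)%N by apply: range_lohi; lia.
by rewrite adj_sym; apply: (ch_clique ch hb wq (ch_right ch hb) (it_neq_v iw hl)).
Qed.

Definition scan_nbrs : cmd := For 6 (Reg 7) (Store 5 (Read 1 (Reg 6)) (Minus (Reg 3) (Lit 1))).

Lemma scan_nbrs_runs s pre post x : vs = pre ++ x :: post -> base s ->
  regs s 6%N = offset pre -> regs s 7%N = (offset pre + size (nb x))%N ->
  runs scan_nbrs s (3 * size (nb x)).+1 (fun s' => forall y,
    arrs s' 5%N (nm y) = if y \in nb x then regs s 3%N - 1 else arrs s 5%N (nm y)).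
Proof.
move=> e bs r6 r7; set o := offset pre in r6 r7.
pose Inv (t : nat) s' := forall y,
  arrs s' 5%N (nm y) = if y \in take (t - o) (nb x) then regs s 3%N - 1 else arrs s 5%N (nm y).
apply: runs_weaken (@runs_for 6 _ _ (o + size (nb x)) o (fun=> 2%N) Inv s _ _ _ _ _) _ _ => //.
- exact: leq_addr.
- by move=> y; rewrite subnn take0.
- by move=> j s' _ [_ fr]; rewrite /= fr.
- move=> j s' /andP[oj jn] r6' Ij fr; have b' := base_frame bs fr isT isT.
  apply: runs_wp => //=; rewrite r6'; split; first by rewrite -PoszD addn1.
  have jt : (j - o < size (nb x))%N by rewrite ltn_subLR.
  move=> y; rewrite /= -{1}(subnKC oj) (read_nbr e x b' jt) nm_eq fr.2 //.
  rewrite subSn // (take_nth x) // mem_rcons inE Ij.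
  by case: (y == nth x (nb x) (j - o)).
- by rewrite sum_nat_const_nat addKn mulnC.
- by move=> s' I y; rewrite I addKn take_size.
Qed.

Lemma find_blocks_runs s : base s ->
  runs find_blocks s (\sum_(1 <= j < k.+2) (3 * size (nb (v j)) + 6)).+2
    (fun s' => forall w, it w -> arrs s' 5%N (nm w) = bk w).
Proof.
move=> bs; apply: runs_assign_seq; set s1 := set_reg _ _ _.
have bs1 : base s1 by apply: base_set_reg.
pose Inv (j : nat) s' := forall w, it w -> ((bk w).+1 < j)%N -> arrs s' 5%N (nm w) = bk w.
apply: runs_weaken (@runs_for 3 _ _ k.+2 1 (fun j => 3 * size (nb (v j)) + 5)%N Inv s1 _ _ _ _ _) _ _ => //.
- by move=> j s' _ fr; have [_ b1 _ _] := base_frame bs1 fr isT isT; rewrite /= b1 -PoszD addn2.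
- move=> j s' /andP[j1 jk] r3 Ij fr; have b' := base_frame bs1 fr isT isT.
  have [pre [post e]] := split_vs (v j).
  have jk2 : (j <= k.+2)%N by apply: ltnW.
  apply: (@runs_seq _ _ _ (3 * size (nb (v j)) + 4) 1); last by lia.
  rewrite addnC; do 3!apply: runs_assign_seq; rewrite /= r3 !(read_spine b') //.
  rewrite (read_offset e b') (read_next_offset e b').
  set s2 := set_reg _ _ _.
  have bs2 : base s2 by do 3!apply: base_set_reg => //.
  apply: runs_weaken (runs_frame (scan_nbrs_runs e bs2 erefl erefl)) _ _ => [|s3 [H3 [f3a f3r]]];
    first lia.
  apply: runs_wp => //=; rewrite f3r //= r3 -PoszD addn1; split=> // w iw hw /=.
  rewrite H3 /= r3 mem_nb; case: ifP => [a|na].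
    by have [|ej|ej] := it_spine_nbr iw _ a; lia.
  case: (ltngtP (bk w).+1 j) hw => [lt _|lt|eq _]; [exact: Ij|lia|].
  by rewrite -eq it_right_nbr in na.
- by under eq_bigr do rewrite -addnS.
- by move=> s' I w iw; apply: I => //; have [] := it_bk ch iw; lia.
Qed.

Lemma pre_sum_prefix g pre x post : vs = pre ++ x :: post ->
  pre_sum vs g x = \sum_(y <- pre) g y.
Proof.
move=> e; have [e'] := nm_split e.
by rewrite /pre_sum e' e take_size_cat.
Qed.

Lemma big_rcons_nat (g : G -> nat) pre x :
  (\sum_(y <- rcons pre x) g y = \sum_(y <- pre) g y + g x)%N.
Proof. by rewrite -cats1 big_cat big_seq1. Qed.

Lemma count_leaves_runs s : base s -> (forall x, arrs s 4%N (nm x) = sp x) ->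
  (forall j, arrs s 6%N j = 0) ->
  runs (each_vertex Skip count_leaf) s (((steps (vertex_step Skip count_leaf)).+2 * #|G|).+2)
    (fun s' => forall p, arrs s' 6%N (nm p) = lcG p).
Proof.
move=> bs m4 z6.
apply: (vertex_loop (Inv := fun pre A => forall p, A 6%N (nm p) =
  (\sum_(u <- pre) leafw lf par p u)%N)) => //.
  by move=> p; rewrite z6 big_nil.
move=> pre x post s' e r3 b' _ IH; split=> [sx p|ix p|lx].
- by rewrite big_rcons_nat IH /leafw (negPf (sp_lf sx)) addn0.
- by rewrite big_rcons_nat IH /leafw (negPf (it_lf ix)) addn0.
rewrite /count_leaf /= -[arrs s' 1%N _]/(eval s' (parent_of (Reg 3))).
rewrite (eval_parent b' r3 (lf_leaf lx)) => p /=.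
rewrite nm_eq big_rcons_nat /leafw lx /= !IH eq_sym.
by case: eqP => [->|_]; rewrite ?addn0 // -PoszD addn1.
Qed.

Definition ranked pre (A : nat -> int -> int) := [/\
  forall i : nat, A 8%N i = (\sum_(y <- pre) hubw vs it lf bk par i y)%N,
  forall i : nat, A 9%N i = (\sum_(y <- pre) barew vs it lf bk par i y)%N,
  forall i : nat, A 10%N i = (\sum_(y <- pre) hubl vs it lf bk par i y)%N,
  forall w, w \in pre -> it w -> (0 < lcG w)%N ->
    A 11%N (nm w) = hub_rankG w /\ A 12%N (nm w) = firstG w &
  forall w, w \in pre -> it w -> lcG w = 0%N -> A 11%N (nm w) = bare_rankG w].

Lemma not_it_weights x i : ~~ it x ->
  [/\ hubw vs it lf bk par i x = 0%N, barew vs it lf bk par i x =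
    0%N & hubl vs it lf bk par i x = 0%N].
Proof. by move=> /negPf ix; rewrite /hubw /barew /hubl ix. Qed.

Lemma rank_ints_runs s : base s -> (forall x, arrs s 4%N (nm x) = sp x) ->
  (forall w, it w -> arrs s 5%N (nm w) = bk w) -> (forall p, arrs s 6%N (nm p) = lcG p) ->
  (forall j, [/\ arrs s 8%N j = 0, arrs s 9%N j = 0 & arrs s 10%N j = 0]) ->
  runs (each_vertex rank_core Skip) s
    (((steps (vertex_step rank_core Skip)).+2 * #|G|).+2) (fun s' => ranked vs (arrs s')).
Proof.
move=> bs m4 b5 l6 z; apply: vertex_loop => //.
  by split=> // i; have [z8 z9 z10] := z i; rewrite ?z8 ?z9 ?z10 big_nil.
move=> pre x post s' e r3 b' fr [i8 i9 i10 ih ib].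
have keep : ~~ it x -> ranked (rcons pre x) (arrs s').
  move=> nix; split=> [i|i|i|w|w]; rewrite ?big_rcons_nat ?(not_it_weights i nix).1 //.
  - by have [-> _ _] := not_it_weights i nix; rewrite addn0 i8.
  - by have [_ -> _] := not_it_weights i nix; rewrite addn0 i9.
  - by have [_ _ ->] := not_it_weights i nix; rewrite addn0 i10.
  - by rewrite mem_rcons inE => /predU1P[->|]; [rewrite (negPf nix)|apply: ih].
  - by rewrite mem_rcons inE => /predU1P[->|]; [rewrite (negPf nix)|apply: ib].
have r5 : it x -> arrs s' 5%N (nm x) = bk x by move=> ix; rewrite fr // b5.
have r6 : arrs s' 6%N (nm x) = lcG x by rewrite fr // l6.
have npre w : w \in pre -> w == x = false.
  move=> wp; apply/negbTE; apply: contraTneq wp => ->.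
  by have := vs_uniq; rewrite e cat_uniq => /and3P[_ /norP[]].
split=> [sx|ix|lx]; first exact/keep/sp_it.
  rewrite /rank_core [wp _ _ _]/= r3 r5 // r6 /=.
  have hx : firstG x = Posz (\sum_(y <- pre) hubl vs it lf bk par (bk x) y)%N.
    by rewrite /first ix (pre_sum_prefix _ e).
  case: ifP => l0.
    have ll : (0 < lcG x)%N by [].
    have hr : hub_rankG x = (\sum_(y <- pre) hubw vs it lf bk par (bk x) y).+1.
      by rewrite /hub_rank (pre_sum_prefix _ e).
    split=> [i|i|i|w|w] /=; rewrite ?big_rcons_nat.
    - rewrite /hubw ix /= ll andbT eqz_nat eq_sym i8; case: eqP => [->|_]; rewrite ?addn0 // i8.
    - by rewrite i9 /barew ix /= -/(lcG x) eqn0Ngt ll andbF addn0.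
    - by rewrite eqz_nat i10 /hubl ix /= eq_sym; case: eqP => [->|_]; rewrite ?addn0 // i10 -PoszD.
    - rewrite mem_rcons inE => /predU1P[->|wp] iw lw.
        by rewrite eqxx i8 i10 hx hr -PoszD addn1 eqxx.
      by rewrite nm_eq npre //; apply: ih.
    - rewrite mem_rcons inE => /predU1P[->|wp] iw lw; first by rewrite lw in ll.
      by rewrite nm_eq npre //; apply: ib.
  have ll : lcG x = 0%N by move: l0; case: (lcG x).
  have br : bare_rankG x = (\sum_(y <- pre) barew vs it lf bk par (bk x) y).+1.
    by rewrite /bare_rank (pre_sum_prefix _ e).
  split=> [i|i|i|w|w] /=; rewrite ?big_rcons_nat.
  - by rewrite i8 /hubw ix /= ll andbF addn0.
  - rewrite /barew ix /= ll andbT eqz_nat eq_sym i9; case: eqP => [->|_]; rewrite ?addn0 // i9.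
  - by rewrite i10 /hubl ix /= ll; case: ifP; rewrite addn0.
  - rewrite mem_rcons inE => /predU1P[->|wp] iw lw; first by rewrite ll in lw.
    by rewrite nm_eq npre //; apply: ih.
  - rewrite mem_rcons inE => /predU1P[->|wp] iw lw; first by rewrite eqxx eqxx i9 br -PoszD addn1.
    by rewrite nm_eq npre //; apply: ib.
exact/keep/(contraL (@it_lf _ _ _ _ _ x)).
Qed.

Lemma spine_vertex i : (1 <= i <= k.+1)%N -> [/\ sp (v i), it (v i) = false & bk (v i) = i.-1].
Proof.
move=> hi'; have hl : (lo true <= i <= hi k true)%N by apply: range_lohi.
have spv : sp (v i) by apply: sp_v.
by rewrite (negPf (sp_it spv)) bk_sp // (idx_v ch en).
Qed.

Lemma nspine_v i : (i <= k)%N -> nspine vs sp lf bk par i = lcG (v i.+1).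
Proof.
move=> ik; have [spv iv bv] := spine_vertex (ik : (1 <= i.+1 <= k.+1)%N).
apply: eq_bigr => u _; rewrite /spinew /leafw; case lu: (lf u) => //=; congr (nat_of_bool _).
apply/andP/eqP => [[spu /eqP bu]|->]; last by rewrite bv.
have := par_lf ch en lu; rewrite (negPf (sp_it spu)) spu /= => i0.
have [<- _] := sp_idx ch en spu; congr v.
by move: bu; rewrite bk_sp // => <-; rewrite prednK.
Qed.

Lemma first_v i : (i <= k)%N ->
  firstG (v i.+1) = Num.max (Posz (nhublG i)) (- loadG i).
Proof.
by move=> ik; have [_ iv bv] := spine_vertex (ik : (1 <= i.+1 <= k.+1)%N); rewrite /first iv bv.
Qed.

Definition loaded (j : nat) s0 (A : nat -> int -> int) := [/\
  forall i : nat, (i <= j)%N -> A 13%N i = loadG i,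
  forall i, (i < j)%N -> A 12%N (nm (v i.+1)) = firstG (v i.+1) /\ A 5%N (nm (v i.+1)) = i,
  forall i : nat, (i < j)%N -> A 14%N i = nhubG i /\ A 15%N i = Num.max (loadG i) 0 &
  forall w, it w -> A 12%N (nm w) = arrs s0 12%N (nm w) /\ A 5%N (nm w) = arrs s0 5%N (nm w)].

Lemma compute_loads_runs s : base s ->
  (forall i : nat, [/\ arrs s 8%N i = nhubG i, arrs s 9%N i = nbareG i & arrs s 10%N i =
    nhublG i]) ->
  (forall p, arrs s 6%N (nm p) = lcG p) -> arrs s 13%N 0 = 0 ->
  runs compute_loads s (10 * k.+1).+2 (fun s' => loaded k.+1 s (arrs s')).
Proof.
move=> bs cnt l6 z13; apply: runs_assign_seq; set s1 := set_reg _ _ _.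
have bs1 : base s1 by apply: base_set_reg.
apply: runs_weaken (@runs_for 3 _ _ k.+1 0 (fun=> 9%N) (fun j s' => loaded j s (arrs s')) s1 _ _ _ _ _) _ _ => //.
- by split=> // -[|i] //; rewrite /s1 /= z13.
- by move=> j s' _ fr; have [_ b1 _ _] := base_frame bs1 fr isT isT; rewrite /= b1 -PoszD addn1.
- move=> j s' /andP[_ jk] r3 [i13 i12 i14 iw] fr; have b' := base_frame bs1 fr isT isT.
  have jk' : (j.+1 <= k.+2)%N by apply: leqW.
  have [spv iv bv] := spine_vertex (jk : (1 <= j.+1 <= k.+1)%N).
  have [c8 c9 c10] := cnt j; have x13 := i13 j (leqnn _).
  have rd a i : a \in [:: 6; 8; 9; 10]%N -> arrs s' a i = arrs s a i.
    by move=> ha; rewrite fr.1 //; move: ha; rewrite !inE => /or4P[] /eqP->.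
  have [r8 r9 r10] : [/\ arrs s' 8%N j = nhubG j, arrs s' 9%N j = nbareG j & arrs s' 10%N j =
    nhublG j].
    by rewrite !rd ?inE.
  have r6 : arrs s' 6%N (nm (v j.+1)) = lcG (v j.+1) by rewrite rd ?inE // l6.
  have e1 : Posz j + 1 = Posz j.+1 by rewrite -PoszD addn1.
  have rv : arrs s' 2%N j.+1 = nm (v j.+1) by apply: read_spine.
  have [_ _ b2 _] := b'.
  have inj i : (i < j)%N -> nm (v i.+1) == nm (v j.+1) = false.
    by move=> ij; rewrite nm_eq; apply/negbTE; apply: (v_neq ch en); rewrite //= /hi; lia.
  have injw w : it w -> nm w == nm (v j.+1) = false.
    by move=> iw'; rewrite nm_eq; apply: contraTF iw' => /eqP->; rewrite iv.
  have injn (i : nat) : (i < j)%N -> (Posz i == Posz j) = false by move=> ij;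
    rewrite eqz_nat ltn_eqF.
  have injs (i : nat) : (i <= j)%N -> (Posz i == Posz j.+1) = false by move=> ij;
    rewrite eqz_nat ltn_eqF.
  have fv := first_v (jk : (j <= k)%N); have nv := nspine_v (jk : (j <= k)%N).
  have ld : loadG j.+1 = spill m (loadG j) (nhubG j) (nbareG j) (nhublG j) (lcG (v j.+1)).
    by rewrite -nv.
  apply: runs_wp => //=; rewrite !r3 !e1 !rv /= !x13 !r10 !r8 !r9 !r6 !b2 !eqxx.
  (* The effect of one iteration on the arrays is stated once, for the four outcomes of the two
     tests. *)
  have fin (A : nat -> int -> int) : [/\ forall i : nat, (i <= j.+1)%N -> A 13%N i = loadG i,
     A 12%N =1 (fun c : int => if c == nm (v j.+1) then firstG (v j.+1) else arrs s' 12%N c),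
     A 5%N =1 (fun c : int => if c == nm (v j.+1) then Posz j else arrs s' 5%N c),
     A 14%N =1 (fun c : int => if c == j then Posz (nhubG j) else arrs s' 14%N c) &
     A 15%N =1 (fun c : int => if c == j then Num.max (loadG j) 0 else arrs s' 15%N c)] ->
     loaded j.+1 s A.
    move=> [f13 f12 f5 f14 f15]; split=> // [i|i|w iw'].
    - rewrite ltnS leq_eqVlt f12 f5 => /predU1P[->|ij]; first by rewrite eqxx.
      by rewrite inj //; apply: i12.
    - rewrite ltnS leq_eqVlt f14 f15 => /predU1P[->|ij]; first by rewrite eqxx.
      by rewrite injn //; apply: i14.
    - by rewrite f12 f5 injw //; apply: iw.
  have final_load (F : int) : F = firstG (v j.+1) ->
    loadG j + F + (Posz (nhubG j) + Posz (nbareG j)) + Posz (lcG (v j.+1)) - (Posz m - 1) =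
      loadG j.+1.
    by move=> ->; rewrite fv ld /spill; lia.
  have store F : F = firstG (v j.+1) ->
     (forall i : nat, (i <= j.+1)%N ->
       (if Posz i == Posz j.+1 then loadG j + F + (Posz (nhubG j) + Posz (nbareG j)) + Posz (lcG (v j.+1)) - (Posz m - 1)
       else arrs s' 13%N i) = loadG i).
    move=> eF i; rewrite leq_eqVlt ltnS => /predU1P[->|ij]; first by rewrite eqxx final_load.
    by rewrite injs // i13.
  have [eF1 eF2] : (0 < 0 - loadG j - Posz (nhublG j) -> 0 - loadG j = firstG (v j.+1)) /\
    (~~ (0 < 0 - loadG j - Posz (nhublG j)) -> Posz (nhublG j) = firstG (v j.+1)).
    by rewrite fv; split; lia.
  have [eH1 eH2] : (0 < loadG j -> loadG j = Num.max (loadG j) 0) /\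
    (~~ (0 < loadG j) -> 0 = Num.max (loadG j) 0) by split; lia.
  case: ifPn => [/eF1|/eF2] eF; case: ifPn => [/eH1|/eH2] eH; split=> //; apply: fin;
    split=> //= [|c|c];
    by [exact: store eF|case: eqP|case: eqP].
- by rewrite sum_nat_const_nat subn0 mulnC.
Qed.

(** The first alternative excludes critical hubs only among the vertices visited so far; for
    [pre = vs] it becomes that of [splits]. *)
Definition split_in (pre : seq G) (A : nat -> int -> int) := forall i : nat, (i <= k)%N ->
  (A 14%N i = nhubG i /\ A 15%N i = Num.max (loadG i) 0 /\
     {in pre, forall w, ~~ critical vs m sp it lf bk par i w}) \/
  (exists w, [/\ critical vs m sp it lf bk par i w, A 14%N i = hub_rankG w &
     A 15%N i = Num.max (Num.max (loadG i) 0)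
       (firstG w + Posz (lcG w) - room m (loadG i) (nhubG i) (nbareG i) - Posz (hub_rankG w))]).

Definition ready s := [/\
  forall x, arrs s 4%N (nm x) = sp x,
  forall w, it w -> arrs s 5%N (nm w) = bk w,
  forall p, arrs s 6%N (nm p) = lcG p,
  forall i : nat, [/\ arrs s 8%N i = nhubG i, arrs s 9%N i = nbareG i &
    (i <= k.+1)%N -> arrs s 13%N i = loadG i] &
  forall w, it w -> if (0 < lcG w)%N then arrs s 11%N (nm w) = hub_rankG w /\
    arrs s 12%N (nm w) = firstG w
    else arrs s 11%N (nm w) = bare_rankG w].

Lemma ready_keep s s' : ready s ->
  (forall a, a \in [:: 4; 5; 6; 8; 9; 11; 12; 13]%N -> arrs s' a =1 arrs s a) -> ready s'.
Proof.
move=> [h4 h5 h6 h8 h11] e; split.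
- by move=> x; rewrite e.
- by move=> w iw; rewrite e // h5.
- by move=> p; rewrite e.
- by move=> i; have [? ? ?] := h8 i; rewrite !e.
- by move=> w iw; have := h11 w iw; case: ifP => _; rewrite !e.
Qed.

Lemma split_core_runs s : base s -> ready s ->
  (forall i : nat, (i <= k)%N -> arrs s 14%N i = nhubG i /\ arrs s 15%N i = Num.max (loadG i) 0) ->
  runs (each_vertex split_core Skip) s
    (((steps (vertex_step split_core Skip)).+2 * #|G|).+2) (fun s' => split_in vs (arrs s')).
Proof.
move=> bs rd i14; have [h4 _ _ _ _] := rd.
apply: vertex_loop => //; first by move=> i ik; left; have [-> ->] := i14 i ik.
move=> pre x post s' e r3 b' fr IH.
have keep : (forall i, ~~ critical vs m sp it lf bk par i x) -> split_in (rcons pre x) (arrs s').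
  move=> nc i ik; case: (IH i ik) => [[e1 [e2 h]]|]; last by right.
  left; split=> //; split=> // w; rewrite mem_rcons inE => /predU1P[->//|]; exact: h.
have nit : ~~ it x -> split_in (rcons pre x) (arrs s').
  by move=> /negPf nix; apply: keep => i; rewrite /critical nix.
split=> [sx|ix|lx]; [exact/nit/sp_it| |exact/nit/(contraL (@it_lf _ _ _ _ _ x))].
have [_ h5 h6 h8 h11] : ready s'.
  by apply: (ready_keep rd) => a ha; apply: fr; move: ha; rewrite !inE;
    do !case/predU1P => [->//|]; move/eqP->.
have [hb _] := it_bk ch ix; have [r8 r9 r13] := h8 (bk x).
have bk1 : (bk x <= k.+1)%N by lia.
have {}r13 := r13 bk1.
have [_ _ b2 _] := b'.
rewrite /split_core /= r3 h6; case: ifP => l0; last first.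
  apply: keep => i; rewrite /critical ix; case: eqP => //= _.
  by move: l0; case: (lcG x) => // _; lia.
have ll : (0 < lcG x)%N by [].
have := h11 x ix; rewrite ll => -[r11 r12].
rewrite !(h5 x ix) r8 r9 r13 r12 b2; set T := Posz m - 1 - _ - _.
have eT : T = room m (loadG (bk x)) (nhubG (bk x)) (nbareG (bk x)) by [].
case: (boolP (critical vs m sp it lf bk par (bk x) x)) => [cx|ncx]; last first.
  have nc i : ~~ critical vs m sp it lf bk par i x.
    by move: ncx; rewrite /critical ix eqxx /=; case: eqP => //= <-.
  have : ~~ ((0 < T - firstG x + 1) && (0 < firstG x + Posz (lcG x) - T)).
    by move: ncx; rewrite /critical ix eqxx /= -eT; apply: contra => /andP[]; lia.
  by case: ifP => //= c1; [case: ifP => // _ _|]; move=> *; apply: keep.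
have := cx; rewrite /critical ix eqxx /= -eT => /andP[t1 t2].
have fin (A : nat -> int -> int) : (forall i : nat, A 14%N i =
  if i == bk x then Posz (hub_rankG x) else arrs s' 14%N i) ->
    (forall i : nat, A 15%N i = if i == bk x then Num.max (Num.max (loadG (bk x)) 0)
       (firstG x + Posz (lcG x) - T - Posz (hub_rankG x)) else arrs s' 15%N i) ->
         split_in (rcons pre x) A.
  move=> A14 A15 i ik; rewrite A14 A15; case: (eqVneq i (bk x)) => [->|ni].
    by right; exists x; rewrite -eT.
  case: (IH i ik) => [[e1 [e2 h]]|]; last by right.
  left; split=> //; split=> // w; rewrite mem_rcons inE => /predU1P[->|]; last exact: h.
  by rewrite /critical ix eq_sym (negPf ni).
rewrite ifT; last lia; rewrite ifT; last lia.
rewrite !r11.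
by do 2!case: ifP => ?; apply: fin => i; rewrite /= eqz_nat //; case: eqP => // _; lia.
Qed.

Section Place.
Variables (a h : nat -> int).
Local Notation posG := (pos vs m sp it lf idx bk par a h).

Definition placed_in (pre : seq G) (A : nat -> int -> int) :=
  (forall u, lf u -> A 12%N (nm (par u)) =
     firstG (par u) + Posz (\sum_(y <- pre) leafw lf par (par u) y)%N) /\
  (forall x, sp x \/ x \in pre -> A 3%N (nm x) = posG x).

Lemma place_runs s : base s -> ready s ->
  (forall i, (i <= k.+2)%N -> arrs s 3%N (nm (v i)) = Posz i * m) ->
  (forall i, (i <= k.+2)%N -> arrs s 7%N i = Posz i * m) ->
  (forall i, (i <= k)%N -> arrs s 12%N (nm (v i.+1)) = firstG (v i.+1) /\
    arrs s 5%N (nm (v i.+1)) = i) ->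
  (forall i, (i <= k)%N -> arrs s 14%N i = a i /\ arrs s 15%N i = h i) ->
  runs (each_vertex place_core place_leaf) s
    (((steps (vertex_step place_core place_leaf)).+2 * #|G|).+2)
    (fun s' => forall x, arrs s' 3%N (nm x) = posG x).
Proof.
move=> bs rd h3 h7 h12 h14; have [h4 h5 h6 h8 h11] := rd.
have par5 u : lf u -> arrs s 5%N (nm (par u)) = bk (par u) /\ (bk (par u) <= k)%N.
  move=> lu; case/orP: (par_lf ch en lu) => [ip|/andP[spp i0]].
    by rewrite h5 //; have [hb _] := it_bk ch ip; split=> //; lia.
  have [pc _] := lf_par lu; have hx := sp_core ch en spp pc; have [ev _] := sp_idx ch en spp.
  have ik : ((idx (par u)).-1 <= k)%N by lia.
  by have [_ e] := h12 _ ik; rewrite prednK // ev in e; rewrite e bk_sp.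
have L := @vertex_loop place_core place_leaf s placed_in bs h4 isT isT.
apply: runs_weaken (L _ _) (leqnn _) _; last first.
- by move=> s' [_ i3] x; apply: i3; right.
- move=> pre x post s' e r3 b' fr [i12 i3]; have [_ _ b2 _] := b'.
  have npre y : sp y && ~~ sp x \/ y \in pre -> nm y == nm x = false.
    rewrite nm_eq => -[/andP[sy sx]|yp]; apply/eqP => exy; subst y; first by rewrite sy in sx.
    by have := vs_uniq; rewrite e cat_uniq => /and3P[_ /norP[]]; rewrite yp.
  have r4 (c : int) : arrs s' 5%N c = arrs s 5%N c by rewrite fr.
  have [r6 r7 r8 r9] : [/\ forall p, arrs s' 6%N (nm p) = lcG p, forall i : nat, (i <= k.+2)%N ->
    arrs s' 7%N i = Posz i * m,
      forall i : nat, arrs s' 8%N i = nhubG i & forall i : nat, arrs s' 9%N i = nbareG i].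
    split=> [p|i ik|i|i]; rewrite fr //; first exact: h7; by have [] := h8 i.
  have r13 (i : nat) : (i <= k.+1)%N -> arrs s' 13%N i = loadG i.
    by move=> ik; rewrite fr //; have [_ _] := h8 i; apply.
  have [r14 r15] : (forall i : nat, (i <= k)%N -> arrs s' 14%N i = a i) /\
      (forall i : nat, (i <= k)%N -> arrs s' 15%N i = h i).
    by split=> i ik; rewrite fr //; have [] := h14 i ik.
  have keep3 (A : nat -> int -> int) : (sp x -> False) -> (forall c, A 3%N c =
    if c == nm x then posG x else arrs s' 3%N c) ->
      forall y, sp y \/ y \in rcons pre x -> A 3%N (nm y) = posG y.
    move=> nsx A3 y hy; rewrite A3; case: (eqVneq y x) => [->|yx]; first by rewrite eqxx.
    rewrite nm_eq (negPf yx); apply: i3; case: hy => [|]; first by left.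
    by rewrite mem_rcons inE (negPf yx); right.
  split=> [sx|ix|lx].
  + split=> [u lu|y]; first by rewrite i12 // big_rcons_nat /leafw (negPf (sp_lf sx)) addn0.
    by rewrite mem_rcons inE => -[sy|/predU1P[->|yp]]; apply: i3; [left|left|right].
  + have nsx : sp x -> False by move/sp_it; rewrite ix.
    have [hb _] := it_bk ch ix; have [bk0 bk1 bk2] : [/\ (bk x <= k)%N,
      (bk x <= k.+1)%N & (bk x <= k.+2)%N] by split; lia.
    have ep : posG x = Posz (bk x) * m + off vs m sp it lf bk par a h x.
      by rewrite /pos (negbTE (introN idP nsx)) /block ix.
    rewrite /place_core /fill_cmd /= r3 !r4 !(h5 x ix) !(r13 _ bk1) !r6 !(r14 _ bk0) !(r15 _ bk0) !(r7 _ bk2) !r8 b2.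
    have fin H (A : nat -> int -> int) :
        (forall c, A 3%N c = if c == nm x then Posz (bk x) * m + H else arrs s' 3%N c) ->
        A 12%N =1 arrs s' 12%N -> H = off vs m sp it lf bk par a h x -> placed_in (rcons pre x) A.
      move=> A3 A12 eH; split; last by apply: keep3 => // c; rewrite A3 ep eH.
      by move=> u lu; rewrite A12 i12 // big_rcons_nat /leafw (negPf (it_lf ix)) addn0.
    have r11 : arrs s' 11%N (nm x) = arrs s 11%N (nm x) by rewrite fr.
    have := h11 x ix; rewrite -r11; case: (posnP (lcG x)) => lx => [er|[er _]]; rewrite er.
      have eo : off vs m sp it lf bk par a h x =
        bare_off (loadG (bk x)) (a (bk x)) (h (bk x)) (bare_rankG x).
        by rewrite /off ix lx.
      by rewrite lx /=; do 2!case: ifP => ?; apply: (fin _ _ (fun=> erefl) (fun=> erefl));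
        rewrite eo /bare_off /fill; case: ifP; lia.
    have eo : off vs m sp it lf bk par a h x =
      hub_off m (loadG (bk x)) (nhubG (bk x)) (a (bk x)) (h (bk x)) (hub_rankG x).
      by rewrite /off ix lx.
    rewrite ltz_nat lx /=.
    by do 3?case: ifP => ?; apply: (fin _ _ (fun=> erefl) (fun=> erefl));
      rewrite eo /hub_off; repeat case: ifP; lia.
  + have nsx : sp x -> False by move/sp_lf; rewrite lx.
    have nix : it x = false by apply/negbTE; apply: contraL lx; apply: it_lf.
    have [p5 pk] := par5 x lx.
    rewrite /place_leaf /fill_cmd /= -[arrs s' 1%N _]/(eval s' (parent_of (Reg 3))).
    have eq : firstG (par x) + Posz (\sum_(y <- pre) leafw lf par (par x) y)%N + 1 =
      leaf_pos vs m sp it lf bk par x.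
      by rewrite /leaf_pos /leaf_rank (pre_sum_prefix _ e) -addn1 PoszD addrA.
    rewrite (eval_parent b' r3 (lf_leaf lx)) eqxx !r4 p5 !(i12 x lx) !eq r3 b2 !r8 !r9.
    rewrite !(r13 _ (leqW pk)) !(r14 _ pk) !(r15 _ pk) !(r7 _ (leqW (leqW pk))).
    have eo : posG x = Posz (bk (par x)) * m + leaf_off m (loadG (bk (par x))) (nhubG (bk (par x)))
        (nbareG (bk (par x))) (a (bk (par x))) (h (bk (par x))) (leaf_pos vs m sp it lf bk par x).
      by rewrite /pos (negbTE (introN idP nsx)) /block /off nix.
    have fin H (A : nat -> int -> int) :
        (forall c, A 3%N c = if c == nm x then Posz (bk (par x)) * m + H else arrs s' 3%N c) ->
        (forall c, A 12%N c = if c == nm (par x) then leaf_pos vs m sp it lf bk par x else arrs s' 12%N c) ->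
        H = leaf_off m (loadG (bk (par x))) (nhubG (bk (par x)))
        (nbareG (bk (par x))) (a (bk (par x))) (h (bk (par x))) (leaf_pos vs m sp it lf bk par x) ->
        placed_in (rcons pre x) A.
      move=> A3 A12 eH; split; last by apply: keep3 => // c; rewrite A3 eo eH.
      move=> u lu; rewrite A12 big_rcons_nat nm_eq; case: (eqVneq (par u) (par x)) => [->|pu].
        have w1 : leafw lf par (par x) x = 1%N by rewrite /leafw lx eqxx.
        by rewrite w1 -eq -addrA -PoszD.
      have w0 : leafw lf par (par u) x = 0%N by rewrite /leafw lx eq_sym (negPf pu).
      by rewrite i12 // w0 addn0.
    by do 3?case: ifP => ?; apply: (fin _ _ (fun=> erefl) (fun=> erefl));
      rewrite /leaf_off /room /fill; repeat case: ifP; lia.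
- split=> [u lu|x [sx|]] //; last first.
    have [ev hx] := sp_idx ch en sx; have hx2 : (idx x <= k.+2)%N by case/andP: hx.
    by rewrite -{1}ev h3 // /pos sx.
  rewrite big_nil addr0; case/orP: (par_lf ch en lu) => [ip|/andP[spp i0]].
    by have := h11 _ ip; rewrite (lc_par par vs_all lu) => -[].
  have [pc _] := lf_par lu; have hx := sp_core ch en spp pc; have [ev _] := sp_idx ch en spp.
  have ik : ((idx (par u)).-1 <= k)%N by lia.
  by have [e _] := h12 _ ik; rewrite prednK // ev in e.
Qed.

End Place.

Lemma runs_step c d s B1 B2 P R : runs c s B1 P ->
  (forall s1, P s1 -> frame c s s1 -> runs d s1 B2 R) -> runs (Seq c d) s (B1 + B2) R.
Proof.
move=> /runs_frame[t [s1 [x1 l1 [P1 f1]]]] H; apply: (@runs_seq _ _ _ B1 B2) => //.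
by exists t, s1; split=> //; apply: H.
Qed.

Lemma layout_runs : exists B : nat,
  [/\ (B <= 400 * #|G| + 3 * \sum_(1 <= j < k.+2) size (nb (v j)))%N &
  runs layout_cmd s_in B (fun s' => exists a h, (forall i, splits vs m sp it lf bk par a h i) /\
    forall x, arrs s' 3%N (nm x) = pos vs m sp it lf idx bk par a h x)].
Proof.
(* The spine vertices are distinct, so a constant cost per spine vertex is linear in [#|G|]. *)
have n0 : (k.+3 <= #|G|)%N.
  by have := max_card (mem (spine k v true true));
    rewrite (card_uniqP (spine_uniq ch en)) size_map size_iota.
(* The bound is left open and assembled by [runs_step] from the costs of the passes; the last goal
   compares the result with the stated bound. *)
eexists; split; last first.
apply: runs_step (mark_spine_runs base_in erefl (fun=> erefl)) _ => s1 [m4 m3 m7] f1.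
have b1 := base_frame base_in f1 isT isT.
apply: runs_step (find_blocks_runs b1) _ => s2 h5 f2; have b2 := base_frame b1 f2 isT isT.
have m4' x : arrs s2 4%N (nm x) = sp x by rewrite f2.1.
apply: runs_step (count_leaves_runs b2 m4' _) _ => [c|s3 h6 f3]; first by rewrite f2.1 // f1.1.
have b3 := base_frame b2 f3 isT isT.
have m4'' x : arrs s3 4%N (nm x) = sp x by rewrite f3.1.
apply: runs_step (rank_ints_runs b3 m4'' _ h6 _) _ => [w iw|c|s4 [r8 r9 r10 rh rb] f4].
- by rewrite f3.1 // h5.
- by split; rewrite f3.1 // f2.1 // f1.1.
have b4 := base_frame b3 f4 isT isT.
apply: runs_step (compute_loads_runs b4 _ _ _) _ => [i|p||s5 [l13 l12 l14 lw] f5].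
- by split.
- by rewrite f4.1.
- by rewrite f4.1 // f3.1 // f2.1 // f1.1.
have b5 := base_frame b4 f5 isT isT.
have rd : ready s5.
  split=> [x|w iw|p|i|w iw].
  - by rewrite f5.1 // f4.1.
  - by have [_ ->] := lw w iw; rewrite f4.1 // f3.1 // h5.
  - by rewrite f5.1 // f4.1.
  - by split; [rewrite f5.1|rewrite f5.1|apply: l13].
  - have [e12 _] := lw w iw; have e11 : arrs s5 11%N (nm w) = arrs s4 11%N (nm w) by rewrite f5.1.
    rewrite e11 e12; case: ifPn => lc; first exact: rh.
    by apply: rb => //; move: lc; rewrite -leqNgt leqn0 => /eqP.
apply: runs_step (split_core_runs b5 rd l14) _ => s6 sp6 f6.
have b6 := base_frame b5 f6 isT isT.
have rd6 : ready s6.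
  by apply: (ready_keep rd) => a ha; apply: f6.1; move: ha; rewrite !inE;
    do !case/predU1P => [->//|]; move/eqP->.
(* [splits] speaks of every [i], but the program fills the cells up to [k] only; later blocks have
   no hubs, so the values without critical hub are right there. *)
pose a i : int := if (i <= k)%N then arrs s6 14%N i else nhubG i.
pose h i : int := if (i <= k)%N then arrs s6 15%N i else Num.max (loadG i) 0.
apply: runs_weaken (@place_runs a h s6 b6 rd6 _ _ _ _) (leqnn _) _ => [i ik|i ik|i ik|i ik|s' hs].
- by rewrite f6.1 // f5.1 // f4.1 // f3.1 // f2.1 // m3.
- by rewrite f6.1 // f5.1 // f4.1 // f3.1 // f2.1 // m7.
- by rewrite !f6.1 //; apply: l12.
- by rewrite /a /h ik.
- exists a, h; split=> // i; rewrite /splits /a /h; case: ifPn => ik.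
    case: (sp6 i ik) => [[-> [-> nc]]|]; last by right.
    by left; split=> //; split=> // w; apply: nc.
  left; split=> //; split=> // w; apply: contra ik; rewrite /critical => /and3P[iw /eqP <- _].
  by have [/andP[]] := it_bk ch iw.
- rewrite big_split sum_nat_const_nat -big_distrr /=.
  set D := (\sum_(1 <= j < k.+2) _)%N; rewrite /maxn /=; move: n0; move: #|G| D => n D n0. lia.
Qed.

End Correctness.

End LayoutProgram.

(** * From distinguished vertices to the verified layout *)

Section Distinguished.
Variable G : sgraph.
Implicit Types (x y z u w : G).

Lemma sum_degrees (A : seq G) (nb : G -> seq G) : uniq A ->
  (forall x, perm_eq (nb x) (enum [set y | adj x y])) ->
  \sum_(x <- A) size (nb x) <= 2 * #|edges G|.
Proof.
move=> uA nbP; pose D := [set p : G * G | adj p.1 p.2].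
pose g (p : G * G) := [set p.1; p.2].
have le1 : \sum_(x <- A) size (nb x) <= #|D|.
  have -> : \sum_(x <- A) size (nb x) = size [seq (x, y) | x <- A, y <- nb x].
    by rewrite size_allpairs_dep sumnE big_map.
  rewrite cardE; apply: uniq_leq_size.
    apply: allpairs_uniq_dep => // [x _|[a b] [c d] _ _ [-> ->] //].
    by rewrite (perm_uniq (nbP x)) enum_uniq.
  move=> _ /allpairsPdep[x [y [_ + ->]]]; rewrite (perm_mem (nbP x)) !mem_enum !inE.
  by [].
apply: leq_trans le1 _; rewrite -sum1_card (partition_big g (mem (edges G))) /=; last first.
  by move=> p pD; apply/imsetP; exists p => //; move: pD; rewrite !inE.
rewrite mulnC -sum_nat_const; apply: leq_sum => e /imsetP[[x y] _ ->] /=.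
rewrite sum1_card; apply: leq_trans (subset_leq_card (_ : _ \subset [set (x, y); (y, x)])) _.
  apply/subsetP => -[a b]; rewrite unfold_in /= !inE => /andP[ab /eqP eg].
  have a_in : a \in [set x; y] by rewrite -eg set21.
  have b_in : b \in [set x; y] by rewrite -eg set22.
  have ab' : a != b by apply: contraTneq ab => ->; rewrite adj_irr.
  move: a_in b_in ab'; rewrite !inE !xpair_eqE => /orP[/eqP->|/eqP->] /orP[/eqP->|/eqP->];
    by rewrite ?eqxx ?orbT.
by rewrite cards2; case: (_ != _).
Qed.

Lemma distinguished_chain k (v : nat -> G) Q : block_caterpillar G -> distinguished k v Q ->
  chain k v Q.
Proof.
move=> [_ bp] dq; have mid i : 2 <= i <= k -> v i \in Q i.-1 /\ v i \in Q i.
  by move=> hi'; apply/setIP; rewrite (dist_v_mid dq hi') set11.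
apply: chain_of_blocks bp (dist_k dq) (dist_Q_inj dq) (dist_Q_blocks dq) _ _
  (dist_v_first_neq dq) (dist_v_last_neq dq) => i hi'.
  case: (ltngtP 1 i) => [i1|i1|<-]; [|lia|exact: dist_v_first dq].
  by have [] := mid i; first lia.
case: (ltngtP i k) => [ik|ik|->]; [|lia|exact: dist_v_last dq].
by have [] := mid i.+1; first lia.
Qed.

Lemma distinguished_ends k (v : nat -> G) Q : chain k v Q -> distinguished k v Q ->
  ends k v Q true true.
Proof.
move=> ch dq; have l0 := dist_leaf_first dq; have lk := dist_leaf_last dq.
split=> //= _ _; apply/eqP => e; have := lk; rewrite -e leaves_atE => /andP[_ /eqP p].
have := l0; rewrite leaves_atE p => /andP[_ /eqP e2].
by have := v_inj_core ch (leqnn 1) (dist_k dq : 1 < k.+1) (leqnn _); rewrite e2 eqxx.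
Qed.

(** A leaf whose neighbor is a leaf forms a component $K_2$ with it, which cannot contain the core
    vertex [c]. *)
Lemma connected_hang c : connected [set: G] -> c \in core G ->
  forall x, (x \in core G) || hangs x.
Proof.
move=> /connectedP[_ con] cc x; case: (boolP (x \in core G)) => //=; rewrite leaf_core negbK => xL.
rewrite /hangs xL leaf_core; apply/negP => pL.
have [||p pp lp] := connectP (con x c _ _); rewrite ?inE //.
have ppx : par (par x) = x by apply/esym/eqP; rewrite -parP // adj_sym parP.
have cl y z : y \in [:: x; par x] -> adj y z -> z \in [:: x; par x].
  by rewrite !inE => /orP[] /eqP->; rewrite parP // => /eqP->; rewrite ?ppx eqxx ?orbT.
have : c \in [:: x; par x].
  rewrite lp; have walk q y : y \in [:: x; par x] -> path (induced [set: G]) y q ->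
      last y q \in [:: x; par x].
    elim: q y => //= z q IH y yx /andP[/and3P[_ _ yz] zq].
    exact: IH (cl _ _ yx yz) zq.
  by apply: walk; rewrite ?mem_head.
by rewrite !inE => /orP[] /eqP e; move: cc; rewrite leaf_core e ?xL ?pL.
Qed.

Lemma density_gt0 x y : adj x y -> 0 < local_density G.
Proof.
move=> xy; rewrite lt0n; apply/negP => /eqP d0.
have ne : x != y by apply: contraTneq xy => ->; rewrite adj_irr.
have c2 : #|[set x; y]| = 2 by rewrite cards2 ne.
have := @density_le G [set x; y] 1 0; rewrite c2 d0 => /(_ isT) W.
suff : 2 <= 0 * 1 + 1 by []; apply: W => // a b aS bS.
case: (eqVneq a b) => [->|ab]; first exact: reach0.
apply: reach1 => //; move: aS bS ab; rewrite !inE => /orP[] /eqP-> /orP[] /eqP->; rewrite ?eqxx //.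
by rewrite adj_sym.
Qed.

Lemma layout_correct k (v : nat -> G) Q (m : int) vs nb :
  block_caterpillar G -> connected [set: G] -> distinguished k v Q ->
  (Posz (local_density G) <= m)%R -> adjacency_lists vs nb ->
  exists t s, [/\ exec layout_cmd (input vs nb k v m) t s, t <= 406 * graph_size G &
    left_justified k v Q m (output vs s)].
Proof.
move=> bc con dq; case: m => // m dm [vsE nbP].
have ch := distinguished_chain bc dq; have en := distinguished_ends ch dq.
have hang := connected_hang con (ch_v1 ch); have k1 := dist_k dq.
have m1 : 0 < m.
  apply: leq_trans dm; apply: (@density_gt0 (v 1) (v 0)).
  by have := dist_leaf_first dq; rewrite inE => /andP[].
have [B [leB [t [s [ex le [a [h [sp e]]]]]]]] := layout_runs m ch en vsE nbP k1 hang.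
(* The factor 406 absorbs 400 per vertex and 3 per neighbor of a spine vertex; the degrees sum to at
   most twice the number of edges. *)
exists t, s; split=> //.
  have uv : uniq (map v (iota 1 k.+1)).
    rewrite map_inj_in_uniq ?iota_uniq // => i j; rewrite !mem_iota => hi' hj.
    by apply: (v_inj ch en); apply: range_lohi; lia.
  have := sum_degrees uv nbP; rewrite big_map -/(index_iota 1 k.+2) => le2.
  by move: le leB le2; rewrite /graph_size; set D := \sum_(1 <= j < _) _; lia.
have -> : output vs s = cpos k v Q true true m vs a h by apply/funext => x; apply: e.
exact: (cpos_left_justified ch en vsE m1 dm k1 hang (dist_Q_first dq) (dist_Q_last dq) sp).
Qed.

End Distinguished.

(** * Bandwidth *)

Section Order.
Variable G : sgraph.
Implicit Types (A B S : {set G}) (x y z u w : G).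

(** Consecutive cutvertices are adjacent and span a block [D i]; these are $k-2$ distinct blocks.
    The remaining two contain the ends of the path, because each cutvertex lies in two blocks. *)
Lemma blocks_in_order A : block_path A -> exists k (v : nat -> G) (Q : nat -> {set G}),
  [/\ 1 <= k, {in [pred i | 1 <= i <= k] &, injective Q},
      forall B, B \in blocks A <-> exists2 i, 1 <= i <= k & B = Q i &
      forall i, 2 <= i <= k -> v i \in Q i.-1 /\ v i \in Q i].
Proof.
case=> bg nb [s [us sC sadj]].
have ss : size s = #|cutvertices A| by rewrite -(card_uniqP us); apply: eq_card.
rewrite -ss in nb; case: (posnP (size s)) => [s0|s0].
  rewrite s0 in nb; move/eqP/cards1P: nb => [B eB].
  have : 0 < #|blocks A| by rewrite eB cards1.
  have [x0 _] : exists x0 : G, True.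
    have : B \in blocks A by rewrite eB set11.
    by case/blocksP=> _ /andP[/connectedP[[x _] _] _]; exists x.
  move=> _; exists 1, (fun=> x0), (fun=> B); split=> //.
  - by move=> i j; rewrite !inE; lia.
  - by move=> B'; rewrite eB inE; split=> [/eqP->|[i _ ->]]; [exists 1|rewrite eqxx].
  - by move=> i; lia.
have x0 : G by case: s s0 {us sC sadj ss nb} => // x.
(* The cutvertices are numbered from 2, leaving index 1 for a vertex of the first block. *)
pose v i := nth x0 s (i - 2); have [k ek] : exists k, k = (size s).+1 by eexists.
rewrite -ek in nb; have k2' : 2 <= k by lia.
have lt i : 2 <= i <= k -> i - 2 < size s by lia.
have vC i : 2 <= i <= k -> v i \in cutvertices A.
  by move=> hi; rewrite -sC; apply: mem_nth; apply: lt.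
have vadj i j : 2 <= i <= k -> 2 <= j <= k -> adj (v i) (v j) = (i == j.+1) || (j == i.+1).
  move=> hi hj; rewrite sadj ?lt //.
  by congr (_ || _); apply/eqP/eqP; lia.
have vinj i j : 2 <= i <= k -> 2 <= j <= k -> v i = v j -> i = j.
  move=> hi hj /eqP; rewrite nth_uniq ?lt ?us // => /eqP; lia.
have vA i : 2 <= i <= k -> v i \in A by move/vC; rewrite inE => /andP[].
have vne i : 2 <= i < k -> v i != v i.+1.
  by move=> hi; apply/eqP => /vinj; lia.
pose D i := odflt set0 [pick B in blocks A | (v i \in B) && (v i.+1 \in B)].
have Dp i : 2 <= i < k -> [/\ D i \in blocks A, v i \in D i & v i.+1 \in D i].
  move=> hi; have e : adj (v i) (v i.+1) by rewrite vadj ?eqxx ?orbT; lia.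
  have cl : clique [set v i; v i.+1].
    by move=> a b /set2P[]-> /set2P[]->; rewrite ?eqxx // adj_sym.
  have [|B BA sB] := sub_block (A := A) _ (clique_nonseparable (set21 _ _) cl).
    by rewrite subUset !sub1set !vA //; lia.
  rewrite /D; case: pickP => [B' /and3P[]//|/(_ B)]; rewrite BA /=.
  by move: sB; rewrite subUset !sub1set => ->.
(* Blocks are cliques and the cutvertices induce a path, so a block contains no two nonconsecutive
   cutvertices. *)
have in_block B i j : B \in blocks A -> 2 <= i <= k -> 2 <= j <= k -> v i \in B -> v j \in B ->
    i <= j.+1 /\ j <= i.+1.
  move=> BA hi hj iB jB; case: (eqVneq i j) => [->|ij]; first by split.
  have : adj (v i) (v j) by apply: (bg _ BA) => //; apply: contra ij => /eqP/vinj ->.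
  by rewrite vadj // => /orP[] /eqP->; split; lia.
have Dinj i j : 2 <= i < k -> 2 <= j < k -> D i = D j -> i = j.
  move=> hi hj e; have [Bi i1 i2] := Dp i hi; have [Bj j1 j2] := Dp j hj.
  rewrite -e in j1 j2.
  have ri : 2 <= i <= k /\ 2 <= i.+1 <= k by clear -hi; lia.
  have rj : 2 <= j <= k /\ 2 <= j.+1 <= k by clear -hj; lia.
  have [_ h] := in_block _ i j.+1 Bi ri.1 rj.2 i1 j2.
  have [h' _] := in_block _ i.+1 j Bi ri.2 rj.1 i2 j1; clear -h h'; lia.
pose Ds := [set:: map D (iota 2 (k - 2))].
have uD : uniq (map D (iota 2 (k - 2))).
  by rewrite map_inj_in_uniq ?iota_uniq // => i j; rewrite !mem_iota => hi hj; apply: Dinj; lia.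
have DsP B : reflect (exists2 i, 2 <= i < k & B = D i) (B \in Ds).
  rewrite inE; apply: (iffP mapP) => -[i hi ->]; exists i => //; move: hi; rewrite mem_iota; lia.
have DsA : Ds \subset blocks A by apply/subsetP => B /DsP[i /Dp[? _ _] ->].
have cD : #|Ds| = k - 2 by rewrite cardsE (card_uniqP uD) size_map size_iota.
have : #|blocks A :\: Ds| == 2.
  by rewrite cardsD (setIidPr DsA) cD nb; lia.
case/cards2P=> E [E' [EE' eqE]].
have [EA ED] : E \in blocks A /\ E \notin Ds.
  by apply/andP; rewrite andbC -in_setD eqE set21.
have [EA' ED'] : E' \in blocks A /\ E' \notin Ds.
  by apply/andP; rewrite andbC -in_setD eqE set22.
have blk B : B \in blocks A -> [\/ B \in Ds, B = E | B = E'].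
  move=> BA; case: (boolP (B \in Ds)) => BD; first by constructor 1.
  have : B \in blocks A :\: Ds by rewrite inE BD.
  by rewrite eqE => /set2P[->|->]; [constructor 2|constructor 3].
have k2 : 2 <= 2 <= k by clear -k2'; lia.
have kk : 2 <= k <= k by clear -k2'; lia.
have D2 B : B \in Ds -> v 2 \in B -> B = D 2 /\ 2 < k.
  case/DsP=> i hi ->; have [Bi i1 i2] := Dp i hi => v2.
  have hi' : 2 <= i.+1 <= k by clear -hi; lia.
  have [_ h] := in_block _ 2 i.+1 Bi k2 hi' v2 i2.
  have -> : i = 2 by clear -hi h; lia.
  by split=> //; clear -hi; lia.
have Dk B : B \in Ds -> v k \in B -> B = D k.-1 /\ 2 < k.
  case/DsP=> i hi ->; have [Bi i1 i2] := Dp i hi => vk.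
  have hi' : 2 <= i <= k by clear -hi; lia.
  have [_ h] := in_block _ i k Bi hi' kk i1 vk.
  have -> : i = k.-1 by clear -hi h; lia.
  by split=> //; clear -hi; lia.
(* Each of $v_2$ and $v_k$ lies in at most one of the blocks [D i], so another of its blocks is [E]
   or [E']. If a single one of these contained both, $k=3$ would make it equal to [D 2]; and for
   $k=2$ the only cutvertex lies in both. *)
have ends : (v 2 \in E /\ v k \in E') \/ (v 2 \in E' /\ v k \in E).
  have two i : 2 <= i <= k -> (forall B B', B \in Ds -> B' \in Ds -> v i \in B -> v i \in B' ->
    B = B') ->
      v i \in E \/ v i \in E'.
    move=> hi one; have [B [B' [BA BA' vB vB' BB']]] := cutvertex_two_blocks bg (vC i hi).
    case: (blk B BA) => [BD|eB|eB]; [|by left; rewrite -eB|by right; rewrite -eB].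
    case: (blk B' BA') => [BD'|eB'|eB']; [|by left; rewrite -eB'|by right; rewrite -eB'].
    by rewrite (one B B') ?eqxx in BB'.
  have t2 : v 2 \in E \/ v 2 \in E'.
    by apply: two => // B B' b b' x x'; have [-> _] := D2 B b x; have [-> _] := D2 B' b' x'.
  have tk : v k \in E \/ v k \in E'.
    by apply: two => // B B' b b' x x'; have [-> _] := Dk B b x; have [-> _] := Dk B' b' x'.
  have notboth F : F \in blocks A -> F \notin Ds -> v 2 \in F -> v k \in F -> k = 2.
    move=> FA FD f2 fk; have [_ h] := in_block F 2 k FA k2 kk f2 fk.
    case: (ltngtP 2 k) => [lt2|lt2|//]; last by clear -lt2 k2'; lia.
    have e3 : k = 3 by clear -lt2 h; lia.
    have h2 : 2 <= 2 < k by clear -lt2; lia.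
    have [DA d1 d2] := Dp 2 h2; rewrite e3 in fk.
    have eF : F = D 2.
      by apply: (blocks_meet FA DA (x := v 2) (y := v 3)); rewrite ?inE ?f2 ?fk ?d1 ?d2 // vne.
    by case/negP: FD; apply/DsP; exists 2.
  have k2case : k = 2 -> v k = v 2 by move=> ->.
  have both : k = 2 -> v 2 \in E /\ v 2 \in E'.
    move=> e; have [B [B' [BA BA' vB vB' BB']]] := cutvertex_two_blocks bg (vC 2 k2).
    have no F : F \in Ds -> False by case/DsP=> i hi _; clear -hi e; lia.
    case: (blk B BA) => [/no//|eB|eB]; case: (blk B' BA') => [/no//|eB'|eB'].
    - by rewrite eB eB' eqxx in BB'.
    - by rewrite -{1}eB -eB'.
    - by rewrite -{1}eB' -eB.
    - by rewrite eB eB' eqxx in BB'.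
  case: (eqVneq k 2) => [e|ne].
    by have [b b'] := both e; left; rewrite k2case.
  case: t2 => [e2|e2]; case: tk => [fk|fk]; [|by left|by right|].
    by have := notboth E EA ED e2 fk => e; rewrite e eqxx in ne.
  by have := notboth E' EA' ED' e2 fk => e; rewrite e eqxx in ne.
have fin F F' : F \in blocks A -> F' \in blocks A -> F \notin Ds -> F' \notin Ds -> F != F' ->
    (forall B, B \in blocks A -> [\/ B \in Ds, B = F | B = F']) -> v 2 \in F -> v k \in F' ->
  exists k (v : nat -> G) (Q : nat -> {set G}),
  [/\ 1 <= k, {in [pred i | 1 <= i <= k] &, injective Q},
      forall B, B \in blocks A <-> exists2 i, 1 <= i <= k & B = Q i &
      forall i, 2 <= i <= k -> v i \in Q i.-1 /\ v i \in Q i].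
  move=> FA FA' FD FD' FF' blkF f2 fk.
  pose Q i := if i == 1 then F else if i == k then F' else D i.
  have k1 : (k == 1) = false by clear -k2'; lia.
  have Q1 : Q 1 = F by []. 
  have Qk : Q k = F' by rewrite /Q k1 eqxx.
  have QD i : 2 <= i < k -> Q i = D i by move=> hi; rewrite /Q !ifF //; clear -hi; lia.
  have DD i : 2 <= i < k -> D i \in Ds by move=> hi; apply/DsP; exists i.
  have rng i : 1 <= i <= k -> [\/ i = 1, i = k | 2 <= i < k].
    by move=> hi; case: (eqVneq i 1) => [->|n1]; [constructor 1|case: (eqVneq i k) => [->|nk];
      [constructor 2|constructor 3; clear -hi n1 nk; lia]].
  exists k, v, Q; split; first by clear -k2'; lia.
  - move=> i j; rewrite !inE => /rng[->|->|hi] /rng[->|->|hj]; rewrite ?Q1 ?Qk // ?QD //.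
    + by move=> e; rewrite e eqxx in FF'.
    + by move=> e; rewrite e DD in FD.
    + by move=> e; rewrite e eqxx in FF'.
    + by move=> e; rewrite e DD in FD'.
    + by move=> e; rewrite -e DD in FD.
    + by move=> e; rewrite -e DD in FD'.
    + exact: Dinj.
  - move=> B; split=> [/blkF[/DsP[i hi ->]|->|->]|[i /rng[->|->|hi] ->]].
    + by exists i; rewrite ?QD //; clear -hi; lia.
    + by exists 1; rewrite //; clear -k2'; lia.
    + by exists k; rewrite ?Qk //; clear -k2'; lia.
    + by rewrite Q1.
    + by rewrite Qk.
    + by rewrite QD //; have [] := Dp i hi.
  - move=> i hi; split.
      case: (eqVneq i 2) => [->|i2]; first by rewrite /= Q1.
      have hi' : 2 <= i.-1 < k by clear -hi i2; lia.
      by rewrite QD //; have [_ _] := Dp _ hi'; rewrite prednK //; clear -hi; lia.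
    case: (eqVneq i k) => [->|ik]; first by rewrite Qk.
    have hi' : 2 <= i < k by clear -hi ik; lia.
    by rewrite QD //; have [] := Dp i hi'.
case: ends => -[e e']; first exact: (fin E E').
apply: (fin E' E) => //; first by rewrite eq_sym.
by move=> B /blk[]; [constructor 1|constructor 3|constructor 2].
Qed.

End Order.

(** * Spines with or without end leaves in an arbitrary block caterpillar *)

Section Bandwidth.
Variable G : sgraph.
Implicit Types (A B S : {set G}) (x y z u w : G).

Lemma chain_ext k (v v' : nat -> G) Q : (forall i, 1 <= i <= k.+1 -> v' i = v i) ->
  chain k v Q -> chain k v' Q.
Proof.
move=> e ch; have el i : 1 <= i <= k -> v' i = v i by move=> hi; apply: e; lia.
have er i : 1 <= i <= k -> v' i.+1 = v i.+1 by move=> hi; apply: e; lia.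
have e1 : v' 1 = v 1 by apply: e.
split; rewrite ?e1.
- exact: ch_v1 ch.
- exact: ch_cover ch.
- exact: ch_core ch.
- exact: ch_clique ch.
- exact: ch_edge ch.
- by move=> i hi; rewrite el //; apply: ch_left ch _ hi.
- by move=> i hi; rewrite er //; apply: ch_right ch _ hi.
- by move=> i hi; rewrite el ?er //; apply: ch_neq ch _ hi.
- move=> i j x i1 ij jk xi xj; have hj : 1 <= j <= k by lia.
  by rewrite el //; apply: (ch_meet ch i1 ij jk xi xj).
Qed.

Lemma add_ends k (v : nat -> G) Q : chain k v Q -> 1 <= k ->
  (exists2 u, hangs u & par u = v 1) \/
    (forall u, hangs u -> par u \in Q 1 -> par u = v 2) ->
  (exists2 u, hangs u & par u = v k.+1) \/
    (forall u, hangs u -> par u \in Q k -> par u = v k) ->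
  exists v' (bl br : bool), chain k v' Q /\ ends k v' Q bl br.
Proof.
move=> ch k1 L R.
have [u0 [bl [l1 l2]]] : exists u0 (bl : bool), (bl -> u0 \in leaves_at (v 1)) /\
    (~~ bl -> forall u, hangs u -> par u \in Q 1 -> par u = v 2).
  case: L => [[u hu pu]|no]; last by exists (v 1), false.
  by exists u, true; split=> // _; rewrite leaves_atE pu eqxx; case/andP: hu => ->.
have [u1 [br [r1 r2]]] : exists u1 (br : bool), (br -> u1 \in leaves_at (v k.+1)) /\
    (~~ br -> forall u, hangs u -> par u \in Q k -> par u = v k).
  case: R => [[u hu pu]|no]; last by exists (v 1), false.
  by exists u, true; split=> // _; rewrite leaves_atE pu eqxx; case/andP: hu => ->.
pose v' i := if i == 0 then u0 else if i == k.+2 then u1 else v i.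
have ev i : 1 <= i <= k.+1 -> v' i = v i by move=> hi; rewrite /v' !ifF //; lia.
have [e1 e2 e3 e4] : [/\ v' 1 = v 1, v' 2 = v 2, v' k = v k & v' k.+1 = v k.+1].
  by split; apply: ev; lia.
have v12 : v 1 != v 2 by apply: (ch_neq ch).
have vkk : v k != v k.+1 by apply: (ch_neq ch); lia.
have q1 : v 1 \in Q 1 by apply: (ch_left ch).
have qk : v k.+1 \in Q k by apply: (ch_right ch); lia.
exists v', bl, br; split; first exact: chain_ext ev ch.
have ek : v' k.+2 = u1 by rewrite /v' eqxx.
split; rewrite ?e1 ?e2 ?e3 ?e4 ?ek //=.
- move=> bL bR; apply/eqP => e; have := r1 bR; rewrite -e leaves_atE => /andP[_ /eqP p].
  have := l1 bL; rewrite leaves_atE p => /andP[_ /eqP e'].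
  by have := v_inj_core ch (leqnn 1) (k1 : 1 < k.+1) (leqnn _); rewrite e' eqxx.
- move=> nb u hu; split=> [|_]; last exact: l2.
  by apply: contraNneq v12 => pu; rewrite -pu (l2 nb u hu) // pu.
- move=> nb u hu; split=> [|_]; last exact: r2.
  by apply: contraNneq vkk => pu; rewrite -pu (r2 nb u hu) // pu.
Qed.

(** [S] is an end clique and [z] its other spine vertex. A vertex with a hanging leaf is preferred
    as the end of the spine; if there is none besides [z], any other vertex serves. *)
Lemma pick_end S z : (exists2 x, x \in S & x != z) -> exists x, [/\ x \in S, x != z &
  (exists2 u, hangs u & par u = x) \/ (forall u, hangs u -> par u \in S -> par u = z)].
Proof.
move=> [x0 x0S x0z].
case: (pickP [pred u : G | [&& hangs u, par u \in S & par u != z]]) => [u /and3P[hu pS pz]|no].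
  by exists (par u); split=> //; left; exists u.
exists x0; split=> //; right => u hu pS; apply/eqP.
by have := no u; rewrite /= hu pS => /negbFE.
Qed.

(** Only the end vertices remain to be chosen in the end cliques. A core with a single vertex has no
    clique with two ends and becomes a chain with [k = 0]. *)
Lemma chain_exists : block_caterpillar G ->
  exists k (v : nat -> G) Q (bl br : bool), chain k v Q /\ ends k v Q bl br.
Proof.
move=> [_ bp]; have [k [v [Q [k1 Qinj Qb vmid]]]] := blocks_in_order bp.
have blk i : 1 <= i <= k -> Q i \in blocks (core G) by move=> hi; apply/Qb; exists i.
have put x1 xk : x1 \in Q 1 -> xk \in Q k -> (k = 1 -> x1 != xk) ->
    (1 < k -> x1 != v 2 /\ xk != v k) ->
    exists w : nat -> G, [/\ chain k w Q, w 1 = x1, w k.+1 = xk & 1 < k -> w 2 = v 2 /\ w k = v k].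
  move=> x1Q xkQ n1 n2.
  pose w i := if i == 1 then x1 else if i == k.+1 then xk else v i.
  have w1 : w 1 = x1 by [].
  have wk : w k.+1 = xk by rewrite /w eqxx ifF //; lia.
  have wm i : 2 <= i <= k -> w i = v i by move=> hi; rewrite /w !ifF //; lia.
  exists w; split=> //; last by move=> k2; split; apply: wm; lia.
  apply: (chain_of_blocks bp k1 Qinj Qb).
  - move=> i hi; case: (eqVneq i 1) => [->//|i1].
    have hi' : 2 <= i <= k by lia.
    by rewrite wm //; have [] := vmid i hi'.
  - move=> i hi; case: (eqVneq i k) => [->|ik]; first by rewrite wk.
    have hi' : 2 <= i.+1 <= k by lia.
    by rewrite wm //; have [] := vmid _ hi'.
  - case: (ltnP 1 k) => k2; first by rewrite (wm 2) ?w1 ?k2 //; have [] := n2 k2.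
    have ek : k = 1 by lia.
    by rewrite w1 -[2]/(1.+1) -{1}ek wk; apply: n1.
  - case: (ltnP 1 k) => k2; first by rewrite wk (wm k); [have [] := n2 k2|lia].
    have ek : k = 1 by lia.
    by rewrite wk {1}ek w1 eq_sym; apply: n1.
case: (ltnP 1 k) => k2.
  have other i j x : 1 <= i <= k -> 1 <= j <= k -> i != j -> x \in Q j ->
      exists2 y, y \in Q i & y != x.
    move=> hi hj ij xj; case: (pickP [pred y | (y \in Q i) && (y != x)]) => [y /andP[]|no].
      by exists y.
    have sub : Q i \subset Q j.
      by apply/subsetP => y yi; have := no y; rewrite /= yi => /negbFE /eqP->.
    have [sj nj] := blocksP (blk j hj).
    by have := Qinj i j hi hj (esym (block_max (blk i hi) sub sj nj)) => e; rewrite e eqxx in ij.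
  have m2 : 2 <= 2 <= k by lia.
  have mk : 2 <= k <= k by lia.
  have [v2 v2'] := vmid 2 m2; have [vk vk'] := vmid k mk.
  have [|x1 [x1Q x1n L]] := @pick_end (Q 1) (v 2).
    by apply: (other 1 2) => //; lia.
  have [|xk [xkQ xkn R]] := @pick_end (Q k) (v k).
    by apply: (other k k.-1) => //; lia.
  have [||w [cw w1 wk /(_ k2)[w2 wk2]]] := put x1 xk x1Q xkQ => //; first lia.
  by exists k; have [||v' [bl [br [c e]]]] := add_ends cw k1; rewrite ?w1 ?wk ?w2 ?wk2 //;
    exists v', Q, bl, br.
have ek : k = 1 by lia.
rewrite {}ek in k1 k2 Qinj Qb vmid blk put *.
have q1 : Q 1 \in blocks (core G) by apply: blk.
have [sQ nQ] := blocksP q1.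
have [c cQ] : exists c, c \in Q 1 by case/nonseparableP: nQ.
case: (pickP [pred y | (y \in Q 1) && (y != c)]) => [d /andP[dQ dc]|one].
  (* Both ends are chosen in the only clique, so [x] takes a vertex with a hanging leaf whenever
     there is one, and [y] is then chosen relative to [x]. *)
  have [x [xQ L]] : exists x, x \in Q 1 /\
      ((exists2 u, hangs u & par u = x) \/ (forall u, hangs u -> par u \notin Q 1)).
    case: (pickP [pred u : G | hangs u && (par u \in Q 1)]) => [u /andP[hu pS]|no].
      by exists (par u); split=> //; left; exists u.
    by exists c; split=> //; right => u hu; have := no u; rewrite /= hu => /negbT.
  have [|y [yQ yx R]] := @pick_end (Q 1) x.
    by case: (eqVneq x c) => [->|xc]; [exists d|exists c; rewrite 1?eq_sym].
  have [||w [cw w1 w2 _]] := put x y xQ yQ => //; first by rewrite eq_sym.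
  have [||v' [bl [br [ce]]]] := add_ends cw k1; rewrite ?w1 ?w2 //; last by exists 1, v', Q, bl, br.
  by case: L => [|no]; [left|right => u /no /negPf->].
have core1 x : x \in core G -> x = c.
  move=> xc; have c1 : clique [set x] by move=> a b /set1P-> /set1P->; rewrite eqxx.
  have [|B /Qb[i hi ->]] := sub_block (A := core G) _ (clique_nonseparable (set11 x) c1).
    by rewrite sub1set.
  have -> : i = 1 by lia.
  by rewrite sub1set => xQ; have := one x; rewrite /= xQ => /negbFE /eqP.
have cc : c \in core G := subsetP sQ c cQ.
have ch0 (w : nat -> G) : w 1 = c -> chain 0 w Q.
  move=> w1; split; rewrite ?w1 //; try by [move=> i; lia|move=> i j x; lia].
  - by move=> x /core1; left.
  - by move=> x y /core1-> /core1->; rewrite adj_irr.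
have hangE u : hangs u = adj c u.
  apply/idP/idP => [/andP[uL /core1 pu]|cu]; first by rewrite adj_sym parP // pu.
  have uL : u \in leaves G.
    by rewrite -[_ \in _]negbK -leaf_core; apply/negP => /core1 e; rewrite e adj_irr in cu.
  have pu : par u = c by apply/esym/eqP; rewrite -parP // adj_sym.
  by rewrite /hangs uL pu.
have pc u : hangs u -> par u = c by case/andP=> _ /core1.
(* An isolated [c] has no hanging leaves, two leaves of [c] can serve as the end leaves, and with
   exactly one neighbor [c] would itself be a leaf. *)
case: (ltngtP #|[set y | adj c y]| 1) => nc.
- have no u : hangs u -> False.
    rewrite hangE => cu; move: nc; rewrite ltnS leqn0 cards_eq0 => /eqP/setP/(_ u).
    by rewrite !inE cu.
  exists 0, (fun=> c), Q, false, false; split; first exact: ch0.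
  by split=> // _ u /no.
- case/card_gt1P: nc => u0 [u1 [h0 h1 u01]]; rewrite !inE -!hangE in h0 h1.
  exists 0, (fun i => if i == 0 then u0 else if i == 2 then u1 else c), Q, true, true.
  split; first exact: ch0.
  by split=> //= _; rewrite leaves_atE pc // eqxx; [case/andP: h0 => ->|case/andP: h1 => ->].
- by move: cc; rewrite leaf_core inE nc.
Qed.

End Bandwidth.

Section Bandwidth.
Variable G : sgraph.
Implicit Types (x y z u w : G).

(* The vertices left out are those of the components K_2, which are placed
   consecutively to the right of everything else. *)
Lemma extend_numbering (f : G -> int) (m : nat) : 0 < m ->
  {in [pred x | (x \in core G) || hangs x] &, injective f} ->
  (forall x y, (x \in core G) || hangs x -> (y \in core G) || hangs y -> adj x y ->
    `|f x - f y| <= m%:Z)%R ->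
  exists2 g : G -> int, injective g & width g <= m.
Proof.
move=> m0 fi fn; pose K x := (x \in core G) || hangs x.
pose M := \max_(x : G) `|f x|%N; pose r x : nat := enum_rank x.
(* Both vertices of a $K_2$ have the same minimum of ranks, and the comparison of their ranks adds 0
   to one and 1 to the other. *)
pose g x : int := if K x then f x
  else Posz (M + 1 + (2 * minn (r x) (r (par x)) + (r (par x) < r x))).
have fM x : (f x <= M)%R.
  have : `|f x|%N <= M by apply: (leq_bigmax (F := fun x => `|f x|%N)).
  by lia.
have ri : injective r by move=> x y /ord_inj /enum_rank_inj.
have out x : ~~ K x -> [/\ x \in leaves G, par x \in leaves G, par (par x) = x & ~~ K (par x)].
  rewrite /K negb_or leaf_core negbK => /andP[xL]; rewrite /hangs xL leaf_core negbK /= => pL.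
  have pp : par (par x) = x by apply/esym/eqP; rewrite -parP // adj_sym parP.
  by split; rewrite ?/K /hangs ?leaf_core ?pp ?leaf_core ?xL ?pL.
have gK x : K x -> g x = f x by rewrite /g => ->.
have gN x : ~~ K x -> g x = Posz (M + 1 + (2 * minn (r x) (r (par x)) + (r (par x) < r x))).
  by rewrite /g => /negPf->.
have apart x y : K x -> ~~ K y -> g x != g y.
  by move=> Kx Ky; rewrite (gK _ Kx) (gN _ Ky); have := fM x; clear; lia.
exists g.
  move=> x y e; case: (boolP (K x)) => Kx; case: (boolP (K y)) => Ky.
  - by apply: fi => //; rewrite -!gK.
  - by have := apart x y Kx Ky; rewrite e eqxx.
  - by have := apart y x Ky Kx; rewrite e eqxx.
  have [_ _ px _] := out x Kx; have [_ _ py _] := out y Ky; move: e.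
  rewrite (gN _ Kx) (gN _ Ky) => -[] e.
  have [e1|e1] : r x = r y \/ r (par x) = r (par y) by clear -e; lia.
    exact: ri.
  by rewrite -px -py (ri _ _ e1).
have half x y : ~~ K x -> adj x y -> (`|g x - g y| <= m%:Z)%R.
  move=> Kx; have [xL _ px Kp] := out x Kx; rewrite parP // => /eqP->.
  rewrite (gN _ Kx) (gN _ Kp) px minnC; set t := minn _ _; clear -m0; lia.
apply/width_leP => x y xy; case: (boolP (K x)) => Kx; last exact: half.
case: (boolP (K y)) => Ky; first by rewrite !gK //; apply: fn.
by rewrite distrC; apply: half; rewrite // adj_sym.
Qed.

Lemma bandwidth_caterpillar : block_caterpillar G -> bandwidth G = local_density G.
Proof.
move=> bc; have min (g : G -> int) : injective g -> bandwidth G <= width g.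
  rewrite /bandwidth; case: ex_minnP => b _ + gi; apply; apply/asboolP; by exists g.
apply/eqP; rewrite eqn_leq; apply/andP; split; last first.
  by rewrite /bandwidth; case: ex_minnP => b /asboolP[f fi <-] _; apply: density_le_width.
suff [g gi le] : exists2 g : G -> int, injective g & width g <= local_density G.
  exact: leq_trans (min g gi) le.
(* The layout needs [m] positive, which an edge guarantees; without edges every numbering has width
   0. *)
case: (pickP [pred p : G * G | adj p.1 p.2]) => [[x y] /= xy|no]; last first.
  exists (fun x => Posz (enum_rank x)); first by move=> x y [] /ord_inj /enum_rank_inj.
  by apply/width_leP => x y xy; have := no (x, y); rewrite /= xy.
have m1 := density_gt0 xy; have [k [v [Q [bl [br [ch en]]]]]] := chain_exists bc.
have pe : perm_eq (enum G) (enum G) by [].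
have [a [h ah]] := splits_exist (enum G) (local_density G) (sp k v bl br) (it k v bl br)
  (lf k v bl br) (bk k v Q bl br) (@par G).
apply: (extend_numbering m1 (cpos_inj ch en pe m1 (leqnn _) ah)) => x' y'.
exact: (cpos_near ch en pe m1 (leqnn _) ah).
Qed.

End Bandwidth.

Theorem theorem3 :
  (forall G : sgraph, block_caterpillar G -> bandwidth G = local_density G)
  /\ (forall (G : sgraph) (k : nat) (v : nat -> G) (Q : nat -> {set G})
             (m : int),
        block_caterpillar G -> connected [set: G] ->
        distinguished k v Q -> (Posz (local_density G) <= m)%R ->
        exists f : G -> int, left_justified k v Q m f)
  /\ (exists (P : cmd) (c : nat),
        forall (G : sgraph) (k : nat) (v : nat -> G) (Q : nat -> {set G})
               (m : int) (vs : seq G) (nb : G -> seq G),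
        block_caterpillar G -> connected [set: G] ->
        distinguished k v Q -> (Posz (local_density G) <= m)%R ->
        adjacency_lists vs nb ->
        exists (t : nat) (s : state),
          [/\ exec P (input vs nb k v m) t s,
              t <= c * graph_size G &
              left_justified k v Q m (output vs s)]).
Proof.
split; first exact: bandwidth_caterpillar.
split=> [G k v Q m bc con dq dm|].
  (* Existence is read off from a run of the program on the canonical adjacency lists. *)
  have al : adjacency_lists (enum G) (fun x => enum [set y | adj x y]) by split.
  have [t [s [_ _ lj]]] := layout_correct bc con dq dm al.
  by exists (output (enum G) s).
by exists layout_cmd, 406 => G k v Q m vs nb bc con dq dm al; apply: layout_correct.
Qed.
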